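(* Let $\Omega$ and $\Lambda$ be non-empty sets, $v\colon\Lambda\to(0,\infty)$, $(E,\|\cdot\|_E)$ a normed space over $\mathbb{K}$, $\mathcal{G}(\Omega)$ a linear subspace of $\mathbb{K}^\Omega$, $\mathcal{G}(\Omega,E)$ a linear subspace of $E^\Omega$, $q\colon\mathcal{G}(\Omega)\to[0,\infty)$ and $q^E\colon\mathcal{G}(\Omega,E)\to[0,\infty)$ seminorms, $T\colon\mathcal{G}(\Omega)\to\mathbb{K}^\Lambda$ and $T^E\colon\mathcal{G}(\Omega,E)\to E^\Lambda$ linear maps. Put \[ \mathcal{F}v(\Omega,E):=\Bigl\{f\in\mathcal{G}(\Omega,E):\|f\|^E:=q^E(f)+\sup_{x\in\Lambda}\|T^E(f)(x)\|_Ev(x)<\infty\Bigr\}, \] \[ \mathcal{F}v(\Omega):=\Bigl\{f\in\mathcal{G}(\Omega):\|f\|:=q(f)+\sup_{x\in\Lambda}|T(f)(x)|v(x)<\infty\Bigr\}, \] and suppose that $(\mathcal{F}v(\Omega),\|\cdot\|)$ is a normed space and that (i) $e^*\circ f\in\mathcal{F}v(\Omega)$ and $e^*\circ (T^E(f))=T(e^*\circ f)$ for all $e^*\in E^*$ and $f\in\mathcal{F}v(\Omega,E)$, (ii) $q^E(f)=\sup_{e^*\in B_{\|\cdot\|_{E^*}}}q(e^*\circ f)$ for all $f\in\mathcal{F}v(\Omega,E)$. Then the following assertions hold. (a) $\mathcal{F}v(\Omega,E)$ is a linear subspace of $\mathcal{F}v(\Omega,E)_\sigma$ and $\|\cdot\|_\sigma^E\le\|\cdot\|^E\le2\|\cdot\|_\sigma^E$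 on $\mathcal{F}v(\Omega,E)$. In particular, $\|\cdot\|^E$ is a norm on $\mathcal{F}v(\Omega,E)$. If $q=0$, then $\|\cdot\|_\sigma^E=\|\cdot\|^E$ on $\mathcal{F}v(\Omega,E)$. Suppose for (b)--(d) that $\mathcal{S}$ is a family of subsets of $\Lambda$ that is closed under finite unions with $\Lambda=\bigcup_{S\in\mathcal{S}}S$, and that $(\mathcal{F}v(\Omega),\|\cdot\|,\tau_{\mathcal{S}})$ is semi-Montel, where $\tau_{\mathcal{S}}:=\tau_{\mathcal{S}}^{\mathbb{K}}$. (b) Then $\gamma_{\mathrm{s}}(\|\cdot\|^E,\tau_{\mathcal{S}}^E)=\gamma_{\mathrm{s}}(\|\cdot\|_\sigma^E,\tau_{\mathcal{S},\sigma}^E)$ on $\mathcal{F}v(\Omega,E)$, where $\tau_{\mathcal{S},\sigma}^E:=(\tau_{\mathcal{S}})_\sigma^E$. (c) If $\tau_{\mathrm{p}}\le\tau_{\mathcal{S}}$, $\mathcal{F}v(\Omega,E)=\mathcal{F}v(\Omega,E)_\sigma$ (as linear spaces) and $E$ is a Banach space, then $(\mathcal{F}v(\Omega,E),\gamma_{\mathrm{s}}(\|\cdot\|^E,\tau_{\mathcal{S}}^E))$ and the Saks space $(\mathcal{F}v(\Omega,E),\|\cdot\|^E,\tau_{\mathcal{S}}^E)$ are complete. (d) If $\Lambda$ is a completely regular Hausdorff space, $\mathcal{S}=\mathcal{K}_\Lambda$ and $\mathcal{W}_0:=\mathcal{W}^+_{\mathrm{b},0}(\Lambda)$ or $\mathcal{W}_0:=\mathcal{W}^+_{\mathrm{usc},0}(\Lambda)$,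 then $\gamma_{\mathrm{s}}(\|\cdot\|^E,\tau_{\mathcal{K}_\Lambda}^E)$ is generated by the system of seminorms $(|\cdot|_w^E)_{w\in\mathcal{W}_0}$, where \[|f|_w^E:=\sup_{x\in\Lambda}\bigl(q^E(f)+\|T^E(f)(x)\|_Ev(x)\bigr)w(x),\quad f\in\mathcal{F}v(\Omega,E).\] If $\Lambda$ is locally compact, we may replace $\mathcal{W}_0$ by $\mathcal{C}_0^+(\Lambda)$.
   Context: $\mathbb{K}\in\{\mathbb{R},\mathbb{C}\}$; for topologies $\le$ means ''coarser than (or equal to)''. $E^\Lambda$ is the space of all functions $\Lambda\to E$; $E^*$ is the norm dual of $E$ with closed unit ball $B_{\|\cdot\|_{E^*}}$. Suprema of non-negative quantities over the empty set are $0$. Saks spaces. Let $(X,\|\cdot\|)$ be a normed space and $\tau\le\tau_{\|\cdot\|}$ a locally convex Hausdorff topology on $X$. The mixed topology $\gamma(\|\cdot\|,\tau)$ is the finest linear topology on $X$ that coincides with $\tau$ on $\|\cdot\|$-bounded sets and lies between $\tau$ and $\tau_{\|\cdot\|}$; it is locally convex Hausdorff. $(X,\|\cdot\|,\tau)$ is a Saks space if there is a directed system $\Gamma_\tau$ of continuous seminorms generating $\tau$ with $\|x\|=\sup_{q\in\Gamma_\tau}q(x)$ for all $x$. The submixed topology $\gamma_{\mathrm{s}}(\|\cdot\|,\tau)$ is generated by the seminorms $x\mapsto\sup_{n\in\mathbb{N}}q_n(x)a_n$ with $(q_n)_{n\in\mathbb{N}}\subset\Gamma_\tau$ and $(a_n)_{n\in\mathbb{N}}$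 a real non-negative null-sequence (independent of the choice of such $\Gamma_\tau$). A Saks space is complete (semi-Montel) if $(X,\gamma)$ is complete (a semi-Montel space, i.e. bounded sets are relatively compact). Topologies $\tau_{\mathcal{S}}^E$. For $\mathcal{S}$ as in the claim, $\tau_{\mathcal{S}}^E$ is the locally convex Hausdorff topology on $\mathcal{F}v(\Omega,E)$ generated by the directed system of seminorms $q_S^E(f):=q^E(f)+\sup_{x\in S}\|T^E(f)(x)\|_Ev(x)$, $S\in\mathcal{S}$; $\tau_{\mathcal{S}}^{\mathbb{K}}$ is the same for $E=\mathbb{K}$, $q^{\mathbb{K}}=q$, $T^{\mathbb{K}}=T$, with seminorms $q_S^{\mathbb{K}}$. $\tau_{\mathrm{p}}$ is the topology of pointwise convergence on $\mathcal{F}v(\Omega)\subset\mathbb{K}^\Omega$. Weak versions. $\mathcal{F}v(\Omega,E)_\sigma:=\{f\colon\Omega\to E: e^*\circ f\in\mathcal{F}v(\Omega)\text{ for all }e^*\in E^*\}$, $\|f\|_\sigma^E:=\sup_{e^*\in B_{\|\cdot\|_{E^*}}}\|e^*\circ f\|$, and $(\tau_{\mathcal{S}})_\sigma^E$ is generated by the seminorms $f\mapsto\sup_{e^*\in B_{\|\cdot\|_{E^*}}}q_S^{\mathbb{K}}(e^*\circ f)$, $S\in\mathcal{S}$. Under (i) and (ii) these quantities are finite on $\mathcal{F}v(\Omega,E)$; ''$\gamma_{\mathrm{s}}(\|\cdot\|_\sigma^E,\tau_{\mathcal{S},\sigma}^E)$ on $\mathcal{F}v(\Omega,E)$'' is the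 topology on $\mathcal{F}v(\Omega,E)$ generated by the restrictions of the seminorms $f\mapsto\sup_{n}\sup_{e^*\in B_{\|\cdot\|_{E^*}}}q_{S_n}^{\mathbb{K}}(e^*\circ f)a_n$, with $(S_n)_{n\in\mathbb{N}}$ in $\mathcal{S}$ and $(a_n)_{n\in\mathbb{N}}$ a non-negative null-sequence. Weights. $\mathcal{K}_\Lambda$ is the family of compact subsets of $\Lambda$. A function $w\colon\Lambda\to[0,\infty)$ vanishes at infinity if $\{x\in\Lambda:w(x)\ge\varepsilon\}$ is compact for every $\varepsilon>0$; $\mathcal{W}^+_{\mathrm{b},0}(\Lambda)$, $\mathcal{W}^+_{\mathrm{usc},0}(\Lambda)$, $\mathcal{C}_0^+(\Lambda)$ are the families of bounded, upper semicontinuous, resp. continuous functions $w\colon\Lambda\to[0,\infty)$ vanishing at infinity. *)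

(* Defs.v *)
From HB Require Import structures.
From mathcomp Require Import all_boot all_order all_algebra.
From mathcomp Require Import complex.
From mathcomp Require Import all_classical all_reals all_analysis.

Set Implicit Arguments.
Unset Strict Implicit.
Unset Printing Implicit Defensive.
Import Order.TTheory GRing.Theory Num.Theory.
Import numFieldNormedType.Exports.
Local Open Scope classical_set_scope.
Local Open Scope ring_scope.
Local Open Scope ereal_scope.

Variant scalar_kind := RealScalars | ComplexScalars.

Definition scalars (R : realType) (k : scalar_kind) : numFieldType :=
  match k with
  | RealScalars => R : numFieldType
  | ComplexScalars => R[i] : numFieldType
  end.

Definition scalar_re (R : realType) (k : scalar_kind) : scalars R k -> R :=
  match k with
  | RealScalars => id
  | ComplexScalars => @complex.Re R
  end.

(* The library norm of a space over R[i] takes its values in the nonnegative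
   reals of R[i]; [rnorm] is the same norm with values in R. *)
Definition rnorm (R : realType) (k : scalar_kind)
    (V : normedZmodType (scalars R k)) (x : V) : R :=
  scalar_re `|x|%R.

(* The supremum of nonnegative quantities, which is 0 over the empty set. *)
Definition nnsup (R : realType) (I : Type) (A : set I) (F : I -> \bar R) :
    \bar R :=
  ereal_sup (0 |` (F @` A)).

Section rnorm_theory.
Context (R : realType) (k : scalar_kind).
Local Notation K := (scalars R k).

Lemma scalar_re_is_additive : zmod_morphism (@scalar_re R k).
Proof. by case: k => //= -[a b] [c d]. Qed.

Lemma scalar_re_ge0 (a : K) : (0 <= a)%R -> (0 <= scalar_re a)%R.
Proof. by case: k a => //= -[a b]; rewrite lecE => /andP[]. Qed.

Lemma scalar_reM (a b : K) : (0 <= a)%R ->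
  scalar_re (a * b)%R = (scalar_re a * scalar_re b)%R.
Proof.
case: k a b => //= -[a1 a2] [b1 b2]; rewrite lecE => /andP[/eqP/= -> _].
by rewrite mul0r subr0.
Qed.

Lemma le_scalar_re (a b : K) : (a <= b)%R -> (scalar_re a <= scalar_re b)%R.
Proof.
by rewrite -subr_ge0 => /scalar_re_ge0; rewrite scalar_re_is_additive subr_ge0.
Qed.

Lemma scalar_reD (a b : K) :
  scalar_re (a + b)%R = (scalar_re a + scalar_re b)%R.
Proof. by case: k a b => //= -[a1 a2] [b1 b2]. Qed.

Lemma rnorm_ge0 (V : normedZmodType K) (x : V) : (0 <= rnorm x)%R.
Proof. by apply: scalar_re_ge0; exact: normr_ge0. Qed.

Lemma rnorm0 (V : normedZmodType K) : rnorm (0 : V)%R = 0%R.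
Proof. by rewrite /rnorm normr0; case: k. Qed.

Lemma ler_rnormD (V : normedZmodType K) (x y : V) :
  (rnorm (x + y) <= rnorm x + rnorm y)%R.
Proof. by rewrite /rnorm -scalar_reD; apply: le_scalar_re; exact: ler_normD. Qed.

Lemma rnormZ (V : normedModType K) (a : K) (x : V) :
  rnorm (a *: x)%R = (rnorm a * rnorm x)%R.
Proof. by rewrite /rnorm normrZ scalar_reM. Qed.

End rnorm_theory.

Lemma nnsup_leP (R : realType) (I : Type) (A : set I) (F : I -> \bar R)
    (y : \bar R) : 0 <= y ->
  nnsup A F <= y <-> forall i, A i -> F i <= y.
Proof.
move=> y0; split=> [+ i Ai|Fy].
  by apply: le_trans; apply: ereal_sup_ubound; right; exists i.
by apply: ge_ereal_sup => _ [->//|[i Ai <-]]; exact: Fy.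
Qed.

Section topologies.

Record topology (T : Type) := Topology {
  opens : set_system T ;
  opens_setT : opens setT ;
  opens_setI : setI_closed opens ;
  opens_bigU : forall (I : Type) (f : I -> set T),
    (forall i, opens (f i)) -> opens (\bigcup_i f i)
}.

(* The set T equipped with the topology t. *)
Definition tspace (T : Type) (t : topology T) : Type := T.

HB.instance Definition _ (T : choiceType) (t : topology T) :=
  Choice.on (tspace t).
HB.instance Definition _ (T : choiceType) (t : topology T) :=
  isOpenTopological.Build (tspace t)
    (opens_setT t) (@opens_setI T t) (@opens_bigU T t).
HB.instance Definition _ (K : numFieldType) (X : lmodType K)
  (t : topology X) := GRing.Lmodule.on (tspace t).

Lemma topology_eqP (T : Type) (t1 t2 : topology T) :
  opens t1 = opens t2 -> t1 = t2.
Proof.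
case: t1 t2 => [u1 a1 b1 c1] [u2 a2 b2 c2] /= eo; subst u2.
by congr Topology; exact: Prop_irrelevance.
Qed.

(* t1 is coarser than (or equal to) t2. *)
Definition coarser (T : Type) (t1 t2 : topology T) : Prop :=
  opens t1 `<=` opens t2.

Definition topology_of (T : topologicalType) : topology T :=
  Topology (@openT T) (@openI T) 
    (fun (I : Type) (f : I -> set T) fo => bigcup_open (fun i _ => fo i)).

Definition sup_of (T : choiceType) (C : set (topology T)) : topology T :=
  topology_of (sup_topology
    (fun t : {t | C t} => Topological.class (tspace (sval t)) : Topological T)).

Lemma coarserP (T : choiceType) (t1 t2 : topology T) :
  coarser t1 t2 <->
  forall x : T, nbhs (x : tspace t1) `<=` nbhs (x : tspace t2).
Proof.
split=> [t12 x A|t12 U oU].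
  rewrite (@nbhsE (tspace t1)) (@nbhsE (tspace t2)) => -[B [oB Bx] BA].
  by exists B => //; split=> //; exact: (t12 B oB).
suff : @open (tspace t2) U by [].
rewrite (@openE (tspace t2)) => x Ux; apply: t12.
exact: (@open_nbhs_nbhs (tspace t1) x U (conj oU Ux)).
Qed.

Lemma cvg_sup_of (T : choiceType) (C : set (topology T)) (F : set_system T)
    (x : T) : Filter F ->
  F --> (x : tspace (sup_of C)) <->
  forall t, C t -> F --> (x : tspace t).
Proof.
move=> FF; pose S : topologicalType := sup_topology (fun t : {t | C t} =>
  Topological.class (tspace (sval t)) : Topological T).
have nbhs_sup : nbhs (x : tspace (sup_of C)) = @nbhs _ S x.
  apply/funext => A.
  have e1 : nbhs (x : tspace (sup_of C)) A =
      exists2 B, @open_nbhs (tspace (sup_of C)) x B & B `<=` A.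
    by rewrite nbhsE.
  have e2 : @nbhs _ S x A = exists2 B, @open_nbhs S x B & B `<=` A.
    by rewrite nbhsE.
  exact: (etrans e1 (esym e2)).
rewrite /cvg_to nbhs_sup; split.
  by move=> /cvg_sup Fx t Ct; exact: (Fx (exist _ t Ct)).
by move=> Fx; apply/cvg_sup => -[t Ct]; exact: Fx.
Qed.

End topologies.

Section saks_spaces.
Context (R : realType) (k : scalar_kind).
Local Notation K := (scalars R k).

(* Seminorms take their values in the extended reals, so that suprema need no
   default value; finiteness is part of the definition. *)
Definition seminorm_on (V : lmodType K) (A : set V) (p : V -> \bar R) : Prop :=
  [/\ forall x, A x -> 0 <= p x < +oo,
      forall (a : K) x, A x -> p (a *: x)%R = (rnorm a)%:E * p x &
      forall x y, A x -> A y -> p (x + y)%R <= p x + p y].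

Context (X : lmodType K).
Implicit Types (p q nrm : X -> \bar R) (P Gamma : set (X -> \bar R))
  (t tau g : topology X).

Definition seminorm p : Prop := seminorm_on [set: X] p.

Definition is_norm p : Prop := seminorm p /\ forall x, p x = 0 -> x = 0%R.

Definition directed P : Prop :=
  P !=set0 /\ forall p q, P p -> P q ->
    exists2 r, P r & forall x, p x <= r x /\ q x <= r x.

Definition seminorm_open P : set_system X := [set U | forall x, U x ->
  exists Q : set (X -> \bar R), [/\ finite_set Q, Q `<=` P &
    exists2 e : R, (0 < e)%R &
      [set y | forall q, Q q -> q (y - x)%R < e%:E] `<=` U]].

Lemma seminorm_openT P : seminorm_open P setT.
Proof.
move=> x _; exists set0; split; [exact: finite_set0|exact: sub0set|].
by exists 1%R.
Qed.

Lemma seminorm_openI P : setI_closed (seminorm_open P).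
Proof.
move=> U V oU oV x [Ux Vx].
have [Q [Qfin QP [e e0 QU]]] := oU x Ux.
have [Q' [Qfin' QP' [e' e0' QV]]] := oV x Vx.
exists (Q `|` Q'); split; first by rewrite finite_setU.
  by rewrite subUset.
exists (Num.min e e'); first by rewrite lt_min e0.
move=> y /= yQ; split; [apply: QU|apply: QV] => q Qq /=.
  by apply: (lt_le_trans (yQ q _)); [left|rewrite lee_fin ge_min lexx].
by apply: (lt_le_trans (yQ q _)); [right|rewrite lee_fin ge_min lexx orbT].
Qed.

Lemma seminorm_open_bigU P (I : Type) (f : I -> set X) :
  (forall i, seminorm_open P (f i)) -> seminorm_open P (\bigcup_i f i).
Proof.
move=> fo x [i _ fix_]; have [Q [Qfin QP [e e0 Qf]]] := fo i x fix_.
exists Q; split=> //; exists e => //.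
by apply: (subset_trans Qf); exact: bigcup_sup.
Qed.

Definition seminorm_topology P : topology X :=
  Topology (@seminorm_openT P) (@seminorm_openI P) (@seminorm_open_bigU P).

Definition norm_topology nrm : topology X := seminorm_topology [set nrm].

Definition norm_bounded nrm (B : set X) : Prop :=
  exists r : R, forall x, B x -> nrm x <= r%:E.

Definition linear_topology t : Prop :=
  continuous (fun z : tspace t * tspace t => (z.1 + z.2)%R : tspace t) /\
  continuous (fun z : K^o * tspace t => (z.1 *: z.2)%R : tspace t).

Definition coincide_on (B : set X) t1 t2 : Prop :=
  [set B `&` U | U in opens t1] = [set B `&` U | U in opens t2].

Definition mixed_candidate nrm tau g : Prop :=
  [/\ linear_topology g, coarser tau g, coarser g (norm_topology nrm) &
      forall B, norm_bounded nrm B -> coincide_on B g tau].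

(* The supremum of all candidates is itself a candidate
   ([mixed_topologyP] below), that is, the finest one. *)
Definition mixed_topology nrm tau : topology X :=
  sup_of (mixed_candidate nrm tau).

Lemma mixed_topologyP nrm tau :
  linear_topology tau -> coarser tau (norm_topology nrm) ->
  mixed_candidate nrm tau (mixed_topology nrm tau) /\
  forall g, mixed_candidate nrm tau g -> coarser g (mixed_topology nrm tau).
Proof.
move=> lin_tau tau_nrm; set m := mixed_topology nrm tau.
have finest g : mixed_candidate nrm tau g -> coarser g m.
  move=> Cg; apply/coarserP => x.
  exact: (cvg_sup_of (mixed_candidate nrm tau) x
    (nbhs_filter (x : tspace m))).1 cvg_id g Cg.
have Ctau : mixed_candidate nrm tau tau by split.
split; last exact: finest.
split; [split| | |].
- move=> z; apply/cvg_sup_of => g Cg.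
  have [[add_g _] _ _ _] := Cg; move/coarserP: (finest g Cg) => gm.
  move=> A /(add_g (z : tspace g * tspace g)) [[U V] [/= /gm Uz /gm Vz] UVA].
  by exists (U, V).
- move=> z; apply/cvg_sup_of => g Cg.
  have [[_ scale_g] _ _ _] := Cg; move/coarserP: (finest g Cg) => gm.
  move=> A /(scale_g (z : K^o * tspace g)) [[U V] [/= Uz /gm Vz] UVA].
  by exists (U, V).
- exact: finest.
- apply/coarserP => x.
  apply: (cvg_sup_of _ x
    (nbhs_filter (x : tspace (norm_topology nrm)))).2 => g [_ _ + _].
  by move=> /coarserP; exact.
- move=> B Bbd; rewrite /coincide_on eqEsubset; split; last first.
    by move=> _ [U oU <-]; exists U => //; exact: (finest tau Ctau U oU).
  move=> _ [U oU <-].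
  pose W := [set V | opens tau V /\ B `&` V `<=` U].
  exists (\bigcup_(V in W) V).
    have : @open (tspace tau) (\bigcup_(V in W) V).
      by apply: bigcup_open => V [].
    by [].
  rewrite eqEsubset; split=> x [Bx].
    by move=> [V [_ VU] Vx]; split=> //; exact: VU.
  move=> Ux; split=> //.
  have Um : nbhs (x : tspace m) U.
    exact: (@open_nbhs_nbhs (tspace m) x U (conj oU Ux)).
  have : within B (nbhs (x : tspace tau)) U.
    apply: ((cvg_sup_of (mixed_candidate nrm tau) x
      (within_filter B (nbhs_filter (x : tspace tau)))).2 _ U Um).
    move=> g [_ _ _ gB] A.
    rewrite (@nbhsE (tspace g)) => -[G [oG Gx] GA].
    have : [set B `&` V | V in opens g] (B `&` G) by exists G.
    rewrite (gB B Bbd) => -[V oV BVG].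
    have Vx : V x by have : (B `&` G) x by []; rewrite -BVG => -[].
    rewrite /within /= (@nbhsE (tspace tau)); exists V => //.
    by move=> y Vy By; apply: GA; have : (B `&` V) y by []; rewrite BVG => -[].
  rewrite /within /= (@nbhsE (tspace tau)) => -[V [oV Vx] VU].
  by exists V => //; split=> // y [By Vy]; exact: VU.
Qed.

(* The members of Gamma are continuous for tau since they generate it. *)
Definition saks_system nrm tau Gamma : Prop :=
  [/\ forall q, Gamma q -> seminorm q,
      directed Gamma,
      tau = seminorm_topology Gamma &
      forall x, nrm x = nnsup Gamma (fun q => q x)].

Definition saks_space nrm tau : Prop :=
  [/\ is_norm nrm,
      hausdorff_space (tspace tau),
      coarser tau (norm_topology nrm) &
      exists Gamma, saks_system nrm tau Gamma].

(* The submixed topology computed from the given directed system of seminorms: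
   it refers to Gamma rather than to the topology that Gamma generates. *)
Definition submixed_topology Gamma : topology X := seminorm_topology
  [set p | exists (q : (X -> \bar R)^nat) (a : R^nat),
    [/\ forall n, Gamma (q n), forall n, (0 <= a n)%R, a @ \oo --> 0%R &
        p = fun x => nnsup [set: nat] (fun n => q n x * (a n)%:E)]].

Definition tvs_cauchy t (F : set_system X) : Prop :=
  forall U : set X, nbhs (0%R : tspace t) U ->
    exists2 A : set X, F A & forall x y, A x -> A y -> U (x - y)%R.

Definition tvs_complete t : Prop :=
  forall F : set_system X, ProperFilter F -> tvs_cauchy t F ->
    exists x : X, F --> (x : tspace t).

Definition tvs_bounded t (B : set X) : Prop :=
  forall U : set X, nbhs (0%R : tspace t) U ->
    exists2 r : R, (0 < r)%R &
      forall a : K, (r <= rnorm a)%R -> B `<=` [set (a *: u)%R | u in U].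

Definition semi_montel t : Prop :=
  forall B : set X, tvs_bounded t B -> precompact (B : set (tspace t)).

Definition complete_saks_space nrm tau : Prop :=
  saks_space nrm tau /\ tvs_complete (mixed_topology nrm tau).

Definition semi_montel_saks_space nrm tau : Prop :=
  saks_space nrm tau /\ semi_montel (mixed_topology nrm tau).

End saks_spaces.

Section weighted_spaces.
Context (R : realType) (k : scalar_kind).
Local Notation K := (scalars R k).
Context (Omega Lambda : Type).

(* A linear subspace G of E^Omega with a seminorm q and a linear map T on G;
   q and T are total functions of which only the values on G matter. *)
Record weighted_data (E : normedModType K) := WeightedData {
  wdom : set (Omega -> E) ;
  wsem : (Omega -> E) -> R ;
  wop : (Omega -> E) -> (Lambda -> E) ;
  wdom_submod : submod_closed [in wdom] ;
  wsem_seminorm : seminorm_on wdom (fun f => (wsem f)%:E) ;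
  wop_linear : forall (a : K) f g, wdom f -> wdom g ->
    wop (a *: f + g)%R = (a *: wop f + wop g)%R
}.

Section weighted_space.
Context (E : normedModType K) (D : weighted_data E) (v : Lambda -> {posnum R}).

(* q(f) + sup_(x in S) ||T(f)(x)|| v(x) *)
Definition wseminorm (S : set Lambda) (f : Omega -> E) : \bar R :=
  (wsem D f)%:E + nnsup S (fun x => (rnorm (wop D f x) * (v x)%:num)%:E).

Definition wnorm : (Omega -> E) -> \bar R := wseminorm setT.

(* sup_x (q(f) + ||T(f)(x)|| v(x)) w(x) *)
Definition wseminorm_weight (w : Lambda -> R) (f : Omega -> E) : \bar R :=
  nnsup [set: Lambda] (fun x =>
    ((wsem D f + rnorm (wop D f x) * (v x)%:num) * w x)%:E).

Definition Fv : set (Omega -> E) := [set f | wdom D f /\ wnorm f < +oo].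

Lemma Fv_submod : submod_closed [in Fv].
Proof.
split=> [|a f g]; rewrite !inE.
  have := wdom_submod D => -[+ _]; rewrite inE => dom0; split=> //.
  rewrite /wnorm /wseminorm lte_add_pinfty ?ltry//.
  suff op0 : wop D 0%R = 0%R.
    apply: (@le_lt_trans _ _ 0); last by rewrite ltry.
    by apply/nnsup_leP => // x _; rewrite op0 rnorm0 mul0r.
  have := @wop_linear _ D 1%R 0%R 0%R dom0 dom0.
  rewrite !scale1r addr0 => /(congr1 (fun h => h - wop D 0)%R).
  by rewrite subrr addrK => <-.
move=> [domf nf] [domg ng].
have domfg : wdom D (a *: f + g)%R.
  have [_ /(_ a f g)] := wdom_submod D.
  by rewrite !inE => /(_ domf domg).
split=> //; rewrite /wnorm /wseminorm lte_add_pinfty ?ltry//.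
pose s h := nnsup setT (fun x => (rnorm (wop D h x) * (v x)%:num)%:E).
have s_fin h : wnorm h < +oo -> exists2 M : R, (0 <= M)%R &
    forall x, (rnorm (wop D h x) * (v x)%:num <= M)%R.
  rewrite /wnorm /wseminorm -/(s h) => nh.
  have s0 : 0 <= s h by apply: ereal_sup_ubound; left.
  have sfin : s h \is a fin_num.
    rewrite ge0_fin_numE//; case: (s h) s0 nh => [r _ _| _ |] //.
    by rewrite ltry.
  exists (fine (s h)); first exact: fine_ge0.
  move=> x; rewrite -lee_fin fineK//.
  by have /nnsup_leP := lexx (s h); apply.
have [M M0 Mf] := s_fin f nf; have [N N0 Ng] := s_fin g ng.
apply: (@le_lt_trans _ _ (rnorm a * M + N)%:E); last by rewrite ltry.
apply/nnsup_leP => [|x _].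
  by rewrite lee_fin addr_ge0// mulr_ge0// rnorm_ge0.
rewrite lee_fin wop_linear// fctE.
apply: (@le_trans _ _
  ((rnorm a * rnorm (wop D f x) + rnorm (wop D g x)) * (v x)%:num)%R).
  by rewrite ler_pM2r// -rnormZ ler_rnormD.
by rewrite mulrDl -mulrA lerD// ler_wpM2l ?rnorm_ge0.
Qed.

(* The vector space underlying the subset Fv. *)
Record weighted_space : Type := WeightedSpace {
  wfun :> Omega -> E ;
  wfunP : wfun \in Fv
}.

HB.instance Definition _ := [isSub for wfun].
HB.instance Definition _ := [Choice of weighted_space by <:].
HB.instance Definition _ :=
  GRing.SubChoice_isSubLmodule.Build K (Omega -> E) [in Fv] weighted_space
    (GRing.submod_closed_semi Fv_submod).

Definition weighted_norm (f : weighted_space) : \bar R := wnorm f.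

(* The system of the seminorms q_S, S in SS, which generates tau_SS. *)
Definition tau_system (SS : set (set Lambda)) :
    set (weighted_space -> \bar R) :=
  [set (fun f : weighted_space => wseminorm S f) | S in SS].

Definition tau_topology (SS : set (set Lambda)) : topology weighted_space :=
  seminorm_topology (tau_system SS).

Definition weight_topology (W : set (Lambda -> R)) : topology weighted_space :=
  seminorm_topology
    [set (fun f : weighted_space => wseminorm_weight w f) | w in W].

Definition pointwise_topology : topology weighted_space :=
  topology_of
    (initial_topology (fun f : weighted_space => (f : {ptws Omega -> E}))).

End weighted_space.

Section weak_versions.
Context (E : normedModType K).

Definition norm_dual : set {linear E -> K^o} :=
  [set e | continuous (e : E -> K^o)].

Definition dual_norm (e : {linear E -> K^o}) : \bar R :=
  nnsup [set x : E | (rnorm x <= 1)%R] (fun x => (rnorm (e x))%:E).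

Definition dual_ball : set {linear E -> K^o} :=
  [set e | norm_dual e /\ dual_norm e <= 1].

Context (D : weighted_data K^o) (v : Lambda -> {posnum R}).

Definition Fv_sigma : set (Omega -> E) :=
  [set f : Omega -> E | forall e, norm_dual e -> Fv D v (e \o f)].

Definition wseminorm_sigma (S : set Lambda) (f : Omega -> E) : \bar R :=
  nnsup dual_ball (fun e => wseminorm D v S (e \o f)).

Definition wnorm_sigma (f : Omega -> E) : \bar R :=
  nnsup dual_ball (fun e => wnorm D v (e \o f)).

(* The seminorms generating (tau_SS)_sigma, restricted to the space given by
   DE. *)
Definition sigma_system (DE : weighted_data E) (SS : set (set Lambda)) :
    set (weighted_space DE v -> \bar R) :=
  [set (fun f : weighted_space DE v => wseminorm_sigma S f) | S in SS].

End weak_versions.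

End weighted_spaces.

Arguments weighted_norm {R k Omega Lambda E} D v f.
Arguments tau_system {R k Omega Lambda E} D v SS.
Arguments tau_topology {R k Omega Lambda E} D v SS.
Arguments weight_topology {R k Omega Lambda E} D v W.
Arguments pointwise_topology {R k Omega Lambda E} D v.
Arguments norm_dual {R k} E.
Arguments dual_ball {R k} E.
Arguments Fv_sigma {R k Omega Lambda} E D v.
Arguments sigma_system {R k Omega Lambda E} D v DE SS.

Section weights.
Context (R : realType) (Lambda : choiceType) (t : topology Lambda).

Definition vanishes_at_infinity (w : Lambda -> R) : Prop :=
  forall e : R, (0 < e)%R -> compact ([set x | (e <= w x)%R] : set (tspace t)).

Definition weights_b0 : set (Lambda -> R) := [set w |
  [/\ forall x, (0 <= w x)%R, exists M : R, forall x, (w x <= M)%R &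
      vanishes_at_infinity w]].

(* Upper semicontinuity of w is lower semicontinuity of - w. *)
Definition weights_usc0 : set (Lambda -> R) := [set w |
  [/\ forall x, (0 <= w x)%R,
      lower_semicontinuous (fun x : tspace t => (- w x)%:E) &
      vanishes_at_infinity w]].

Definition weights_c0 : set (Lambda -> R) := [set w |
  [/\ forall x, (0 <= w x)%R, continuous (w : tspace t -> R) &
      vanishes_at_infinity w]].

End weights.

(* Main.v *)
Require Import Defs.
From HB Require Import structures.
From mathcomp Require Import all_boot all_order all_algebra.
From mathcomp Require Import complex.
From mathcomp Require Import all_classical all_reals all_analysis.
From mathcomp Require Import ring lra.

Set Implicit Arguments.
Unset Strict Implicit.
Unset Printing Implicit Defensive.
Import Order.TTheory GRing.Theory Num.Theory.
Import numFieldNormedType.Exports.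
Local Open Scope classical_set_scope.
Local Open Scope ring_scope.
Local Open Scope ereal_scope.

(* For f in Fv(Omega, E) and S a subset of Lambda, the Hahn-Banach theorem and
   (ii) show that the strong seminorm q_S(f) lies between the supremum over the
   dual unit ball of q_S(e o f) and twice this supremum; (a) and (b) follow.

   For (c), the unit ball of Fv(Omega) is tau_S-compact, since it is bounded for
   the mixed topology.  A Banach-Dieudonne argument then bounds every seminorm
   that is continuous for the mixed topology by a submixed one, and it follows
   that the submixed topology of Fv(Omega) is complete: otherwise a Cauchy filter
   would stay away from every ball, and the gauges measuring this would have a
   supremum that is continuous for the mixed topology.  A submixed Cauchy filter on
   Fv(Omega, E) converges pointwise to some f, and e o f is the limit of its image
   under e, so that f is in Fv(Omega, E)_sigma = Fv(Omega, E).  The mixed topology is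
   generated by the infimal convolutions p of sequences ||.|| / (n + 1) + q_n with
   q_n increasing and tau_S-continuous, and the tau_S-closure of {p < 1} lies in
   {p <= 5}; hence a mixed Cauchy filter that converges for tau_S converges for
   the mixed topology.

   For (d), a weight w is compared with the compact level sets of w, and a null
   sequence a_n with compact sets K_n is dominated by the weight sup_n a_n 1_(K_n),
   where 1_(K_n) is replaced by a bump function in the locally compact case. *)

(** * Scalars and real suprema *)

(** The factor 2 comes from the two summands of the norm: (ii) controls [q] and a norming functional
    controls each value of [T], but the functionals attaining the two bounds may differ.

    In (c) compactness is available for the scalar space only. The balls of Fv(Omega, E) need not be
    relatively compact, so the Banach-Dieudonne argument does not compare the two topologies there,
    and completeness for the mixed topology is not read off from a submixed limit alone. What
    bridges the gap is a base at 0 that is stable under tau_S-closure up to a constant. Since the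
    mixed topology is given only as a finest linear topology, this base has to be built from
    neighbourhoods [W n] with [W n.+1 + W n.+1] inside [W n].

    The gauge attached to the ball {N <= n + 1} is at most N / (n + 1). On a bounded set all but
    finitely many gauges are therefore small, which is why their supremum is still continuous for
    the mixed topology. *)

Section scalar_theory.
Local Open Scope ring_scope.
Context (R : realType) (k : scalar_kind).
Local Notation K := (scalars R k).

Definition of_real : R -> K :=
  match k return R -> scalars R k with
  | RealScalars => id
  | ComplexScalars => fun r => (r%:C)%C
  end.

Lemma ler_of_real (a b : R) : (of_real a <= of_real b) = (a <= b).
Proof. by rewrite /of_real; case: k => //=; rewrite lecR. Qed.

Lemma ltr_of_real (a b : R) : (of_real a < of_real b) = (a < b).
Proof. by rewrite /of_real; case: k => //=; rewrite ltcR. Qed.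

Lemma of_realD (a b : R) : of_real (a + b) = of_real a + of_real b.
Proof. by rewrite /of_real; case: k => //=; rewrite rmorphD. Qed.

Lemma of_realN (a : R) : of_real (- a) = - of_real a.
Proof. by rewrite /of_real; case: k => //=; rewrite rmorphN. Qed.

Lemma of_realM (a b : R) : of_real (a * b) = of_real a * of_real b.
Proof. by rewrite /of_real; case: k => //=; rewrite rmorphM. Qed.

Lemma of_real1 : of_real 1 = 1.
Proof. by rewrite /of_real; case: k. Qed.

Lemma of_real0 : of_real 0 = 0.
Proof. by rewrite /of_real; case: k. Qed.

Lemma normrE (V : normedZmodType K) (x : V) : `|x| = of_real (rnorm x).
Proof.
have := normr_ge0 x; rewrite /rnorm; move: (`|x|).
rewrite /of_real; case: (k) => //= -[a b]; rewrite lecE /= => /andP[/eqP-> _].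
by [].
Qed.

Lemma rnorm_eq0 (V : normedZmodType K) (x : V) : rnorm x = 0 -> x = 0.
Proof. by move=> x0; apply/eqP; rewrite -normr_eq0 normrE x0 of_real0. Qed.

Lemma rnormN (V : normedZmodType K) (x : V) : rnorm (- x) = rnorm x.
Proof. by rewrite /rnorm normrN. Qed.

Lemma rnorm_of_real (r : R) : rnorm (of_real r) = `|r|.
Proof.
have reK (s : R) : scalar_re (of_real s) = s by rewrite /of_real; case: (k).
have normK (s : R) : 0 <= s -> scalar_re `|of_real s| = s.
  by move=> s0; rewrite (_ : `|_| = of_real s) ?reK//; apply: (@ger0_norm K);
    rewrite -of_real0 ler_of_real.
rewrite /rnorm; have [r0|r0] := leP 0 r.
  by rewrite normK// (@ger0_norm R).
by rewrite -normrN -of_realN normK ?oppr_ge0 1?ltW// (@ltr0_norm R).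
Qed.

Lemma rnormM (a b : K) : rnorm (a * b) = rnorm a * rnorm b.
Proof. exact: (@rnormZ R k K^o). Qed.

Lemma rnorm1 : rnorm (1 : K) = 1.
Proof. by rewrite -of_real1 rnorm_of_real normr1. Qed.

Lemma rnormV (a : K) : a != 0 -> rnorm a^-1 = (rnorm a)^-1.
Proof.
move=> a0; have an0 : rnorm a != 0.
  by apply: contra_neq a0 => /rnorm_eq0.
by apply: (mulfI an0); rewrite -rnormM !mulfV ?rnorm1.
Qed.

Lemma gt0_of_real (e : K) : 0 < e -> e = of_real (rnorm e).
Proof. by move=> e0; rewrite -normrE gtr0_norm. Qed.

(** Library balls have radii in [K]; a positive element of [K] is real and equals its own norm. *)
Lemma ball_rnormP (V : normedModType K) (x y : V) (e : K) : 0 < e ->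
  ball x e y <-> rnorm (x - y) < rnorm e.
Proof.
move=> e0; rewrite -ball_normE /= normrE {1}(gt0_of_real e0).
by rewrite ltr_of_real.
Qed.

Lemma nbhs_rnormP (V : normedModType K) (x : V) (A : set V) :
  nbhs x A <-> exists2 e : R, 0 < e & forall y, rnorm (y - x) < e -> A y.
Proof.
have e_gt0 (e : R) : 0 < e -> 0 < (of_real e : K).
  by move=> ?; rewrite -of_real0 ltr_of_real.
split=> [/nbhs_ballP[e /= e0 eA]|[e e0 eA]].
  exists (rnorm e); first by rewrite -ltr_of_real -(gt0_of_real e0) of_real0.
  by move=> y yx; apply/eA/(ball_rnormP _ _ e0); rewrite -rnormN opprB.
apply/nbhs_ballP; exists (of_real e : K); first exact: e_gt0.
move=> y /(ball_rnormP _ _ (e_gt0 _ e0)).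
by rewrite -rnormN opprB rnorm_of_real gtr0_norm//; exact: eA.
Qed.

End scalar_theory.

Section real_suprema.
Local Open Scope ring_scope.
Context (R : realType) (I : Type).
Implicit Types (A : set I) (F : I -> R).

(** [fine] turns an infinite supremum into 0, so bounds on values through [rsup] always come with an
    upper bound [M]. *)
Definition rsup A F : R := fine (nnsup A (fun i => (F i)%:E)).

Lemma nnsup_rsup A F M : (forall i, A i -> F i <= M) ->
  nnsup A (fun i => (F i)%:E) = (rsup A F)%:E.
Proof.
move=> FM; rewrite /rsup fineK// ge0_fin_numE; last first.
  by apply: ereal_sup_ubound; left.
apply: (@le_lt_trans _ _ (Num.max 0 M)%:E); last by rewrite ltry.
apply/nnsup_leP => [|i Ai]; rewrite lee_fin le_max ?lexx//.
by rewrite FM ?orbT.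
Qed.

Lemma rsup_leP A F M c : (forall i, A i -> F i <= M) -> 0 <= c ->
  rsup A F <= c <-> forall i, A i -> F i <= c.
Proof.
move=> FM c0; rewrite -lee_fin -(nnsup_rsup FM).
by rewrite nnsup_leP ?lee_fin.
Qed.

Lemma rsup_ge0 A F : 0 <= rsup A F.
Proof. by apply: fine_ge0; apply: ereal_sup_ubound; left. Qed.

Lemma le_rsup A F M i : (forall i, A i -> F i <= M) -> A i -> F i <= rsup A F.
Proof. by move=> FM Ai; apply: (rsup_leP FM (rsup_ge0 A F)).1. Qed.

End real_suprema.

(** * Topologies generated by real-valued seminorms *)

Section real_seminorms.
Local Open Scope ring_scope.
Context (R : realType) (k : scalar_kind) (X : lmodType (scalars R k)).
Local Notation K := (scalars R k).
Implicit Types (p q : X -> R) (P Q : set (X -> R)) (x y : X).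

(** Two inequalities are enough: equality in the homogeneity follows by applying it to the inverse
    scalar ([rsemiZ]), and nonnegativity from [x - x = 0] ([rsemi_ge0]). *)
Definition rseminorm p : Prop :=
  (forall x y, p (x + y) <= p x + p y) /\
  (forall (a : K) x, p (a *: x) <= rnorm a * p x).

Lemma rsemi0 p : rseminorm p -> p 0 = 0.
Proof.
move=> [pD pZ]; apply/eqP; rewrite eq_le; apply/andP; split.
  by have := pZ 0 0; rewrite scale0r rnorm0 mul0r.
by have := pD 0 0; rewrite addr0; lra.
Qed.

Lemma rsemiN p x : rseminorm p -> p (- x) = p x.
Proof.
move=> [pD pZ]; have pN y : p (- y) <= p y.
  by have := pZ (-1) y; rewrite scaleN1r rnormN rnorm1 mul1r.
by apply/eqP; rewrite eq_le pN; have := pN (- x); rewrite opprK => ->.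
Qed.

Lemma rsemi_ge0 p x : rseminorm p -> 0 <= p x.
Proof.
move=> sp; have [pD _] := sp.
by have := pD x (- x); rewrite subrr rsemi0// rsemiN//; lra.
Qed.

Lemma rsemiZ p (a : K) x : rseminorm p -> p (a *: x) = rnorm a * p x.
Proof.
move=> sp; have [_ pZ] := sp.
have [->|a0] := eqVneq a 0; first by rewrite scale0r rnorm0 mul0r rsemi0.
apply/eqP; rewrite eq_le pZ/=.
have := pZ a^-1 (a *: x); rewrite scalerA mulVf// scale1r rnormV//.
have a0' : 0 < rnorm a.
  by rewrite lt_def rnorm_ge0 andbT; apply: contra_neq a0 => /rnorm_eq0.
by rewrite mulrC ler_pdivlMr// mulrC.
Qed.

Lemma rsemi_of_real p (r : R) x : rseminorm p ->
  p (of_real k r *: x) = `|r| * p x.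
Proof. by move=> sp; rewrite rsemiZ// rnorm_of_real. Qed.

Lemma rsemiB p x y : rseminorm p -> p (x - y) <= p x + p y.
Proof. by move=> sp; have [pD _] := sp; rewrite -(rsemiN y sp). Qed.

Lemma rsemi_distC p x y : rseminorm p -> p (x - y) = p (y - x).
Proof. by move=> sp; rewrite -opprB rsemiN. Qed.

Lemma rsemi_dist p x y z : rseminorm p -> p (x - z) <= p (x - y) + p (y - z).
Proof. by move=> [pD _]; have := pD (x - y) (y - z); rewrite subrKA. Qed.

Lemma rsemi_shift p x y : rseminorm p -> p x <= p (x - y) + p y.
Proof. by move=> [pD _]; have := pD (x - y) y; rewrite subrK. Qed.

Lemma rsemi_sum p (I : Type) (s : seq I) (A : pred I) (f : I -> X) :
  rseminorm p -> p (\sum_(i <- s | A i) f i) <= \sum_(i <- s | A i) p (f i).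
Proof.
move=> sp; have [pD _] := sp; elim/big_rec2: _ => [|i y1 y2 _ h].
  by rewrite rsemi0.
by apply: (le_trans (pD _ _)); rewrite lerD2l.
Qed.

Lemma rseminormD p q : rseminorm p -> rseminorm q ->
  rseminorm (fun x => p x + q x).
Proof.
move=> sp sq; have [pD _] := sp; have [qD _] := sq; split=> [x y|a x].
  by have := pD x y; have := qD x y; lra.
by rewrite !rsemiZ// mulrDr.
Qed.

Lemma rseminormM (c : R) p : 0 <= c -> rseminorm p ->
  rseminorm (fun x => c * p x).
Proof.
move=> c0 sp; have [pD _] := sp; split=> [x y|a x].
  by rewrite -mulrDr ler_wpM2l.
by rewrite rsemiZ// mulrCA.
Qed.

(** Scale [x] by the inverse of [q x + e], which is positive even where [q] vanishes, and let [e]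
    tend to 0. *)
Lemma rsemi_le p q : rseminorm p -> rseminorm q ->
  (forall x, q x < 1 -> p x <= 1) -> forall x, p x <= q x.
Proof.
move=> sp sq pq x; apply/ler_addgt0Pr => e e0.
have c0 : 0 < q x + e by have := rsemi_ge0 x sq; lra.
have ci : 0 < (q x + e)^-1 by rewrite invr_gt0.
have := pq (of_real k (q x + e)^-1 *: x).
rewrite !rsemi_of_real// (gtr0_norm ci).
rewrite -![_^-1 * _]mulrC ltr_pdivrMr// ler_pdivrMr// mul1r; apply; lra.
Qed.

Definition rtopology P : topology X :=
  seminorm_topology [set (fun x => (p x)%:E) | p in P].

(** Since [F] is an arbitrary filter, this also serves to show that all neighbourhoods of a point
    have some property, by taking for [F] the sets with that property. *)
Lemma cvg_rtopology P (F : set_system X) x : Filter F ->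
  (forall p, P p -> forall e : R, 0 < e -> F [set y | p (y - x) < e]) ->
  F --> (x : tspace (rtopology P)).
Proof.
move=> FF Fp U; rewrite (@nbhsE (tspace (rtopology P))) => -[V [oV Vx] VU].
have [Q [/finite_seqP[s Qs] QP [e e0 QV]]] := oV x Vx.
apply: (filterS VU); apply: (filterS QV); rewrite Qs in QP *.
elim: s QP {Qs QV} => [|q s IH] QP.
  by apply: filterS filterT => y _ q; rewrite /= in_nil.
have [p Pp pq] := QP q (mem_head _ _).
have Fs := IH (fun g gs => QP g (mem_behead (s := q :: s) gs)).
apply: filterS (filterI (Fp p Pp e e0) Fs) => y [/= py ys] g /=.
rewrite in_cons => /orP[/eqP->|gs]; last exact: ys.
by rewrite -pq lte_fin.
Qed.

Lemma nbhs_rseminorm_ball P p x (e : R) : rseminorm p -> P p -> 0 < e ->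
  nbhs (x : tspace (rtopology P)) [set y | p (y - x) < e].
Proof.
move=> sp Pp e0; apply: (@open_nbhs_nbhs (tspace (rtopology P))).
split; last by rewrite /= subrr rsemi0.
move=> y /= pyx; exists [set (fun x => (p x)%:E)]; split.
- exact: finite_set1.
- by move=> _ ->; exists p.
exists (e - p (y - x)); first by rewrite subr_gt0.
move=> z /= /(_ _ erefl); rewrite lte_fin => pz.
by have := rsemi_dist z y x sp; lra.
Qed.

Definition rdirected P : Prop := P !=set0 /\ forall p q, P p -> P q ->
  exists2 r, P r & forall x, p x <= r x /\ q x <= r x.

Lemma nbhs_rtopologyP P x (U : set X) : (forall p, P p -> rseminorm p) ->
  rdirected P ->
  nbhs (x : tspace (rtopology P)) U <->
  exists p, P p /\ exists2 e : R, 0 < e & forall y, p (y - x) < e -> U y.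
Proof.
move=> sP [[p0 P0] dP]; split=> [|[p [Pp [e e0 eU]]]]; last first.
  have := @nbhs_rseminorm_ball P p x e (sP p Pp) Pp e0.
  exact: (@filterS _ (nbhs (x : tspace (rtopology P)))).
(* By directedness the sets that contain a ball of a single seminorm form a filter; [cvg_rtopology]
   puts every neighbourhood into it. *)
pose F := [set U | exists p, P p /\ exists2 e : R, 0 < e &
  forall y, p (y - x) < e -> U y].
have FF : Filter F.
  split; first by exists p0; split => //; exists 1.
    move=> A B [p [Pp [e e0 eA]]] [q [Pq [d d0 dB]]].
    have [r Pr rpq] := dP p q Pp Pq; exists r; split=> //.
    exists (Num.min e d); first by rewrite lt_min e0.
    move=> y; rewrite lt_min => /andP[re rd]; have [pr qr] := rpq (y - x).
    by split; [apply: eA|apply: dB];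
      exact: le_lt_trans re || exact: le_lt_trans rd.
  by move=> A B AB [p [Pp [e e0 eA]]]; exists p; split=> //;
    exists e => // y /eA/AB.
have := @cvg_rtopology P F x FF; apply=> p Pp e e0.
by exists p; split=> //; exists e.
Qed.

Lemma coarser_rtopology P Q :
  (forall p, P p -> exists q, [/\ Q q, rseminorm q &
    exists2 C : R, 0 < C & forall x, p x <= C * q x]) ->
  coarser (rtopology P) (rtopology Q).
Proof.
move=> PQ; apply/coarserP => x.
apply: (@cvg_rtopology P (nbhs (x : tspace (rtopology Q)))).
move=> p /PQ[q [Qq sq [C C0 pq]]] e e0.
have := @nbhs_rseminorm_ball Q q x (e / C) sq Qq (divr_gt0 e0 C0).
apply: (@filterS _ (nbhs (x : tspace (rtopology Q)))) => y /=.
rewrite ltr_pdivlMr// mulrC => qy.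
exact: le_lt_trans (pq _) qy.
Qed.

Lemma rtopology_linear P : (forall p, P p -> rseminorm p) ->
  linear_topology (rtopology P).
Proof.
move=> sP; split=> -[u v] /=.
  apply: (@cvg_rtopology P) => p Pp e e0; rewrite /nbhs /=.
  have sp := sP p Pp; have e20 : 0 < e / 2 by lra.
  exists ([set y | p (y - u) < e / 2], [set y | p (y - v) < e / 2]) => /=.
    by split; exact: nbhs_rseminorm_ball.
  move=> [y z] /= [yu zv]; rewrite opprD addrACA.
  by have [pD _] := sp; have := pD (y - u) (z - v); lra.
apply: (@cvg_rtopology P) => p Pp e e0; rewrite /nbhs /=.
have sp := sP p Pp; have pv := rsemi_ge0 v sp; have ru := rnorm_ge0 u.
(* The bound [d <= 1] keeps [rnorm a] below [rnorm u + 1] in the splitting a y - u v = a (y - v) +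
   (a - u) v. *)
pose d := Num.min 1 (e / (2 * (p v + 1))).
have d0 : 0 < d by rewrite lt_min ltr01 divr_gt0//; lra.
pose d' := e / (2 * (rnorm u + 1)).
have d'0 : 0 < d' by rewrite divr_gt0//; lra.
exists ([set y : K^o | rnorm (y - u) < d], [set y | p (y - v) < d']) => /=.
  by split; [apply/nbhs_rnormP; exists d|exact: nbhs_rseminorm_ball].
move=> [a y] /= [au yv].
have -> : a *: y - u *: v = a *: (y - v) + (a - u) *: v.
  by rewrite scalerBr scalerBl addrA subrK.
have [pD _] := sp; apply: le_lt_trans (pD _ _) _.
rewrite !rsemiZ//.
have ra : rnorm a <= rnorm u + 1.
  have := ler_rnormD u (a - u); rewrite addrC subrK.
  by have : d <= 1 by [rewrite ge_min lexx]; lra.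
have h1 : rnorm a * p (y - v) < e / 2.
  apply: (@le_lt_trans _ _ ((rnorm u + 1) * p (y - v))).
    by rewrite ler_wpM2r ?rsemi_ge0.
  rewrite mulrC -ltr_pdivlMr; last lra.
  by apply: lt_le_trans yv _; rewrite /d' invfM mulrA.
have h2 : rnorm (a - u) * p v <= e / 2.
  apply: (@le_trans _ _ (rnorm (a - u) * (p v + 1))).
    by rewrite ler_wpM2l ?rnorm_ge0//; lra.
  rewrite -ler_pdivlMr; last lra.
  apply: ltW; apply: lt_le_trans au _; rewrite /d ge_min invfM mulrA lexx.
  by rewrite orbT.
lra.
Qed.

End real_seminorms.

(** * Mixed topologies *)

Section infimal_convolution.
Local Open Scope ring_scope.
Context (R : realType) (k : scalar_kind) (X : lmodType (scalars R k)).
Context (m : nat -> X -> R) (sm : forall n, rseminorm (m n)).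
Implicit Types (x y : X) (w : nat -> X).

(** This is the largest seminorm below all [m n]; its open unit ball is the absolutely convex hull
    of the union of their open unit balls. *)
Definition infconv x : R := inf [set s | exists n w,
  \sum_(0 <= i < n) w i = x /\ s = \sum_(0 <= i < n) m i (w i)].

Let sums_ge0 n w : 0 <= \sum_(0 <= i < n) m i (w i).
Proof. by apply: sumr_ge0 => i _; apply: rsemi_ge0. Qed.

Let sum_one n x (Y : zmodType) (f : nat -> X -> Y) : (forall i, f i 0 = 0) ->
  \sum_(0 <= i < n.+1) f i (if i == n then x else 0) = f n x.
Proof.
move=> f0; rewrite big_nat_recr//= eqxx big_nat_cond big1 ?add0r// => i.
by move=> /andP[/andP[_ /ltn_eqF->]].
Qed.

Let has_inf_sums x : has_inf [set s | exists n w,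
  \sum_(0 <= i < n) w i = x /\ s = \sum_(0 <= i < n) m i (w i)].
Proof.
split; last by exists 0 => _ [n [w [_ ->]]].
exists (m 0 x); exists 1%N, (fun=> x); by rewrite !big_nat1.
Qed.

Lemma infconv_sum_le n w :
  infconv (\sum_(0 <= i < n) w i) <= \sum_(0 <= i < n) m i (w i).
Proof.
apply: ge_inf; first by have [] := has_inf_sums (\sum_(0 <= i < n) w i).
by exists n, w.
Qed.

Lemma infconv_le n x : infconv x <= m n x.
Proof.
have := infconv_sum_le n.+1 (fun i => if i == n then x else 0).
rewrite (sum_one n x (f := fun _ y => y))// (sum_one n x (f := m))// => i.
exact: rsemi0.
Qed.

Lemma infconv_lt x c : infconv x < c -> exists n w,
  \sum_(0 <= i < n) w i = x /\ \sum_(0 <= i < n) m i (w i) < c.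
Proof.
move=> /(inf_lt (has_inf_sums x).1) [_ [n [w [wx ->]]] lc].
by exists n, w.
Qed.

Let pad n n' w : (n <= n')%N -> exists w',
  \sum_(0 <= i < n') w' i = \sum_(0 <= i < n) w i /\
  \sum_(0 <= i < n') m i (w' i) = \sum_(0 <= i < n) m i (w i).
Proof.
move=> nn'; exists (fun i => if (i < n)%N then w i else 0).
split; rewrite (big_cat_nat (n := n))//= [X in _ + X]big_nat_cond.
  rewrite [X in _ + X]big1 ?addr0; last first.
    by move=> i /andP[/andP[ni _] _]; rewrite ltnNge ni.
  by apply: eq_big_nat => i /andP[_ ->].
rewrite [X in _ + X]big1 ?addr0; last first.
  by move=> i /andP[/andP[ni _] _]; rewrite ltnNge ni rsemi0.
by apply: eq_big_nat => i /andP[_ ->].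
Qed.

Lemma rseminorm_infconv : rseminorm infconv.
Proof.
split=> [x y|a x].
  apply/ler_addgt0Pr => e e0.
  have [n [w [<- wlt]]] : exists n w, \sum_(0 <= i < n) w i = x /\
      \sum_(0 <= i < n) m i (w i) < infconv x + e / 2.
    by apply: infconv_lt; lra.
  have [n' [w' [<- wlt']]] : exists n w, \sum_(0 <= i < n) w i = y /\
      \sum_(0 <= i < n) m i (w i) < infconv y + e / 2.
    by apply: infconv_lt; lra.
  have [u [ux us]] := pad w (leq_maxl n n').
  have [v [vy vs]] := pad w' (leq_maxr n n').
  move: wlt wlt'; rewrite -ux -vy -us -vs -big_split/= => ult vlt.
  apply: (le_trans (infconv_sum_le _ _)).
  apply: (@le_trans _ _ (\sum_(0 <= i < maxn n n') (m i (u i) + m i (v i)))).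
    by apply: ler_sum => i _; have [mD _] := sm i.
  by rewrite big_split/=; lra.
apply/ler_addgt0Pr => e e0; have ra := rnorm_ge0 a.
have a1 : 0 < rnorm a + 1 by lra.
have [n [w [wx wlt]]] : exists n w, \sum_(0 <= i < n) w i = x /\
    \sum_(0 <= i < n) m i (w i) < infconv x + e / (rnorm a + 1).
  by apply: infconv_lt; rewrite ltrDl divr_gt0.
rewrite -{1}wx scaler_sumr; apply: (le_trans (infconv_sum_le _ _)).
under eq_bigr do rewrite rsemiZ//.
rewrite -mulr_sumr; apply: (@le_trans _ _ (rnorm a * (infconv x + e / (rnorm a
  + 1)))).
  by rewrite ler_wpM2l// ltW.
rewrite mulrDr lerD2l mulrCA ger_pMr// ler_pdivrMr//; lra.
Qed.

End infimal_convolution.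

(** * Seminorms continuous for the mixed topology, and a base at 0 *)

Section mixed_topologies.
Local Open Scope ring_scope.

Definition saks_family (R : realType) (k : scalar_kind)
    (X : lmodType (scalars R k)) (N : X -> R) (G : set (X -> R)) : Prop :=
  [/\ rseminorm N, forall q, G q -> rseminorm q, rdirected G,
      forall q x, G q -> q x <= N x &
      forall x c, (forall q, G q -> q x <= c) -> N x <= c].

Context (R : realType) (k : scalar_kind) (X : lmodType (scalars R k)).
Local Notation K := (scalars R k).
Context (N : X -> R) (G : set (X -> R)).
Hypothesis NG : saks_family N G.
Let sN : rseminorm N. Proof. by case: NG. Qed.
Let sG q : G q -> rseminorm q. Proof. by case: NG => _ + _ _ _; apply. Qed.
Let dG : rdirected G. Proof. by case: NG. Qed.
Let GN q x : G q -> q x <= N x. Proof. by case: NG => _ _ _ + _; apply. Qed.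
Implicit Types (P Q q : X -> R) (x y : X).

(** As [G] is directed, these are exactly the seminorms continuous for [tau]. *)
Definition dominated Q : Prop :=
  rseminorm Q /\ exists q, G q /\ exists2 C : R, 0 < C & forall x,
    Q x <= C * q x.

(** Choosing [e] small against a radius r makes [P] continuous for [tau] on the ball {N <= r}. This
    expresses continuity for the mixed topology by an estimate. *)
Definition mixed_seminorm P : Prop :=
  rseminorm P /\ forall e : R, 0 < e ->
    exists2 Q, dominated Q & forall x, P x <= e * N x + Q x.

Local Notation tau := (rtopology G).
Local Notation gamma := (mixed_topology (fun x => (N x)%:E) tau).

Lemma dominatedW q : G q -> dominated q.
Proof.
by move=> Gq; split; [exact: sG|exists q; split=> //; exists 1 => // x;
  rewrite mul1r].
Qed.

Lemma dominatedD P Q : dominated P -> dominated Q ->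
  dominated (fun x => P x + Q x).
Proof.
move=> [sP [p [Gp [C C0 PC]]]] [sQ [q [Gq [D D0 QD]]]].
split; first exact: rseminormD.
have [r Gr rpq] := dG.2 p q Gp Gq; exists r; split=> //; exists (C + D).
  exact: addr_gt0.
move=> x; have [pr qr] := rpq x; rewrite mulrDl; apply: lerD.
  by apply: le_trans (PC x) _; rewrite ler_pM2l.
by apply: le_trans (QD x) _; rewrite ler_pM2l.
Qed.

Lemma dominatedM (c : R) P : 0 < c -> dominated P ->
  dominated (fun x => c * P x).
Proof.
move=> c0 [sP [p [Gp [C C0 PC]]]]; split; first exact/rseminormM/sP/ltW.
exists p; split=> //; exists (c * C); first exact: mulr_gt0.
by move=> x; rewrite -mulrA ler_pM2l.
Qed.

Lemma nbhs_dominated Q x (e : R) : dominated Q -> 0 < e ->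
  nbhs (x : tspace tau) [set y | Q (y - x) < e].
Proof.
move=> [sQ [q [Gq [C C0 QC]]]] e0; apply/(nbhs_rtopologyP x _ sG dG).
exists q; split=> //; exists (e / C); first exact: divr_gt0.
by move=> y; rewrite ltr_pdivlMr// mulrC; apply: le_lt_trans.
Qed.

Lemma mixedW Q : dominated Q -> mixed_seminorm Q.
Proof.
move=> dQ; split=> [|e e0]; first by have [] := dQ.
by exists Q => // x; rewrite lerDr; apply: mulr_ge0;
  [exact: ltW|exact: rsemi_ge0].
Qed.

Lemma mixedD P Q : mixed_seminorm P -> mixed_seminorm Q ->
  mixed_seminorm (fun x => P x + Q x).
Proof.
move=> [sP mP] [sQ mQ]; split=> [|e e0]; first exact: rseminormD.
have [P' dP' PP'] := mP (e / 2) (divr_gt0 e0 (ltr0Sn R 1)).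
have [Q' dQ' QQ'] := mQ (e / 2) (divr_gt0 e0 (ltr0Sn R 1)).
exists (fun x => P' x + Q' x); first exact: dominatedD.
by move=> x; have := PP' x; have := QQ' x; lra.
Qed.

Lemma mixed_directed : rdirected mixed_seminorm.
Proof.
split; first by have [[q Gq] _] := dG; exists q; exact/mixedW/dominatedW.
move=> P Q mP mQ; exists (fun x => P x + Q x); first exact: mixedD.
have [sP _] := mP; have [sQ _] := mQ.
by move=> x; have := rsemi_ge0 x sP; have := rsemi_ge0 x sQ; split; lra.
Qed.

Lemma norm_topologyE : norm_topology (fun x => (N x)%:E) = rtopology [set N].
Proof. by rewrite /rtopology image_set1. Qed.

Lemma coarser_rtopology_norm (S : set (X -> R)) :
  (forall p, S p -> exists2 C : R, 0 < C & forall x, p x <= C * N x) ->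
  coarser (rtopology S) (norm_topology (fun x => (N x)%:E)).
Proof.
move=> SN; rewrite norm_topologyE; apply: coarser_rtopology => p /SN pN.
by exists N; split.
Qed.

Lemma tau_coarser_norm : coarser tau (norm_topology (fun x => (N x)%:E)).
Proof.
by apply: coarser_rtopology_norm => q Gq; exists 1 => // x; rewrite mul1r GN.
Qed.

Lemma mixed_seminorm_candidate :
  mixed_candidate (fun x => (N x)%:E) tau (rtopology mixed_seminorm).
Proof.
have sM p : mixed_seminorm p -> rseminorm p by case.
split.
- exact: rtopology_linear.
- apply: coarser_rtopology => q Gq; exists q; split.
  + exact/mixedW/dominatedW.
  + exact: sG.
  + by exists 1 => // x; rewrite mul1r.
- apply: coarser_rtopology_norm => P [sP mP].
  have [Q [sQ [q [Gq [C C0 QC]]]] PQ] := mP 1 ltr01.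
  exists (1 + C) => [|x]; first lra.
  apply: (le_trans (PQ x)); rewrite mulrDl lerD2l.
  by apply: (le_trans (QC x)); rewrite ler_pM2l// GN.
- move=> B [r Br]; rewrite /coincide_on eqEsubset; split; last first.
    move=> _ [U oU <-]; exists U => //; apply: (coarser_rtopology _ oU) => q Gq.
    exists q; split; [exact/mixedW/dominatedW|exact: sG|].
    by exists 1 => // x; rewrite mul1r.
  move=> _ [U oU <-].
  (* The part of [U] in [B] is recovered as the trace of the union of all tau-open sets whose trace
     on [B] lies in [U]. *)
  pose W := [set V | opens tau V /\ B `&` V `<=` U].
  exists (\bigcup_(V in W) V).
    have : @open (tspace tau) (\bigcup_(V in W) V) by apply: bigcup_open => V
      [].
    by [].
  rewrite eqEsubset; split=> x [Bx].
    by move=> [V [_ VU] Vx]; split=> //; exact: VU.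
  move=> Ux; split=> //.
  have : nbhs (x : tspace (rtopology mixed_seminorm)) U.
    exact: (@open_nbhs_nbhs (tspace (rtopology mixed_seminorm)) x U (conj oU
      Ux)).
  move=> /(nbhs_rtopologyP x _ sM mixed_directed) [P [[sP mP] [e e0 eU]]].
  have r0 : 0 <= r.
    by have := Br x Bx; rewrite lee_fin; apply: le_trans; exact: rsemi_ge0.
  (* Differences of points of [B] have norm at most 2 (r + 1), so the [N] part costs at most e / 2;
     the summand 1 covers r = 0. *)
  have [|Q dQ PQ] := mP (e / (4 * (r + 1))); first by rewrite divr_gt0//; lra.
  have := nbhs_dominated x dQ (divr_gt0 e0 (ltr0Sn R 1)).
  rewrite (@nbhsE (tspace tau)) => -[V [oV Vx] VQ].
  exists V => //; split=> // y [By Vy]; apply: eU; apply: (le_lt_trans (PQ _)).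
  have /= Qyx := VQ y Vy.
  have Nyx : N (y - x) <= 2 * (r + 1).
    apply: (le_trans (rsemiB _ _ sN)).
    by have := Br x Bx; have := Br y By; rewrite !lee_fin; lra.
  suff : e / (4 * (r + 1)) * N (y - x) <= e / 2 by lra.
  apply: (@le_trans _ _ (e / (4 * (r + 1)) * (2 * (r + 1)))).
    by rewrite ler_wpM2l// divr_ge0//; lra.
  have r1 : r + 1 != 0 by apply: lt0r_neq0; lra.
  by rewrite le_eqVlt; apply/orP; left; apply/eqP; field; rewrite r1.
Qed.

Lemma tau_linear : linear_topology tau.
Proof. exact: rtopology_linear. Qed.

Lemma mixed_topology_candidate : mixed_candidate (fun x => (N x)%:E) tau gamma.
Proof. exact: (mixed_topologyP tau_linear tau_coarser_norm).1. Qed.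

Lemma mixed_seminorm_coarser : coarser (rtopology mixed_seminorm) gamma.
Proof.
apply: (mixed_topologyP tau_linear tau_coarser_norm).2.
exact: mixed_seminorm_candidate.
Qed.

Lemma nbhs_mixed P x (e : R) : mixed_seminorm P -> 0 < e ->
  nbhs (x : tspace gamma) [set y | P (y - x) < e].
Proof.
move=> mP e0; move/coarserP: mixed_seminorm_coarser; apply.
by apply: nbhs_rseminorm_ball => //; have [] := mP.
Qed.

Definition ramp (Q : nat -> X -> R) n x : R := N x / n.+1%:R + Q n x.

Lemma rseminorm_ramp (Q : nat -> X -> R) n : rseminorm (Q n) ->
  rseminorm (ramp Q n).
Proof.
move=> sQ; have := rseminormM (c := n.+1%:R^-1) _ sN.
rewrite invr_ge0 ler0n => /(_ isT) sN'.
have [h1 h2] := rseminormD sN' sQ.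
split=> [x y|a x]; rewrite /ramp.
  by have := h1 x y; rewrite ![_^-1 * _]mulrC.
by have := h2 a x; rewrite ![_^-1 * _]mulrC.
Qed.

(** For given [e] a single member of the family suffices: [infconv] lies below N / (n + 1) + Q n,
    with n so large that 1 / (n + 1) < e. *)
Lemma infconv_ramp_mixed (Q : nat -> X -> R) : (forall n, dominated (Q n)) ->
  mixed_seminorm (infconv (ramp Q)).
Proof.
move=> dQ; have sr n : rseminorm (ramp Q n).
  by apply: rseminorm_ramp; have [] := dQ n.
split=> [|e e0]; first exact: rseminorm_infconv.
pose n := Num.truncn e^-1.
exists (Q n) => // x; apply: (le_trans (infconv_le sr n x)).
rewrite /ramp lerD2r mulrC ler_wpM2r//; first exact: rsemi_ge0.
rewrite -[leRHS]invrK lef_pV2 ?posrE ?invr_gt0//.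
by apply/ltW/truncnS_gt.
Qed.

Lemma nbhs0_half t (U : set X) : linear_topology t ->
  nbhs (0 : tspace t) U -> exists2 W : set X, nbhs (0 : tspace t) W &
    forall x y, W x -> W y -> U (x + y).
Proof.
move=> [addt _] U0.
have U00 : nbhs ((0 + 0 : X) : tspace t) U by rewrite addr0.
have [[A B] /= [A0 B0] AB] := addt (0, 0) U U00; exists (A `&` B).
  exact: (@filterI _ (nbhs (0 : tspace t))).
by move=> x y [Ax _] [_ By]; exact: (AB (x, y)).
Qed.

(** The mixed topology and [tau] have the same traces on the ball of radius n + 1, so some tau-ball
    cut down to it lies in [U]; rescaling normalises its radius to 1. *)
Lemma nbhs0_ball n (U : set X) : nbhs (0 : tspace gamma) U ->
  exists2 Q, dominated Q & forall x, N x <= n.+1%:R -> Q x < 1 -> U x.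
Proof.
have [_ _ _ coin] := mixed_topology_candidate.
pose B := [set x | N x <= n.+1%:R].
have Bb : norm_bounded (fun x => (N x)%:E) B by exists n.+1%:R => x;
  rewrite lee_fin.
rewrite (@nbhsE (tspace gamma)) => -[V [oV V0] VU].
have : [set B `&` W | W in opens gamma] (B `&` V) by exists V.
rewrite (coin B Bb) => -[W oW BWV].
have W0 : W 0.
  suff : (B `&` W) 0 by case.
  by rewrite BWV; split => //; rewrite /B /= rsemi0.
have : nbhs (0 : tspace tau) W by exact: (@open_nbhs_nbhs (tspace tau) 0 W
  (conj oW W0)).
move=> /(nbhs_rtopologyP _ _ sG dG)[q [Gq [e e0 eW]]].
exists (fun x => e^-1 * q x).
  by apply: dominatedM; [rewrite invr_gt0|exact: dominatedW].
move=> x Nx qx; apply: VU.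
suff : (B `&` V) x by case.
rewrite -BWV; split => //; apply: eW; rewrite subr0.
by move: qx; rewrite mulrC ltr_pdivrMr// mul1r.
Qed.

(* Scalings of the sets {infconv (ramp Q) < 1} form a base at 0 of the mixed
   topology, which is therefore locally convex. *)
Lemma nbhs0_mixed (U : set X) : nbhs (0 : tspace gamma) U ->
  exists Q : nat -> X -> R, [/\ forall n, dominated (Q n),
    forall n x, Q n x <= Q n.+1 x &
    forall x, infconv (ramp Q) x < 1 -> U x].
Proof.
move=> U0; have [lin _ _ _] := mixed_topology_candidate.
have /choice[half halfP] : forall U : set X, exists W : set X,
    nbhs (0 : tspace gamma) U -> nbhs (0 : tspace gamma) W /\
    forall x y, W x -> W y -> U (x + y).
  move=> V; have [V0|V0] := pselect (nbhs (0 : tspace gamma) V);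
    last by exists V.
  by have [W W0 WV] := nbhs0_half lin V0; exists W.
(* Successive halves of [U]; [half] was made total so that it can be iterated. *)
pose W n := iter n half U.
have W0 n : nbhs (0 : tspace gamma) (W n).
  by elim: n => [//|n IH]; have [] := halfP _ IH.
have WW n x y : W n.+1 x -> W n.+1 y -> W n (x + y).
  by have [_] := halfP _ (W0 n); apply.
have /choice[Q QP] : forall n, exists Q, dominated Q /\
    forall x, N x <= n.+1%:R -> Q x < 1 -> W n.+1 x.
  by move=> n; have [Q dQ QW] := nbhs0_ball n (W0 n.+1); exists Q.
(* Partial sums give an increasing sequence that still dominates each [Q n]. *)
pose S n x := \sum_(0 <= i < n.+1) Q i x.
have Q0 n x : 0 <= Q n x by apply: rsemi_ge0; have [[]] := QP n.
have dS n : dominated (S n).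
  elim: n => [|n IH].
    suff -> : S 0%N = Q 0%N by have [] := QP 0%N.
    by apply/funext => x; rewrite /S big_nat1.
  suff -> : S n.+1 = fun x => S n x + Q n.+1 x.
    by apply: dominatedD => //; have [] := QP n.+1.
  by apply/funext => x; rewrite /S big_nat_recr.
have sr n : rseminorm (ramp S n).
  by apply: rseminorm_ramp; have [] := dS n.
exists S; split => //.
  by move=> n x; rewrite /S [leRHS]big_nat_recr//= lerDl.
move=> x /(infconv_lt sr) [n [w [<- wlt]]].
have w1 i : (i < n)%N -> W i.+1 (w i).
  move=> ni; have : ramp S i (w i) < 1.
    apply: le_lt_trans wlt; rewrite !big_mkord.
    rewrite (bigD1 (Ordinal ni))//= lerDl sumr_ge0// => j _.
    exact: rsemi_ge0.
  have Nw := rsemi_ge0 (w i) sN.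
  have Sw := rsemi_ge0 (w i) (dS i).1.
  have Nw' : 0 <= N (w i) / i.+1%:R by rewrite divr_ge0.
  rewrite /ramp => h.
  have [h1 h2] : N (w i) / i.+1%:R <= 1 /\ S i (w i) < 1.
    by move: (N (w i) / i.+1%:R) Nw' h => a a0 h; split; lra.
  apply: (QP i).2; first by rewrite -[leRHS]mul1r -ler_pdivrMr.
  apply: le_lt_trans h2.
  rewrite /S big_nat_recr//= lerDr sumr_ge0//.
(* Here [w j] lies in [W j.+1], and so does the remaining sum by induction; hence the whole sum lies
   in [W j]. *)
suff H l : forall j, (j + l <= n)%N ->
    W j (\sum_(0 <= i < l) w (j + i)%N) by apply: (H n 0%N).
elim: l => [|l IH] j jl.
  by rewrite big_nil; exact: (nbhs_singleton (W0 j)).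
rewrite big_nat_recl//= addn0; apply: WW.
  by apply: w1; apply: leq_trans jl; rewrite addnS ltnS leq_addr.
rewrite (eq_bigr (fun i => w (j.+1 + i)%N)); last by move=> i _;
  rewrite addSnnS.
by apply: IH; rewrite addSnnS.
Qed.

Lemma dominated_mono (Q : nat -> X -> R) : (forall n x, Q n x <= Q n.+1 x) ->
  forall i j, (i <= j)%N -> forall x, Q i x <= Q j x.
Proof.
move=> QS i j /subnKC <- x; elim: (j - i)%N => [|n IH]; first by rewrite addn0.
by rewrite addnS (le_trans IH).
Qed.

(* In a decomposition of a point w of {infconv (ramp Q) < 1} close to x, the
   first n terms have norm at most n in total, so that the remainder of x is
   bounded in norm as well as small for Q n. *)
Lemma infconv_closure (Q : nat -> X -> R) x :
  (forall n, dominated (Q n)) -> (forall n x, Q n x <= Q n.+1 x) ->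
  (forall P, dominated P ->
    exists2 w, infconv (ramp Q) w < 1 & P (x - w) < 1) ->
  infconv (ramp Q) x <= 5.
Proof.
move=> dQ Qn xw; have sQ n : rseminorm (Q n) by have [] := dQ n.
have sr n : rseminorm (ramp Q n) by exact: rseminorm_ramp.
have sI := rseminorm_infconv sr.
pose n := Num.truncn (N x).
have xn : N x <= n.+1%:R by apply/ltW/truncnS_gt.
have [w w1 xwn] := xw (Q n) (dQ n).
have [l [u [ux ul]]] := infconv_lt sr w1.
(* The cut comes after index n. Up to n the summand N / (i + 1) of [ramp Q i] controls the norm,
   with a loss of at most n + 1; beyond n, monotonicity gives [Q n <= Q i]. *)
pose l' := minn l n.+1.
pose h := \sum_(0 <= i < l') u i.
pose t := \sum_(l' <= i < l) u i.
have l'l : (l' <= l)%N by exact: geq_minl.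
have wht : w = h + t by rewrite -ux (big_cat_nat (n := l')).
move: ul; rewrite (big_cat_nat (n := l'))//=.
set sh := \sum_(0 <= i < l') _; set st := \sum_(l' <= i < l) _ => hl.
have sh0 : 0 <= sh by apply: sumr_ge0 => i _; apply: rsemi_ge0.
have st0 : 0 <= st by apply: sumr_ge0 => i _; apply: rsemi_ge0.
have Nh : N h <= n.+1%:R.
  apply: (le_trans (rsemi_sum _ _ _ sN)).
  apply: (@le_trans _ _ (n.+1%:R * sh)); last by rewrite ger_pMr//; lra.
  rewrite mulr_sumr; apply: ler_sum_nat => i /andP[_ il].
  have il' : (i.+1 <= n.+1)%N by apply: leq_trans il _; exact: geq_minr.
  rewrite -ler_pdivrMl// mulrC; apply: (@le_trans _ _ (N (u i) / i.+1%:R)).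
    by rewrite ler_wpM2l ?rsemi_ge0// lef_pV2 ?posrE// ler_nat.
  by rewrite lerDl rsemi_ge0.
have Qt : Q n t <= 1.
  apply: (le_trans (rsemi_sum _ _ _ (sQ n))).
  apply: (@le_trans _ _ st); last lra.
  apply: ler_sum_nat => i /andP[il' il].
  have ni : (n <= i)%N.
    by move: il'; rewrite geq_min leqNgt il => /= /ltnW.
  apply: (le_trans (dominated_mono Qn ni _)).
  by rewrite lerDr divr_ge0// rsemi_ge0.
(* The bound is 5 = 1 + 2 + 2: the head [h] contributes at most 1, and N (x - h) / (n + 1) and Q n
   (x - h) at most 2 each. *)
have -> : x = h + (x - h) by rewrite addrC subrK.
have [ID _] := sI; apply: (le_trans (ID _ _)).
have Ih : infconv (ramp Q) h <= sh by exact: infconv_sum_le.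
have Nxh : N (x - h) / n.+1%:R <= 2.
  by rewrite ler_pdivrMr//; have := rsemiB x h sN; lra.
have Qxh : Q n (x - h) <= 2.
  have -> : x - h = (x - w) + t by rewrite wht opprD addrA subrK.
  by have [QD _] := sQ n; have := QD (x - w) t; lra.
have := infconv_le sr n (x - h); rewrite {2}/ramp.
by move: (N (x - h) / n.+1%:R) Nxh => a a2; lra.
Qed.

Lemma nbhs_translate t x (U : set X) : linear_topology t ->
  nbhs (x : tspace t) U -> nbhs (0 : tspace t) [set y | U (x + y)].
Proof.
move=> [addt _] Ux.
have Ux0 : nbhs ((x + 0 : X) : tspace t) U by rewrite addr0.
have [[A B] /= [Ax B0] AB] := addt (x, 0) U Ux0.
apply: (@filterS _ (nbhs (0 : tspace t))) B0 => y By.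
by apply: (AB (x, y)); split => //; exact: nbhs_singleton Ax.
Qed.

Lemma mixed_cauchy_cvg (F : set_system X) x : ProperFilter F ->
  tvs_cauchy gamma F -> F --> (x : tspace tau) -> F --> (x : tspace gamma).
Proof.
move=> FF cF Fx U Ux; have [lin _ _ _] := mixed_topology_candidate.
have [Q [dQ QS QU]] := nbhs0_mixed (nbhs_translate lin Ux).
have mQ := infconv_ramp_mixed dQ; have [sQ _] := mQ.
have /cF[A FA AQ] : nbhs (0 : tspace gamma)
    [set y | infconv (ramp Q) (y - 0) < 1 / 6].
  by apply: nbhs_mixed => //; lra.
apply: (filterS _ FA) => a Aa.
suff aU : infconv (ramp Q) (a - x) < 1 by have := QU _ aU;
  rewrite /= addrC subrK.
(* The closure lemma yields the bound 5, so differences below 1 / 6 leave 5 / 6 < 1. The points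
   [a - b], with [b] in [A] close to [x] for [tau], approximate [a - x]. *)
suff : infconv (ramp Q) (of_real k 6 *: (a - x)) <= 5.
  by rewrite rsemi_of_real// ger0_norm//; lra.
apply: infconv_closure => // P dP; have [sP _] := dP.
have FP : F [set y | P (y - x) < 1 / 6].
  by apply: Fx; apply: nbhs_dominated => //; lra.
have [b [Ab /= bx]] := filter_ex (filterI FA FP).
exists (of_real k 6 *: (a - b)).
  have /= := AQ a b Aa Ab; rewrite subr0 rsemi_of_real// ger0_norm//; lra.
rewrite -scalerBr opprB addrC addrA subrK.
by rewrite rsemi_of_real// ger0_norm//; lra.
Qed.

End mixed_topologies.

(** * Submixed topologies *)

Section null_sequences.
Local Open Scope ring_scope.
Context (R : realType).
Implicit Types a : R^nat.

Lemma null_seq_lt a (e : R) : a @ \oo --> 0 -> 0 < e ->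
  exists n0, forall n, (n0 <= n)%N -> a n < e.
Proof.
move=> a0 e0; have /cvgrPdist_lt /(_ e e0) := a0.
move=> [n0 _ an0]; exists n0 => n nn0.
by have := an0 n nn0; rewrite sub0r normrN; apply: le_lt_trans; exact: ler_norm.
Qed.

Lemma null_seq_bounded a : (forall n, 0 <= a n) -> a @ \oo --> 0 ->
  exists2 M, 0 < M & forall n, a n <= M.
Proof.
move=> a0 acvg; have [n0 an0] := null_seq_lt acvg ltr01.
have s0 : 0 <= \sum_(0 <= i < n0) a i by apply: sumr_ge0.
exists (1 + \sum_(0 <= i < n0) a i) => [|n]; first lra.
have [/an0/ltW|nn0] := leqP n0 n; first by lra.
apply: ler_wpDl => //; rewrite big_mkord (bigD1 (Ordinal nn0))//= lerDl.
exact: sumr_ge0.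
Qed.

Lemma cvg_invS : (fun n => n.+1%:R^-1 : R) @ \oo --> 0.
Proof. exact: cvg_harmonic. Qed.

End null_sequences.

(** * Submixed seminorms and their comparison with [tau] and the mixed topology *)

Section submixed_topologies.
Local Open Scope ring_scope.
Context (R : realType) (k : scalar_kind) (X : lmodType (scalars R k)).
Local Notation K := (scalars R k).
Context (N : X -> R) (G : set (X -> R)).
Hypothesis NG : saks_family N G.
Let sN : rseminorm N. Proof. by case: NG. Qed.
Let sG q : G q -> rseminorm q. Proof. by case: NG => _ + _ _ _; apply. Qed.
Let dG : rdirected G. Proof. by case: NG. Qed.
Let GN q x : G q -> q x <= N x. Proof. by case: NG => _ _ _ + _; apply. Qed.
Let supG x c : (forall q, G q -> q x <= c) -> N x <= c.
Proof. by case: NG => _ _ _ _; apply. Qed.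
Implicit Types (P Q q : X -> R) (x y : X).
Local Notation tau := (rtopology G).

Definition submixed_seminorms : set (X -> R) :=
  [set p | exists (q : nat -> X -> R) (a : R^nat),
    [/\ forall n, G (q n), forall n, 0 <= a n, a @ \oo --> 0 &
        p = fun x => rsup [set: nat] (fun n => q n x * a n)]].

Local Notation gammas := (rtopology submixed_seminorms).

Lemma submixed_bound (q : nat -> X -> R) (a : R^nat) x :
  (forall n, G (q n)) -> (forall n, 0 <= a n) -> a @ \oo --> 0 ->
  exists M, forall n, setT n -> q n x * a n <= M.
Proof.
move=> Gq a0 acvg; have [M M0 aM] := null_seq_bounded a0 acvg.
exists (N x * M) => n _; apply: ler_pM => //; last exact: GN.
by apply: rsemi_ge0; exact: sG.
Qed.

Lemma submixed_topologyE :
  submixed_topology [set (fun x => (q x)%:E) | q in G] = gammas.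
Proof.
congr seminorm_topology; apply/seteqP; split=> p /=.
  move=> [q [a [Gq a0 acvg ->]]].
  have /choice[q' q'P] : forall n, exists q', G q' /\
    (fun x => (q' x)%:E) = q n.
    by move=> n; have [q' Gq' <-] := Gq n; exists q'.
  have Gq' n : G (q' n) by have [] := q'P n.
  exists (fun x => rsup [set: nat] (fun n => q' n x * a n)).
    by exists q', a.
  apply/funext => x; have [M qM] := submixed_bound x Gq' a0 acvg.
  rewrite -(nnsup_rsup qM); congr nnsup; apply/funext => n.
  by have [_ <-] := q'P n.
move=> [_ [q [a [Gq a0 acvg ->]]] <-].
exists (fun n x => (q n x)%:E), a; split=> // [n|]; first by exists (q n).
apply/funext => x; have [M qM] := submixed_bound x Gq a0 acvg.
by rewrite -(nnsup_rsup qM).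
Qed.

(* rsup p is at most e N outside finitely many terms. *)
Lemma mixed_rsup (p : nat -> X -> R) (D : nat -> X -> R) (c : R^nat) :
  (forall n, rseminorm (p n)) -> (forall n, dominated G (D n)) ->
  (forall n x, p n x <= D n x) -> (forall n x, p n x <= c n * N x) ->
  (forall n, 0 <= c n) -> c @ \oo --> 0 ->
  mixed_seminorm N G (fun x => rsup [set: nat] (fun n => p n x)).
Proof.
move=> sp dD pD pc c0 ccvg; have [M M0 cM] := null_seq_bounded c0 ccvg.
have pM x n : setT n -> p n x <= M * N x.
  by move=> _; apply: le_trans (pc n x) _; rewrite ler_wpM2r// rsemi_ge0.
split.
  split=> [x y|a x].
    apply/(rsup_leP (pM _)); first by rewrite addr_ge0// rsup_ge0.
    move=> n _; have [pDn _] := sp n; apply: (le_trans (pDn _ _)).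
    by apply: lerD; exact: (le_rsup (pM _)).
  apply/(rsup_leP (pM _)); first by rewrite mulr_ge0 ?rsup_ge0 ?rnorm_ge0.
  move=> n _; rewrite rsemiZ// ler_wpM2l ?rnorm_ge0//.
  exact: (le_rsup (pM _)).
move=> e e0; have [n0 cn0] := null_seq_lt ccvg e0.
pose S n x := \sum_(0 <= i < n.+1) D i x.
have D0 n x : 0 <= D n x by apply: rsemi_ge0; have [] := dD n.
have dS n : dominated G (S n).
  elim: n => [|n IH].
    suff -> : S 0%N = D 0%N by exact: dD.
    by apply/funext => x; rewrite /S big_nat1.
  suff -> : S n.+1 = fun x => S n x + D n.+1 x by exact: (dominatedD NG).
  by apply/funext => x; rewrite /S big_nat_recr.
exists (S n0) => // x.
have S0 : 0 <= S n0 x by apply: rsemi_ge0; have [] := dS n0.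
have eN : 0 <= e * N x by apply: mulr_ge0; [exact: ltW|exact: rsemi_ge0].
apply/(rsup_leP (pM _)); first exact: addr_ge0.
move=> n _; have [/cn0 cn|nn0] := leqP n0 n.
  apply: ler_wpDr => //; apply: (le_trans (pc n x)).
  by rewrite ler_wpM2r ?rsemi_ge0// ltW.
apply: ler_wpDl => //; apply: (le_trans (pD n x)).
rewrite /S big_mkord (bigD1 (Ordinal (leqW nn0)))//= lerDl.
exact: sumr_ge0.
Qed.

Lemma submixed_mixed p : submixed_seminorms p -> mixed_seminorm N G p.
Proof.
move=> [q [a [Gq a0 acvg ->]]].
(* Since [a n] may vanish and [dominatedM] asks for a positive factor, the majorant uses
   [a n + 1]. *)
apply: (@mixed_rsup (fun n x => q n x * a n) (fun n x => (a n + 1) * q n x) a).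
- move=> n; rewrite (_ : (fun x => _) = fun x => a n * q n x); last first.
    by apply/funext => x; rewrite mulrC.
  by apply: rseminormM => //; exact: sG.
- move=> n; apply: dominatedM; first exact: ltr_wpDl.
  exact: (dominatedW NG).
- move=> n x; rewrite mulrC ler_wpM2r//; last lra.
  by apply: rsemi_ge0; exact: sG.
- by move=> n x; rewrite mulrC ler_wpM2l// GN.
- exact: a0.
- exact: acvg.
Qed.

Lemma rseminorm_submixed p : submixed_seminorms p -> rseminorm p.
Proof. by move=> /submixed_mixed[]. Qed.

Lemma submixed_coarser_mixed :
  coarser gammas (mixed_topology (fun x => (N x)%:E) tau).
Proof.
apply: subset_trans (mixed_seminorm_coarser NG).
apply: coarser_rtopology => p sp; exists p; split; first exact: submixed_mixed.
  exact: rseminorm_submixed.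
by exists 1 => // x; rewrite mul1r.
Qed.

(** With a constant sequence q and weights 1 / (n + 1), the term for n = 0 is q itself. *)
Lemma tau_coarser_submixed : coarser tau gammas.
Proof.
apply: coarser_rtopology => q Gq; pose a n : R := n.+1%:R^-1.
have a0 n : 0 <= a n by rewrite invr_ge0.
have sp : submixed_seminorms (fun x => rsup [set: nat] (fun n => q x * a n)).
  by exists (fun=> q), a; split=> //; exact: cvg_invS.
exists (fun x => rsup [set: nat] (fun n => q x * a n)); split => //.
  exact: rseminorm_submixed.
exists 1 => // x; rewrite mul1r.
have [M qM] := submixed_bound x (fun=> Gq) a0 (@cvg_invS R).
by have := @le_rsup _ _ _ _ M 0%N qM I; rewrite /a invr1 mulr1.
Qed.

(** * Saks spaces whose balls are relatively compact for [tau] *)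

Section compact_balls.
Hypothesis ball_compact : forall r : R,
  exists2 B : set X, compact (B : set (tspace tau)) & [set x | N x <= r] `<=` B.

(** The cluster point provided by compactness stays in the ball because the ball is tau-closed, [N]
    being the supremum of the tau-continuous seminorms in [G]. *)
Lemma ball_cluster (r : R) (F : set_system X) : ProperFilter F ->
  F [set x | N x <= r] ->
  exists2 x, N x <= r & forall A, F A -> forall Q, dominated G Q ->
    forall e : R, 0 < e -> exists2 y, A y & Q (y - x) < e.
Proof.
move=> FF Fr; have [B cB rB] := ball_compact r.
have [x [_ clx]] := cB F FF (filterS rB Fr).
have clxQ A : F A -> forall Q, dominated G Q -> forall e : R, 0 < e ->
    exists2 y, A y & Q (y - x) < e.
  move=> FA Q dQ e e0.
  have [y [Ay Qy]] := clx A _ FA (nbhs_dominated NG x dQ e0).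
  by exists y.
exists x => //; apply: supG => q Gq; apply/ler_addgt0Pr => e e0.
have [y /= Ny qy] := clxQ _ Fr q (dominatedW NG Gq) e e0.
have := rsemi_shift x y (sG Gq); rewrite rsemi_distC; last exact: sG.
by have := GN y Gq; lra.
Qed.

(** This is tau-closedness, phrased to match the conclusion of [ball_cluster]. *)
Let sclosed (C : set X) := forall x, (forall Q, dominated G Q ->
  forall e : R, 0 < e -> exists2 y, C y & Q (y - x) < e) -> C x.

Let sclosed_le q (c : R) : G q -> sclosed [set x | q x <= c].
Proof.
move=> Gq x clx; rewrite /=; apply/ler_addgt0Pr => e e0.
have [y /= qy qyx] := clx q (dominatedW NG Gq) e e0.
have := rsemi_shift x y (sG Gq); rewrite rsemi_distC; last exact: sG.
lra.
Qed.

Let sclosedI (C D : set X) : sclosed C -> sclosed D -> sclosed (C `&` D).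
Proof.
by move=> cC cD x clx; split; [apply: cC|apply: cD] => Q dQ e e0;
  have [y [Cy Dy] Qy] := clx Q dQ e e0; exists y.
Qed.

(** If every q failed, the sets [Z q] of counterexamples would generate a filter on the ball {N <= n
    + 2}. Its cluster point satisfies q <= n + 1 for all q, hence N <= n + 1 and P < 1, whereas
    continuity of [P] on the ball forces P >= 1 there. The bound n + 1 on q grows with n so that its
    inverses form a null sequence. *)
Lemma compact_ball_step P n (C : set X) : mixed_seminorm N G P ->
  sclosed C -> (forall x, C x -> N x <= n.+1%:R -> P x < 1) ->
  exists q, G q /\ forall x, C x -> q x <= n.+1%:R ->
    N x <= n.+2%:R -> P x < 1.
Proof.
move=> [sP mP] cC CP; apply: contrapT => nq.
pose Z q := [set x | [/\ C x, q x <= n.+1%:R, N x <= n.+2%:R & 1 <= P x]].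
have Z0 q : G q -> Z q !=set0.
  move=> Gq; apply: contrapT => Zq; apply: nq; exists q; split=> // x Cx qx Nx.
  by rewrite ltNge; apply/negP => Px; apply: Zq; exists x.
have FF : ProperFilter (filter_from G Z).
  apply: filter_from_proper => //; apply: filter_from_filter.
    exact: dG.1.
  move=> p q Gp Gq; have [r Gr rpq] := dG.2 p q Gp Gq; exists r => // x.
  move=> [Cx rx Nx Px]; have [pr qr] := rpq x.
  by split; split => //; [exact: le_trans rx|exact: le_trans rx].
have [[q0 Gq0] _] := dG.
have [|x Nx clx] := @ball_cluster n.+2%:R _ FF.
  by exists q0 => // x [].
have FZ q : G q -> filter_from G Z (Z q) by move=> Gq; exists q.
have Cx : C x.
  apply: cC => Q dQ e e0.
  by have [y [Cy _ _ _] Qy] := clx _ (FZ _ Gq0) Q dQ e e0; exists y.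
have Nx1 : N x <= n.+1%:R.
  apply: supG => q Gq; apply: (sclosed_le Gq) => Q dQ e e0.
  by have [y [_ qy _ _] Qy] := clx _ (FZ _ Gq) Q dQ e e0; exists y.
suff : 1 <= P x by rewrite leNgt CP.
apply/ler_addgt0Pr => e e0.
pose d := e / (4 * n.+2%:R).
have d0 : 0 < d by rewrite divr_gt0// mulr_gt0.
have [Q dQ PQ] := mP d d0.
have [y [_ _ Ny Py] Qy] := clx _ (FZ _ Gq0) Q dQ (e / 2) (divr_gt0 e0 (ltr0Sn R
  1)).
have dN : d * N (y - x) <= e / 2.
  apply: (@le_trans _ _ (d * (n.+2%:R + n.+2%:R))).
    rewrite ler_pM2l//; apply: (le_trans (rsemiB _ _ sN)).
    by apply: lerD.
  rewrite le_eqVlt; apply/orP; left; apply/eqP; rewrite /d.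
  by move: (n.+2%:R : R) (ltr0Sn R n.+1) => c /lt0r_neq0 c0; field.
by have := rsemi_shift y x sP; have := PQ (y - x); lra.
Qed.

(* The Banach-Dieudonne argument: starting from a tau-neighbourhood on which
   P < 1 in the unit ball, impose one condition q_(n+1) <= n + 1 for each
   further ball {N <= n + 2}. *)
Lemma mixed_le_submixed P : mixed_seminorm N G P ->
  exists2 p, submixed_seminorms p & forall x, P x <= p x.
Proof.
move=> mP; have [sP mP'] := mP.
have [|Q0 [sQ0 [q0 [Gq0 [c c0 Q0c]]]] PQ0] := mP' (1 / 2); first lra.
(* On {q0 <= b} one has Q0 <= 1 / 4, so [P] is at most 1 / 2 + 1 / 4 on the unit ball. *)
pose b := (4 * c)^-1; have b0 : 0 < b by rewrite invr_gt0 mulr_gt0.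
(* Each new seminorm depends on the set cut out by the earlier ones, so the choice is made over all
   pairs (n, C), with [q0] as a value where the premises fail. *)
have /choice[f fP] : forall nC : nat * set X, exists q,
    sclosed nC.2 -> (forall x, nC.2 x -> N x <= nC.1.+1%:R -> P x < 1) ->
    G q /\ forall x, nC.2 x -> q x <= nC.1.+1%:R -> N x <= nC.1.+2%:R ->
      P x < 1.
  move=> [n C] /=; have [cC|cC] := pselect (sclosed C); last by exists q0.
  have [CP|CP] := pselect (forall x, C x -> N x <= n.+1%:R -> P x < 1);
    last by exists q0.
  by have [q qP] := compact_ball_step mP cC CP; exists q.
pose C := fix C n : set X := if n is n'.+1 then
  C n' `&` [set x | f (n', C n') x <= n'.+1%:R] else [set x | q0 x <= b].
have inv n : sclosed (C n) /\ (forall x, C n x -> N x <= n.+1%:R -> P x < 1).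
  elim: n => [|n [cC CP]] /=.
    split; first exact: sclosed_le.
    move=> x q0b N1; apply: (le_lt_trans (PQ0 x)).
    have : Q0 x <= 1 / 4.
      apply: (le_trans (Q0c x)); rewrite mulrC -ler_pdivlMr//.
      by apply: (le_trans q0b); rewrite /b invfM mul1r.
    lra.
  have [Gf fn] := fP (n, C n) cC CP; split.
    by apply: sclosedI => //; exact: sclosed_le.
  by move=> x [Cx fx]; exact: fn.
pose q n := if n is n'.+1 then f (n', C n') else q0.
(* These weights turn the conditions q0 <= b and q_(n+1) <= n + 1 into [q n x * a n <= 1]. *)
pose a n : R := if n is n'.+1 then n'.+1%:R^-1 else 4 * c.
have Gq n : G (q n).
  by case: n => [//|n]; have [cC CP] := inv n; have [] := fP (n, C n) cC CP.
have a0 n : 0 <= a n.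
  by case: n => [|n]; rewrite /a ?invr_ge0 ?mulr_ge0// ltW.
have acvg : a @ \oo --> 0.
  by rewrite -(cvg_shiftS a); exact: cvg_invS.
have sp : submixed_seminorms (fun x => rsup [set: nat] (fun n => q n x * a n)).
  by exists q, a.
exists (fun x => rsup [set: nat] (fun n => q n x * a n)) => //.
apply: rsemi_le => //; first exact: rseminorm_submixed.
move=> x px; apply: ltW.
have [M qM] := submixed_bound x Gq a0 acvg.
have qa n : q n x * a n <= 1 by apply: le_trans (ltW px); exact: (le_rsup qM).
have Cx n : C n x.
  elim: n => [|n IH] /=.
    have := qa 0%N; rewrite /q /a /= -ler_pdivlMr ?mulr_gt0//.
    by rewrite mul1r.
  split => //; have := qa n.+1; rewrite /q /a -ler_pdivlMr ?invr_gt0//.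
  by rewrite invrK mul1r.
apply: ((inv (Num.truncn (N x))).2 x (Cx _)).
by apply/ltW/truncnS_gt.
Qed.

(* If F stays away from every ball, say from {N <= n + 1} by e_n in q_n, then
   the gauges of {2 q_n < e_n} + {N < n + 1} form a sequence with a
   mixed-continuous supremum, contradicting that F is Cauchy. *)
Lemma submixed_cauchy_near_ball (F : set_system X) : ProperFilter F ->
  tvs_cauchy gammas F ->
  exists n : nat, forall q, G q -> forall e : R, 0 < e ->
    exists2 x, N x <= n.+1%:R & exists2 A, F A & forall h, A h -> q (x - h) < e.
Proof.
move=> FF cF; apply: contrapT => nF.
have /choice[qe qeP] : forall n : nat, exists qe : (X -> R) * R,
    [/\ G qe.1, 0 < qe.2 & forall x, N x <= n.+1%:R -> forall A, F A ->
      exists2 h, A h & qe.2 <= qe.1 (x - h)].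
  move=> n; apply: contrapT => nqe; apply: nF; exists n => q Gq e e0.
  apply: contrapT => nx; apply: nqe; exists (q, e); split=> //= x Nx A FA.
  apply: contrapT => nh; apply: nx; exists x => //; exists A => // h Ah.
  by rewrite ltNge; apply/negP => qh; apply: nh; exists h.
pose q n := (qe n).1; pose d n := (qe n).2.
have Gq n : G (q n) by have [] := qeP n.
have d0 n : 0 < d n by have [] := qeP n.
have sq n : rseminorm (q n) by exact: sG.
(* Index 0 carries the seminorm of the n-th gap, all other indices the same multiple of [N];
   [infconv (m n)] is thus the infimal convolution of just two seminorms. *)
pose m n i x := if i is 0 then 2 / d n * q n x else n.+1%:R^-1 * N x.
have sm n i : rseminorm (m n i).
  case: i => [|i]; rewrite /m; apply: rseminormM => //.
    by rewrite divr_ge0// ltW.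
pose P x := rsup [set: nat] (fun n => infconv (m n) x).
have mP : mixed_seminorm N G P.
  apply: (@mixed_rsup _ (fun n x => 2 / d n * q n x) (fun n => n.+1%:R^-1)).
  - by move=> n; exact: rseminorm_infconv.
  - by move=> n; apply: dominatedM; [rewrite divr_gt0|exact: (dominatedW NG)].
  - by move=> n x; exact: (infconv_le (sm n) 0%N).
  - by move=> n x; exact: (infconv_le (sm n) 1%N).
  - by move=> n; rewrite invr_ge0.
  - exact: cvg_invS.
have pM x n : setT n -> infconv (m n) x <= N x.
  move=> _; apply: (le_trans (infconv_le (sm n) 1%N x)); rewrite /m.
  by rewrite ler_piMl ?rsemi_ge0// invf_le1 ?ler1n ?ltr0n.
have [p sp Pp] := mixed_le_submixed mP.
have sp' := rseminorm_submixed sp.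
have [A FA Ap] : exists2 A, F A & forall x y, A x -> A y -> p (x - y) < 1 / 2.
  have /cF[A FA Ap] : nbhs (0 : tspace gammas) [set y | p (y - 0) < 1 / 2].
    by apply: (nbhs_rseminorm_ball 0 sp' sp); lra.
  by exists A => // x y Ax Ay; have := Ap x y Ax Ay; rewrite /= subr0.
have [h0 Ah0] := filter_ex FA.
(* [A] is fixed before n, so n may depend on [h0]: the gauge of [h0] is at most N h0 / (n + 1) < 1 /
   2. Only [B] depends on n. *)
pose n := Num.truncn (2 * N h0).
have [B FB Bq] : exists2 B, F B &
    forall x y, B x -> B y -> q n (x - y) < d n / 2.
  have /cF[B FB Bq] : nbhs (0 : tspace gammas) [set y | q n (y - 0) < d n / 2].
    move/coarserP: tau_coarser_submixed; apply.
    by apply: nbhs_rseminorm_ball => //; rewrite divr_gt0.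
  by exists B => // x y Bx By; have := Bq x y Bx By; rewrite /= subr0.
have [h1 [Ah1 Bh1]] := filter_ex (filterI FA FB).
have sI := rseminorm_infconv (sm n).
have h0n : infconv (m n) h0 < 1 / 2.
  apply: (le_lt_trans (infconv_le (sm n) 1%N h0)); rewrite /m.
  rewrite mulrC ltr_pdivrMr//; have := truncnS_gt (2 * N h0).
  by rewrite -/n; lra.
have h10 : infconv (m n) (h1 - h0) < 1 / 2.
  apply: le_lt_trans (Ap h1 h0 Ah1 Ah0); apply: le_trans (Pp _).
  exact: (le_rsup (pM _)).
have : infconv (m n) h1 < 1 by have := rsemi_shift h1 h0 sI; lra.
move=> /(infconv_lt (sm n)) [l [w [wh1 wl]]].
(* The terms with positive index add up to a point [y] of the ball {N <= n + 1}; the term of index 0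
   is [h1 - y], which is small for [q n]. *)
have [y Ny qy] : exists2 y, N y <= n.+1%:R & q n (y - h1) < d n / 2.
  case: l wh1 wl => [|l] wh1 wl.
    exists 0; first by rewrite rsemi0.
    by rewrite -wh1 big_nil subrr rsemi0// divr_gt0.
  move: wh1 wl; rewrite !big_nat_recl//= => wh1.
  rewrite -mulr_sumr; set Nw := \sum_(0 <= i < l) N (w i.+1) => wl.
  have Nw0 : 0 <= Nw by apply: sumr_ge0 => i _; exact: rsemi_ge0.
  have qw0 := rsemi_ge0 (w 0%N) (sq n).
  have qw1 : 0 <= 2 / d n * q n (w 0%N) by rewrite mulr_ge0// divr_ge0// ltW.
  have Nw1 : 0 <= n.+1%:R^-1 * Nw by rewrite mulr_ge0.
  exists (\sum_(0 <= i < l) w i.+1).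
    apply: (le_trans (rsemi_sum _ _ _ sN)); rewrite -/Nw.
    rewrite -[leRHS]mulr1 -ler_pdivrMl//.
    by move: (n.+1%:R^-1 * Nw) Nw1 wl => c ? ?; lra.
  rewrite -wh1 opprD addrCA subrr addr0 rsemiN//.
  have : 2 / d n * q n (w 0%N) < 1.
    by move: (n.+1%:R^-1 * Nw) Nw1 wl => c ? ?; lra.
  by rewrite mulrAC ltr_pdivrMr// mul1r; lra.
have [_ _ /(_ y Ny B FB) [h Bh]] := qeP n.
rewrite leNgt => /negP; apply.
by have := rsemi_dist y h1 h (sq n); have := Bq h1 h Bh1 Bh;
  rewrite -/(q n) -/(d n); lra.
Qed.

(** The points of a fixed ball that are close to [F] generate a filter on that ball. It has a
    cluster point by compactness, and [F] converges to it. *)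
Lemma submixed_cauchy_cvg (F : set_system X) : ProperFilter F ->
  tvs_cauchy gammas F -> exists x, F --> (x : tspace tau).
Proof.
move=> FF cF; have [n Fn] := submixed_cauchy_near_ball FF cF.
pose I := [set qe : (X -> R) * R | G qe.1 /\ 0 < qe.2].
pose Z (qe : (X -> R) * R) := [set x | N x <= n.+1%:R /\
  exists2 A, F A & forall h, A h -> qe.1 (x - h) < qe.2].
have [[q0 Gq0] _] := dG.
have FZ : ProperFilter (filter_from I Z).
  apply: filter_from_proper; last first.
    by move=> [q e] [/= Gq e0]; have [x Nx Ax] := Fn q Gq e e0; exists x.
  apply: filter_from_filter; first by exists (q0, 1).
  move=> [p e] [q d] [/= Gp e0] [/= Gq d0].
  have [r Gr rpq] := dG.2 p q Gp Gq; exists (r, Num.min e d).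
    by split=> //=; rewrite lt_min e0.
  move=> x [Nx [A FA /= Ar]]; split; split=> //; exists A => //= h /Ar;
    rewrite lt_min => /andP[re rd]; have [pr qr] := rpq (x - h).
    exact: le_lt_trans re.
  exact: le_lt_trans rd.
have [|x Nx clx] := ball_cluster (r := n.+1%:R) FZ.
  by exists (q0, 1) => // x [].
exists x; apply: cvg_rtopology => q Gq e e0.
have e2 : 0 < e / 2 by rewrite divr_gt0.
have FZq : filter_from I Z (Z (q, e / 2)) by exists (q, e / 2).
have [y [Ny [A FA Ay]] yx] := clx _ FZq q (dominatedW NG Gq) _ e2.
apply: filterS FA => h /Ay /= yh.
have := rsemi_dist h y x (sG Gq); rewrite (rsemi_distC h y); last exact: sG.
lra.
Qed.

End compact_balls.
End submixed_topologies.

(** * The Hahn-Banach theorem over the real and complex scalars *)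

Section hahn_banach.
Local Open Scope ring_scope.
Context (R : realType) (k : scalar_kind) (X : lmodType (scalars R k)).
Context (p : X -> R) (sp : rseminorm p) (x0 : X).
Implicit Types (x y : X) (r s t : R).

Let rZ t x : X := of_real k t *: x.

Let rZD s t x : rZ (s + t) x = rZ s x + rZ t x.
Proof. by rewrite /rZ of_realD scalerDl. Qed.
Let rZA s t x : rZ s (rZ t x) = rZ (s * t) x.
Proof. by rewrite /rZ of_realM scalerA. Qed.
Let rZDr t x y : rZ t (x + y) = rZ t x + rZ t y.
Proof. by rewrite /rZ scalerDr. Qed.
Let rZ1 x : rZ 1 x = x.
Proof. by rewrite /rZ of_real1 scale1r. Qed.
Let rZ0 x : rZ 0 x = 0.
Proof. by rewrite /rZ of_real0 scale0r. Qed.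
Let pZ t x : p (rZ t x) = `|t| * p x.
Proof. exact: rsemi_of_real. Qed.

(** Graphs of real-linear functionals below [p] on subspaces containing [x0]. Single-valuedness
    follows from the bound by [p] at 0, and the last clause is conditional so that the empty chain
    has a union in this class. *)
Let partial (G : set (X * R)) :=
  [/\ forall a b, G a -> G b -> G (a.1 + b.1, a.2 + b.2),
      forall t a, G a -> G (rZ t a.1, t * a.2),
      forall a, G a -> a.2 <= p a.1 &
      G !=set0 -> forall t, G (rZ t x0, t * p x0)].

Let line : set (X * R) := [set (rZ t x0, t * p x0) | t in setT].

Let partial_line : partial line.
Proof.
split.
- move=> _ _ [s _ <-] [t _ <-] /=; exists (s + t) => //.
  by rewrite rZD mulrDl.
- by move=> t _ [s _ <-] /=; exists (t * s) => //; rewrite rZA mulrA.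
- move=> _ [t _ <-] /=; rewrite pZ ler_wpM2r ?ler_norm//.
  exact: rsemi_ge0.
- by move=> _ t; exists t.
Qed.

(** The value at [x] must lie between all a.2 - p (a.1 - x) and all p (b.1 + x) - b.2; subadditivity
    separates the two families, and the supremum of the first is taken. *)
Let extend (G : set (X * R)) x : partial G -> G !=set0 ->
  exists c, partial [set (a.1 + rZ t x, a.2 + t * c) | a in G & t in setT].
Proof.
move=> [GD GZ Gp G0] Gn0; have [pD _] := sp.
have sep a b : G a -> G b -> a.2 - p (a.1 - x) <= p (b.1 + x) - b.2.
  move=> Ga Gb; have /= := Gp _ (GD a b Ga Gb).
  by have := pD (a.1 - x) (b.1 + x); rewrite addrACA addNr addr0; lra.
pose A := [set a.2 - p (a.1 - x) | a in G].
have [a0 Ga0] := Gn0.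
have hA : has_sup A.
  split; first by exists (a0.2 - p (a0.1 - x)), a0.
  by exists (p (a0.1 + x) - a0.2) => _ [a Ga <-]; exact: sep.
exists (sup A).
have lo a : G a -> a.2 - p (a.1 - x) <= sup A.
  by move=> Ga; apply: ub_le_sup; [exact: hA.2|exists a].
have hi b : G b -> sup A <= p (b.1 + x) - b.2.
  by move=> Gb; apply: ge_sup; [exact: hA.1|move=> _ [a Ga <-]; exact: sep].
split.
- move=> _ _ [a Ga [s _ <-]] [b Gb [t _ <-]] /=.
  exists (a.1 + b.1, a.2 + b.2); first exact: GD.
  exists (s + t) => //=; congr pair; first by rewrite rZD addrACA.
  by rewrite mulrDl addrACA.
- move=> t _ [a Ga [s _ <-]] /=.
  exists (rZ t a.1, t * a.2); first exact: GZ.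
  by exists (t * s) => //=; rewrite rZDr rZA mulrDr mulrA.
- move=> _ [a Ga [t _ <-]] /=.
  (* After division by |t|, negative [t] uses the lower bounds on the new value and positive [t] the
     upper ones. *)
  have [t0|t0|->] := ltgtP t 0; last by rewrite rZ0 mul0r !addr0; exact: Gp.
    pose s := - t^-1; have s0 : 0 < s by rewrite oppr_gt0 invr_lt0.
    have /lo /= := GZ s a Ga.
    have -> : rZ s a.1 - x = rZ s (a.1 + rZ t x).
      rewrite rZDr rZA /s mulNr mulVf ?lt_eqF// /rZ.
      by rewrite (_ : of_real k (-1) = -1) ?scaleN1r// of_realN of_real1.
    rewrite pZ gtr0_norm// -mulrBr => h.
    have : - t * (s * (a.2 - p (a.1 + rZ t x))) <= - t * sup A.
      by rewrite ler_pM2l ?oppr_gt0.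
    rewrite mulrA /s mulrNN mulfV ?lt_eqF// mul1r; lra.
  have s0 : 0 < t^-1 by rewrite invr_gt0.
  have /hi /= := GZ t^-1 a Ga.
  have -> : rZ t^-1 a.1 + x = rZ t^-1 (a.1 + rZ t x).
    by rewrite rZDr rZA mulVf ?gt_eqF// rZ1.
  rewrite pZ gtr0_norm// -mulrBr => h.
  have : t * sup A <= t * (t^-1 * (p (a.1 + rZ t x) - a.2)) by rewrite ler_pM2l.
  rewrite mulrA mulfV ?gt_eqF// mul1r; lra.
- move=> _ t; exists (rZ t x0, t * p x0); first exact: G0.
  by exists 0 => //=; rewrite rZ0 mul0r !addr0.
Qed.

Lemma real_hahn_banach : exists u : X -> R,
  [/\ forall x y, u (x + y) = u x + u y,
      forall t x, u (of_real k t *: x) = t * u x,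
      forall x, u x <= p x & u x0 = p x0].
Proof.
have [F FP Ftot|G [PG Gmax]] := @Zorn_bigcup _ partial.
  split.
  - move=> a b [A FA Aa] [B FB Bb].
    have [AB|BA] := Ftot A B FA FB.
      by exists B => //; have [D _ _ _] := FP B FB; apply: D => //; exact: AB.
    by exists A => //; have [D _ _ _] := FP A FA; apply: D => //; exact: BA.
  - by move=> t a [A FA Aa]; exists A => //; have [_ Z _ _] := FP A FA;
      exact: Z.
  - by move=> a [A FA Aa]; have [_ _ L _] := FP A FA; exact: L.
  - move=> [a [A FA Aa]] t; exists A => //; have [_ _ _ L] := FP A FA.
    by apply: L; exists a.
(* The empty graph satisfies [partial], but it is not maximal, as [line] extends it. *)
have Gn0 : G !=set0.
  apply: contrapT => /set0P/negP; rewrite negbK => /eqP G0.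
  apply: (Gmax line) partial_line; rewrite G0; split => // /(_ (rZ 1 x0,
    1 * p x0)).
  by apply; exists 1.
have [GD GZ Gp G0] := PG.
have dom x : exists r, G (x, r).
  apply: contrapT => nx; have [c Pc] := extend x PG Gn0.
  apply: Gmax Pc; split.
    move=> a Ga; exists a => //; exists 0 => //.
    by rewrite rZ0 mul0r !addr0; case: (a).
  move=> GE; apply: nx; exists (0 + 1 * c); apply: GE.
  exists (0, 0); last by exists 1 => //=; rewrite rZ1 add0r.
  by have := G0 Gn0 0; rewrite rZ0 mul0r.
have fn x r s : G (x, r) -> G (x, s) -> r = s.
  have le r' s' : G (x, r') -> G (x, s') -> r' <= s'.
    move=> Gr Gs; have := Gp _ (GD _ _ Gr (GZ (-1) _ Gs)) => /=.
    rewrite (_ : x + rZ (-1) x = 0); last first.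
      by rewrite -{1}(rZ1 x) -rZD subrr rZ0.
    by rewrite rsemi0// mulN1r subr_le0.
  by move=> Gr Gs; apply/eqP; rewrite eq_le !le.
have /choice[u uP] := dom.
exists u; split.
- by move=> x y; apply: fn (uP _) _; exact: (GD _ _ (uP x) (uP y)).
- by move=> t x; apply: fn (uP _) _; exact: (GZ t _ (uP x)).
- by move=> x; exact: (Gp _ (uP x)).
- by apply: fn (uP _) _; have := G0 Gn0 1; rewrite rZ1 mul1r.
Qed.

End hahn_banach.

Section norming_functionals.
Local Open Scope ring_scope.

Lemma dominated_functional (R : realType) (k : scalar_kind)
    (X : lmodType (scalars R k)) (p : X -> R) (x0 : X) : rseminorm p ->
  exists e : {linear X -> (scalars R k)^o},
    (forall x, rnorm (e x : (scalars R k)^o) <= p x) /\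
    rnorm (e x0 : (scalars R k)^o) = p x0.
Proof.
case: k X p x0 => X p x0 sp; have [u [uD uZ up ux0]] := real_hahn_banach sp x0.
  pose e : X -> (scalars R RealScalars)^o := u.
  have le : linear e by move=> a x y; rewrite /e uD (uZ a).
  pose e' := HB.pack_for {linear X -> (scalars R RealScalars)^o} e
    (GRing.isLinear.Build _ _ _ _ e le).
  have eu x : rnorm (e x : (scalars R RealScalars)^o) = `|u x| by [].
  exists e'; split=> [x|]; rewrite [rnorm _]eu; last first.
    by rewrite ux0 ger0_norm// rsemi_ge0.
  rewrite ler_norml up andbT lerNl -(rsemiN x sp).
  by rewrite (_ : - u x = u (- x)) ?up// -scaleN1r (uZ (-1)) mulN1r.
pose K := scalars R ComplexScalars; pose i : K := ('i)%C.
(* The complex functional with real part u is u(x) - i u(i x). *)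
pose e : X -> K^o := fun x => ((u x) +i* (- u (i *: x)))%C.
pose r : R -> K := of_real ComplexScalars.
have uN x : u (- x) = - u x.
  by rewrite -scaleN1r -of_real1 -of_realN uZ mulN1r.
have rZ c x : u (r c *: x) = c * u x by exact: uZ.
have iiN x : i *: (i *: x) = - x by rewrite scalerA -expr2 sqr_i scaleN1r.
have eD x y : e (x + y) = e x + e y.
  by rewrite /e scalerDr !uD opprD.
have decomp (s t : R) x : (s +i* t)%C *: x = r s *: x + r t *: (i *: x).
  rewrite scalerA -scalerDl; congr (_ *: _).
  by apply/eqP; rewrite eq_complex /= !(mulr0, mul0r, mulr1, subr0, addr0,
    add0r) !eqxx.
have eZ (a : K) x : e (a *: x) = a * e x.
  case: a => s t; rewrite decomp eD.
  have eR (c : R) y : e (r c *: y) = r c * e y.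
    rewrite /e rZ scalerA [i * r c]mulrC -scalerA rZ.
    by apply/eqP; rewrite eq_complex /= !(mul0r, subr0, addr0) mulrN !eqxx.
  have ei y : e (i *: y) = i * e y.
    rewrite /e iiN uN opprK.
    by apply/eqP; rewrite eq_complex /= !(mul0r, mul1r, sub0r, opprK,
      add0r) !eqxx.
  rewrite !eR ei mulrA -mulrDl; congr (_ * _).
  by apply/eqP; rewrite eq_complex /= !(mulr0, mul0r, mulr1, subr0, addr0,
    add0r) !eqxx.
have le : linear e by move=> a x y; rewrite eD eZ.
pose e' := HB.pack_for {linear X -> K^o} e (GRing.isLinear.Build _ _ _ _ e le).
have Re_le (z : K) : scalar_re z <= rnorm (z : K^o).
  apply: (le_trans (ler_norm _)).
  by have := normc_ge_Re z; rewrite lecE /= => /andP[].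
have ep x : rnorm (e x) <= p x.
  have [->|ex0] := eqVneq (e x) 0; first by rewrite rnorm0 rsemi_ge0.
  (* A rotation by a scalar of modulus 1 makes [e (a *: x)] real and nonnegative, hence equal to
     [u (a *: x)], which is at most p x. *)
  pose a : K := of_real ComplexScalars (rnorm (e x)) * (e x)^-1.
  have ra : rnorm a = 1.
    rewrite rnormM rnormV// rnorm_of_real ger0_norm ?rnorm_ge0// mulfV//.
    by apply: contra_neq ex0 => /rnorm_eq0.
  have : e (a *: x) = of_real ComplexScalars (rnorm (e x)).
    by rewrite eZ /a mulfVK.
  move=> /(congr1 (@scalar_re R ComplexScalars)) /= <-.
  by apply: (le_trans (up _)); rewrite rsemiZ// ra mul1r.
exists e'; split=> [x|]; first exact: ep.
apply/eqP; rewrite eq_le ep/= -ux0.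
exact: (Re_le (e x0)).
Qed.

End norming_functionals.

(** * Weighted spaces *)

Section saks_families.
Local Open Scope ring_scope.
Context (R : realType) (k : scalar_kind) (X : lmodType (scalars R k)).
Implicit Types (N p q : X -> R) (G : set (X -> R)).

Lemma seminorm_EFin p : rseminorm p -> seminorm (fun x => (p x)%:E).
Proof.
move=> sp; have [pD _] := sp; split=> [x _|a x _|x y _ _].
- by rewrite lee_fin ltry rsemi_ge0.
- by rewrite rsemiZ// EFinM.
- by rewrite -EFinD lee_fin.
Qed.

Lemma saks_family_hausdorff N G : saks_family N G ->
  (forall x, N x = 0 -> x = 0) -> hausdorff_space (tspace (rtopology G)).
Proof.
move=> [sN sG dG GN supG] N0 x y clxy; apply/eqP; rewrite -subr_eq0.
apply/eqP/N0/eqP; rewrite eq_le rsemi_ge0// andbT.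
apply: supG => q Gq; apply/ler_addgt0Pr => e e0.
have e2 : 0 < e / 2 by rewrite divr_gt0.
have [z [/= zx zy]] := clxy _ _ (nbhs_rseminorm_ball x (sG _ Gq) Gq e2)
  (nbhs_rseminorm_ball y (sG _ Gq) Gq e2).
have := rsemi_dist x z y (sG _ Gq); rewrite (rsemi_distC x z); last exact: sG.
lra.
Qed.

Lemma saks_family_space N G : saks_family N G ->
  (forall x, N x = 0 -> x = 0) -> saks_space (fun x => (N x)%:E) (rtopology G).
Proof.
move=> NG N0; have [sN sG dG GN supG] := NG; split.
- by split=> [|x [/N0]]; first exact: seminorm_EFin.
- exact: saks_family_hausdorff NG N0.
- exact: tau_coarser_norm.
exists [set (fun x => (q x)%:E) | q in G]; split => //.
- by move=> _ [q Gq <-]; apply/seminorm_EFin/sG.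
- have [[q0 Gq0] dG2] := dG; split; first by exists (fun x => (q0 x)%:E), q0.
  move=> _ _ [p Gp <-] [q Gq <-]; have [r Gr rpq] := dG2 p q Gp Gq.
  by exists (fun x => (r x)%:E) => [|x]; [exists r|rewrite !lee_fin].
move=> x; apply/eqP; rewrite eq_le; apply/andP; split; last first.
  apply/nnsup_leP; first by rewrite lee_fin rsemi_ge0.
  by move=> _ [q Gq <-]; rewrite lee_fin GN.
set s := nnsup _ _; have s0 : (0 <= s)%E by apply: ereal_sup_ubound; left.
have : (forall q, G q -> ((q x)%:E <= s)%E).
  by move=> q Gq; apply: ereal_sup_ubound; right;
    exists (fun x => (q x)%:E) => //; exists q.
case: s s0 => [c _|_ _|//]; last by rewrite leey.
by move=> qc; rewrite lee_fin; apply: supG => q Gq; rewrite -lee_fin qc.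
Qed.

(** The mixed topology is coarser than the norm topology, so norm balls are bounded for it and the
    semi-Montel property applies to them. *)
Lemma ball_tvs_bounded N G (r : R) : saks_family N G ->
  tvs_bounded (mixed_topology (fun x => (N x)%:E) (rtopology G)) [set x | N x
    <= r].
Proof.
move=> NG U U0; have [sN _ _ _ _] := NG.
have [_ _ gammaN _] := mixed_topology_candidate NG.
move/coarserP: gammaN => /(_ 0 U U0); rewrite norm_topologyE.
have sN' p : [set N] p -> rseminorm p by move=> ->.
have dN : rdirected [set N].
  by split; [exists N|move=> _ _ -> ->; exists N => // x; rewrite lexx].
move=> /(nbhs_rtopologyP 0 _ sN' dN) [_ [-> [e e0 eU]]].
have r1 : 0 < `|r| + 1 by rewrite ltr_wpDl.
exists ((`|r| + 1) / e); first by rewrite divr_gt0.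
move=> a; rewrite ler_pdivrMr// => ra x /= Nx.
have a0 : a != 0.
  apply/eqP => a0; move: ra; rewrite a0 rnorm0 mul0r; lra.
exists (a^-1 *: x); last by rewrite scalerA mulfV// scale1r.
apply: eU; rewrite subr0 rsemiZ// rnormV//.
have a0' : 0 < rnorm a.
  by rewrite lt_def rnorm_ge0 andbT; apply: contra_neq a0 => /rnorm_eq0.
rewrite mulrC ltr_pdivrMr// mulrC; apply: lt_le_trans ra.
by have := ler_norm r; lra.
Qed.

Lemma semi_montel_ball_compact N G (r : R) : saks_family N G ->
  semi_montel (mixed_topology (fun x => (N x)%:E) (rtopology G)) ->
  exists2 B : set X, compact (B : set (tspace (rtopology G))) &
    [set x | N x <= r] `<=` B.
Proof.
move=> NG /(_ _ (@ball_tvs_bounded _ _ r NG)) [B sB [cB _]].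
exists B; last exact: sB.
have [_ /coarserP tau_gamma _ _] := mixed_topology_candidate NG.
move=> F FF FB; have [x [Bx clx]] := cB F FF FB.
exists x; split=> // A V FA Vx; apply: clx => //; exact: tau_gamma.
Qed.

Lemma coarser_submixed N N' G G' (C : R) : 0 < C ->
  saks_family N G -> saks_family N' G' ->
  (forall q, G q -> exists2 q', G' q' & forall x, q x <= C * q' x) ->
  coarser (rtopology (submixed_seminorms G)) (rtopology (submixed_seminorms
    G')).
Proof.
move=> C0 NG NG' GG'; apply: coarser_rtopology => p [q [a [Gq a0 acvg ->]]].
have /choice[q' q'P] : forall n, exists q', G' q' /\ forall x,
  q n x <= C * q' x.
  by move=> n; have [q' Gq' qq'] := GG' _ (Gq n); exists q'.
have Gq' n : G' (q' n) by have [] := q'P n.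
have sp : submixed_seminorms G' (fun x => rsup [set: nat] (fun n => q' n x * a
  n)).
  by exists q', a.
exists (fun x => rsup [set: nat] (fun n => q' n x * a n)); split => //.
  exact: (rseminorm_submixed NG').
exists C => // x.
have [M qM] := submixed_bound NG x Gq a0 acvg.
have [M' qM'] := submixed_bound NG' x Gq' a0 acvg.
apply/(rsup_leP qM); first by rewrite mulr_ge0 ?rsup_ge0 ?ltW.
move=> n _; apply: (@le_trans _ _ (C * (q' n x * a n))).
  by rewrite mulrA ler_wpM2r//; have [_] := q'P n.
by rewrite ler_pM2l//; apply: (le_rsup qM').
Qed.

Lemma tvs_cauchy_rtopology G (F : set_system X) : (forall q, G q ->
  rseminorm q) ->
  tvs_cauchy (rtopology G) F -> forall q, G q -> forall e : R, 0 < e ->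
  exists2 A, F A & forall x y, A x -> A y -> q (x - y) < e.
Proof.
move=> sG cF q Gq e e0.
have /cF[A FA Aq] : nbhs (0 : tspace (rtopology G)) [set y | q (y - 0) < e].
  by apply: nbhs_rseminorm_ball => //; exact: sG.
by exists A => // x y Ax Ay; have := Aq x y Ax Ay; rewrite /= subr0.
Qed.

End saks_families.

(** * The seminorms q_S as a Saks family *)

Section weighted_seminorms.
Local Open Scope ring_scope.
Context (R : realType) (k : scalar_kind) (Omega Lambda : Type).
Local Notation K := (scalars R k).
Context (E : normedModType K) (D : weighted_data Omega Lambda E)
  (v : Lambda -> {posnum R}).
Implicit Types (f g : Omega -> E) (S : set Lambda).

Definition wterm f x : R := rnorm (wop D f x) * (v x)%:num.

Definition wsemi S f : R := wsem D f + rsup S (wterm f).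

Lemma wterm_ge0 f x : 0 <= wterm f x.
Proof. by rewrite mulr_ge0// rnorm_ge0. Qed.

Lemma wsem_ge0 f : wdom D f -> 0 <= wsem D f.
Proof.
by move=> df; have [/(_ f df)] := wsem_seminorm D; rewrite lee_fin => /andP[].
Qed.

Lemma wsemD f g : wdom D f -> wdom D g -> wsem D (f + g) <= wsem D f + wsem D g.
Proof.
move=> df dg; have [_ _ /(_ f g df dg)] := wsem_seminorm D.
by rewrite -EFinD lee_fin.
Qed.

Lemma wsemZ (a : K) f : wdom D f -> wsem D (a *: f) = rnorm a * wsem D f.
Proof.
by move=> df; have [_ /(_ a f df) + _] := wsem_seminorm D;
  rewrite -EFinM => -[].
Qed.

Lemma wdom0 : wdom D 0.
Proof. by have [+ _] := wdom_submod D; rewrite inE. Qed.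

Lemma wop0 : wop D 0 = 0.
Proof.
have := @wop_linear _ _ _ _ _ D 1 0 0 wdom0 wdom0.
rewrite !scale1r addr0 => /(congr1 (fun h => h - wop D 0)).
by rewrite subrr addrK => <-.
Qed.

Lemma wopD f g : wdom D f -> wdom D g -> wop D (f + g) = wop D f + wop D g.
Proof. by move=> df dg; have := wop_linear 1 df dg; rewrite !scale1r. Qed.

Lemma wopZ (a : K) f : wdom D f -> wop D (a *: f) = a *: wop D f.
Proof. by move=> df; have := wop_linear a df wdom0; rewrite wop0 !addr0. Qed.

Lemma wtermD f g x : wdom D f -> wdom D g ->
  wterm (f + g) x <= wterm f x + wterm g x.
Proof.
move=> df dg; rewrite /wterm wopD// -mulrDl ler_wpM2r//.
exact: ler_rnormD.
Qed.

Lemma wtermZ (a : K) f x : wdom D f -> wterm (a *: f) x = rnorm a * wterm f x.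
Proof. by move=> df; rewrite /wterm wopZ// rnormZ mulrA. Qed.

Lemma Fv_bounded f : Fv D v f -> exists M, forall x, setT x -> wterm f x <= M.
Proof.
move=> [df]; rewrite /wnorm /wseminorm.
set s := nnsup _ _ => sfin.
have s0 : (0 <= s)%E by apply: ereal_sup_ubound; left.
have le x : ((wterm f x)%:E <= s)%E by apply: ereal_sup_ubound; right; exists x.
case: s s0 sfin le => [M _ _ le|_|//]; last by rewrite addeC addye.
by exists M => x _; rewrite -lee_fin le.
Qed.

Lemma wseminormE S f : Fv D v f -> wseminorm D v S f = (wsemi S f)%:E.
Proof.
move=> /Fv_bounded[M fM]; rewrite /wseminorm (@nnsup_rsup _ _ S (wterm f) M)//.
by move=> x _; exact: fM.
Qed.

(** The separate bound on [wsem D f] covers the case of empty [S]. *)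
Lemma wsemi_leP S f c : Fv D v f -> 0 <= c ->
  wsemi S f <= c <->
  wsem D f <= c /\ forall x, S x -> wsem D f + wterm f x <= c.
Proof.
move=> Ff c0; have [M fM] := Fv_bounded Ff.
have fM' x : S x -> wterm f x <= M by move=> _; exact: fM.
rewrite /wsemi; split=> [fc|[fc fSc]].
  have := rsup_ge0 S (wterm f); split; first lra.
  by move=> x Sx; have := le_rsup fM' Sx; lra.
rewrite addrC -lerBrDr; apply/(rsup_leP fM'); first lra.
by move=> x /fSc; lra.
Qed.

Lemma wsem_le_wsemi S f : wsem D f <= wsemi S f.
Proof. by rewrite lerDl rsup_ge0. Qed.

Lemma le_wsemi S f x : Fv D v f -> S x -> wsem D f + wterm f x <= wsemi S f.
Proof.
move=> Ff Sx; have [M fM] := Fv_bounded Ff.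
by rewrite lerD2l; apply: (@le_rsup _ _ S (wterm f) M) => // y _; exact: fM.
Qed.

Lemma wsemi_ge0 S f : Fv D v f -> 0 <= wsemi S f.
Proof. by move=> [df _]; rewrite addr_ge0 ?wsem_ge0 ?rsup_ge0. Qed.

Lemma wsemi_mono S S' f : Fv D v f -> S `<=` S' -> wsemi S f <= wsemi S' f.
Proof.
move=> Ff SS'; apply/(wsemi_leP _ Ff (wsemi_ge0 _ Ff)); split.
  exact: wsem_le_wsemi.
by move=> x /SS'; exact: le_wsemi.
Qed.

Lemma FvD f g : Fv D v f -> Fv D v g -> Fv D v (f + g).
Proof.
move=> Ff Fg; have [_ /(_ 1 f g)] := Fv_submod D v.
by rewrite !inE scale1r; apply.
Qed.

Lemma FvZ (a : K) f : Fv D v f -> Fv D v (a *: f).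
Proof.
move=> Ff; have [F0 /(_ a f 0)] := Fv_submod D v.
by rewrite !inE addr0; apply=> //; move: F0; rewrite inE.
Qed.

Lemma wsemiD S f g : Fv D v f -> Fv D v g ->
  wsemi S (f + g) <= wsemi S f + wsemi S g.
Proof.
move=> Ff Fg; have [df _] := Ff; have [dg _] := Fg.
apply/wsemi_leP; first exact: FvD.
  by rewrite addr_ge0// wsemi_ge0.
have := wsemD df dg; have := wsem_le_wsemi S f; have := wsem_le_wsemi S g.
split; first lra.
move=> x Sx; have := wtermD x df dg.
by have := le_wsemi Ff Sx; have := le_wsemi Fg Sx; lra.
Qed.

Lemma wsemiZ S (a : K) f : Fv D v f -> wsemi S (a *: f) <= rnorm a * wsemi S f.
Proof.
move=> Ff; have [df _] := Ff; have ra := rnorm_ge0 a.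
apply/wsemi_leP; first exact: FvZ.
  by rewrite mulr_ge0// wsemi_ge0.
split; first by rewrite wsemZ// ler_wpM2l// wsem_le_wsemi.
move=> x Sx; rewrite wsemZ// wtermZ// -mulrDr ler_wpM2l//.
exact: le_wsemi.
Qed.

Lemma weighted_funP (f : weighted_space D v) : Fv D v f.
Proof. by have := wfunP f; rewrite inE. Qed.

Lemma rseminorm_wsemi S :
  rseminorm (fun f : weighted_space D v => wsemi S f).
Proof.
split=> [f g|a f]; first by apply: wsemiD; exact: weighted_funP.
by apply: wsemiZ; exact: weighted_funP.
Qed.

Definition wsystem (SS : set (set Lambda)) : set (weighted_space D v -> R) :=
  [set (fun f : weighted_space D v => wsemi S f) | S in SS].

Lemma tau_systemE SS :
  tau_system D v SS = [set (fun f : weighted_space D v => (q f)%:E) | q in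
    wsystem SS].
Proof.
rewrite /tau_system /wsystem image_comp; apply: eq_imagel => S _ /=.
by apply/funext => f; rewrite wseminormE//; exact: weighted_funP.
Qed.

Lemma weighted_normE :
  weighted_norm D v = fun f : weighted_space D v => (wsemi setT f)%:E.
Proof.
by apply/funext => f; rewrite /weighted_norm /wnorm wseminormE//;
  exact: weighted_funP.
Qed.

Lemma wsystem_saks (SS : set (set Lambda)) : setU_closed SS ->
  \bigcup_(S in SS) S = setT -> SS !=set0 ->
  saks_family (fun f : weighted_space D v => wsemi setT f) (wsystem SS).
Proof.
move=> SSU cov [S0 SS0]; split.
- exact: rseminorm_wsemi.
- by move=> _ [S _ <-]; exact: rseminorm_wsemi.
- split; first by exists (fun f : weighted_space D v => wsemi S0 f), S0.
  move=> _ _ [S SSS <-] [S' SSS' <-];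
    exists (fun f : weighted_space D v => wsemi (S `|` S') f).
    by exists (S `|` S') => //; exact: SSU.
  by move=> f; have Ff := weighted_funP f; split; exact: wsemi_mono.
- by move=> _ f [S _ <-]; apply: wsemi_mono => //; exact: weighted_funP.
- move=> f c qc; have Ff := weighted_funP f; have c0 : 0 <= c.
    by apply: le_trans (qc _ (ex_intro2 _ _ S0 SS0 erefl)); exact: wsemi_ge0.
  apply/wsemi_leP => //; split.
    apply: le_trans (qc _ (ex_intro2 _ _ S0 SS0 erefl)).
    exact: wsem_le_wsemi.
  move=> x _; have : setT x by []; rewrite -cov => -[S SSS Sx].
  apply: le_trans (qc _ (ex_intro2 _ _ S SSS erefl)).
  exact: le_wsemi.
Qed.

End weighted_seminorms.

Arguments wsystem {R k Omega Lambda E} D v SS.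

(** * Weak and strong seminorms *)

Section dual_ball_theory.
Local Open Scope ring_scope.
Context (R : realType) (k : scalar_kind).
Local Notation K := (scalars R k).
Context (E : normedModType K).
Implicit Types (e : {linear E -> K^o}) (x : E).

Let rn (a : K^o) : R := rnorm a.

Lemma rseminorm_rnorm : rseminorm (fun x : E => rnorm x).
Proof. by split=> [x y|a x]; [exact: ler_rnormD|rewrite rnormZ]. Qed.

Lemma dual_ballP e : dual_ball E e <-> forall x, rn (e x) <= rnorm x.
Proof.
split=> [[_ e1] x|ex].
  have [->|x0] := eqVneq x 0; first by rewrite linear0 /rn !rnorm0.
  have xp : 0 < rnorm x.
    by rewrite lt_def rnorm_ge0 andbT; apply: contra_neq x0 => /rnorm_eq0.
  move: e1; rewrite /dual_norm nnsup_leP// => /(_ (of_real k (rnorm x)^-1 *: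
    x)).
  rewrite /= rsemi_of_real; last exact: rseminorm_rnorm.
  rewrite gtr0_norm ?invr_gt0// mulVf ?gt_eqF// lexx => /(_ isT).
  rewrite linearZ lee_fin rnormZ rnorm_of_real gtr0_norm ?invr_gt0//.
  by rewrite mulrC ler_pdivrMr// mul1r.
split.
  move=> x A /nbhs_rnormP[d d0 dA]; apply/nbhs_rnormP; exists d => // y yx.
  by apply: dA; rewrite -linearB; exact: le_lt_trans (ex _) yx.
by apply/nnsup_leP => // x /= x1; rewrite lee_fin; exact: le_trans (ex x) x1.
Qed.

Lemma norming_functional x : exists2 e, dual_ball E e & rn (e x) = rnorm x.
Proof.
have [e [ex ex0]] := dominated_functional x rseminorm_rnorm.
by exists e => //; apply/dual_ballP.
Qed.

(** Estimates over the dual unit ball pass in this way to every continuous functional, as needed for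
    membership in [Fv_sigma]. *)
Lemma norm_dual_scale e : norm_dual E e ->
  exists c e', [/\ 0 < c, dual_ball E e' & forall x, e x = of_real k c * e' x].
Proof.
move=> ce.
have e00 : nbhs (e 0 : K^o) [set y : K^o | rn y < 1].
  by apply/nbhs_rnormP; exists 1 => // y; rewrite linear0 subr0.
have /nbhs_rnormP[d d0 dE] := ce 0 _ e00.
pose c := 2 / d; have c0 : 0 < c by rewrite divr_gt0.
pose e' : {linear E -> K^o} := of_real k c^-1 \*: e.
have re : rseminorm (fun x => rn (e x)).
  split=> [x y|a x]; first by rewrite linearD; exact: ler_rnormD.
  by rewrite linearZ /rn rnormZ.
have rc : rseminorm (fun x : E => c * rnorm x).
  by apply: rseminormM; [exact: ltW|exact: rseminorm_rnorm].
have ec x : rn (e x) <= c * rnorm x.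
  move: x; apply: rsemi_le => // x cx; apply: ltW; apply: dE.
  rewrite subr0; move: cx; rewrite mulrC -ltr_pdivlMr// mul1r /c invf_div.
  by move=> h; apply: lt_trans h _; lra.
exists c, e'; split=> //.
  apply/dual_ballP => x; rewrite /e' /= /rn rnormZ rnorm_of_real.
  by rewrite gtr0_norm ?invr_gt0// mulrC ler_pdivrMr// mulrC ec.
move=> x; rewrite /e' /= /GRing.scale /= mulrA -of_realM mulfV ?gt_eqF//.
by rewrite of_real1 mul1r.
Qed.

End dual_ball_theory.

(** * Consequences of (i) and (ii) *)

Section weak_strong.
Local Open Scope ring_scope.
Context (R : realType) (k : scalar_kind) (Omega Lambda : Type).
Local Notation K := (scalars R k).
Context (v : Lambda -> {posnum R}) (E : normedModType K)
  (D : weighted_data Omega Lambda K^o) (DE : weighted_data Omega Lambda E).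
Hypotheses
  (Hi : forall (e : {linear E -> K^o}) (f : Omega -> E),
      norm_dual E e -> Fv DE v f ->
      Fv D v (e \o f) /\ e \o wop DE f = wop D (e \o f))
  (Hii : forall f : Omega -> E, Fv DE v f ->
      (wsem DE f)%:E = nnsup (dual_ball E) (fun e => (wsem D (e \o f))%:E)).
Implicit Types (f g : Omega -> E) (S : set Lambda) (e : {linear E -> K^o}).

Lemma wterm_comp e f x : norm_dual E e -> Fv DE v f ->
  wterm D v (e \o f) x = rnorm (e (wop DE f x) : K^o) * (v x)%:num.
Proof. by move=> ne Ff; have [_ opE] := Hi ne Ff; rewrite /wterm -opE. Qed.

Lemma wsem_weak_le e f : dual_ball E e -> Fv DE v f ->
  wsem D (e \o f) <= wsem DE f.
Proof.
move=> be Ff; rewrite -lee_fin (Hii Ff); apply: ereal_sup_ubound; right.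
by exists e.
Qed.

Lemma wsem_leP f c : Fv DE v f -> 0 <= c ->
  (forall e, dual_ball E e -> wsem D (e \o f) <= c) -> wsem DE f <= c.
Proof.
move=> Ff c0 fc; rewrite -lee_fin (Hii Ff); exact/nnsup_leP.
Qed.

Lemma wterm_weak_le e f x : dual_ball E e -> Fv DE v f ->
  wterm D v (e \o f) x <= wterm DE v f x.
Proof.
move=> be Ff; rewrite wterm_comp//; last by case: be.
by rewrite ler_wpM2r//; exact: (dual_ballP e).1.
Qed.

Lemma wterm_norming f x : Fv DE v f ->
  exists2 e, dual_ball E e & wterm D v (e \o f) x = wterm DE v f x.
Proof.
move=> Ff; have [e be ex] := norming_functional (wop DE f x).
by exists e => //; rewrite wterm_comp//; [rewrite /wterm -ex|case: be].
Qed.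

Lemma wsemi_weak_le S e f : dual_ball E e -> Fv DE v f ->
  wsemi D v S (e \o f) <= wsemi DE v S f.
Proof.
move=> be Ff; have [Fe _] := Hi be.1 Ff.
apply/(wsemi_leP _ Fe (wsemi_ge0 _ Ff)); split.
  exact: le_trans (wsem_weak_le be Ff) (wsem_le_wsemi _ _ _ _).
move=> x Sx; apply: le_trans (le_wsemi Ff Sx).
by apply: lerD; [exact: wsem_weak_le|exact: wterm_weak_le].
Qed.

(** Hypothesis (ii) bounds q by c, and a functional norming T f(x) bounds the term at x by c. Since
    different functionals are involved, the two bounds are added. *)
Lemma wsemi_le_weak S f c : Fv DE v f -> 0 <= c ->
  (forall e, dual_ball E e -> wsemi D v S (e \o f) <= c) ->
  wsemi DE v S f <= 2 * c.
Proof.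
move=> Ff c0 fc.
have qc : wsem DE f <= c.
  apply: wsem_leP => // e be; apply: le_trans (fc e be).
  exact: wsem_le_wsemi.
apply/wsemi_leP => //; first by rewrite mulr_ge0.
split=> [|x Sx]; first lra.
have [e be <-] := wterm_norming x Ff; have [Fe _] := Hi be.1 Ff.
have := fc e be; have := le_wsemi Fe Sx; have := wsem_ge0 Fe.1; lra.
Qed.

Definition weak_wsemi S f : R :=
  rsup (dual_ball E) (fun e => wsemi D v S (e \o f)).

Let weak_bound S f : Fv DE v f ->
  forall e, dual_ball E e -> wsemi D v S (e \o f) <= wsemi DE v S f.
Proof. by move=> Ff e be; exact: wsemi_weak_le. Qed.

Lemma wseminorm_sigmaE S f : Fv DE v f ->
  wseminorm_sigma D v S f = (weak_wsemi S f)%:E.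
Proof.
move=> Ff; rewrite /weak_wsemi -(nnsup_rsup (weak_bound S Ff)).
rewrite /wseminorm_sigma /nnsup; congr (ereal_sup (_ `|` _)).
by apply: eq_imagel => e be; rewrite wseminormE//; exact: (Hi be.1 Ff).1.
Qed.

Lemma weak_wsemi_leP S f c : Fv DE v f -> 0 <= c ->
  weak_wsemi S f <= c <-> forall e, dual_ball E e -> wsemi D v S (e \o f) <= c.
Proof. by move=> Ff c0; exact: (rsup_leP (weak_bound S Ff)). Qed.

Lemma le_weak_wsemi S f e : Fv DE v f -> dual_ball E e ->
  wsemi D v S (e \o f) <= weak_wsemi S f.
Proof. by move=> Ff be; exact: (le_rsup (weak_bound S Ff)). Qed.

Lemma weak_wsemi_ge0 S f : 0 <= weak_wsemi S f.
Proof. exact: rsup_ge0. Qed.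

Lemma weak_wsemi_le S f : Fv DE v f -> weak_wsemi S f <= wsemi DE v S f.
Proof.
by move=> Ff; apply/(weak_wsemi_leP S Ff (wsemi_ge0 _ Ff)); exact: weak_bound.
Qed.

Lemma wsemi_le_weak_wsemi S f : Fv DE v f ->
  wsemi DE v S f <= 2 * weak_wsemi S f.
Proof.
move=> Ff; apply: wsemi_le_weak => // [|e be]; first exact: weak_wsemi_ge0.
exact: le_weak_wsemi.
Qed.

Lemma Fv_sigma_submod : submod_closed [in Fv_sigma E D v].
Proof.
split=> [|a f g]; rewrite !inE.
  move=> e _; rewrite (_ : e \o 0 = 0); last first.
    by apply/funext => x /=; rewrite linear0.
  by have [+ _] := Fv_submod D v; rewrite inE.
move=> Ff Fg e ne; rewrite (_ : e \o _ = a *: (e \o f : Omega ->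
  K^o) + (e \o g)).
  by apply: FvD; [apply: FvZ; exact: Ff|exact: Fg].
by apply/funext => x /=; rewrite linearP.
Qed.

Lemma Fv_sub_sigma : Fv DE v `<=` Fv_sigma E D v.
Proof. by move=> f Ff e ne; exact: (Hi ne Ff).1. Qed.

Lemma wnorm_weak f : Fv DE v f ->
  (wnorm_sigma D v f <= wnorm DE v f <= 2%:E * wnorm_sigma D v f)%E.
Proof.
move=> Ff; rewrite /wnorm [wnorm_sigma _ _ _](wseminorm_sigmaE setT Ff).
rewrite wseminormE// -EFinM !lee_fin weak_wsemi_le//.
exact: wsemi_le_weak_wsemi.
Qed.

(** Without the summand q each term is normed by its own functional, and no factor is lost. *)
Lemma wnorm_weak_eq f : (forall h, wdom D h -> wsem D h = 0) -> Fv DE v f ->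
  wnorm_sigma D v f = wnorm DE v f.
Proof.
move=> q0 Ff; rewrite /wnorm [wnorm_sigma _ _ _](wseminorm_sigmaE setT Ff).
rewrite wseminormE//; congr EFin; apply/eqP; rewrite eq_le weak_wsemi_le//=.
have dom0 e : dual_ball E e -> wsem D (e \o f) = 0.
  by move=> be; have [[/q0]] := Hi be.1 Ff.
have -> : wsemi DE v setT f = rsup setT (wterm DE v f).
  rewrite /wsemi (_ : wsem DE f = 0) ?add0r//.
  apply/eqP; rewrite eq_le wsem_ge0 ?andbT; last by case: Ff.
  by apply: wsem_leP => // e be; rewrite dom0.
have [M fM] := Fv_bounded Ff.
apply/(rsup_leP fM); first exact: weak_wsemi_ge0.
move=> x _; have [e be <-] := wterm_norming x Ff.
apply: le_trans (le_weak_wsemi setT Ff be).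
have [Fe _] := Hi be.1 Ff; have := le_wsemi Fe (I : setT x).
by rewrite dom0// add0r.
Qed.

Lemma weighted_norm_eq0 : is_norm (weighted_norm D v) ->
  forall f : weighted_space DE v, wsemi DE v setT f = 0 -> f = 0.
Proof.
move=> [_ D0] f f0; apply: val_inj; apply/funext => w /=.
have Ff := weighted_funP f.
have [e be ew] := norming_functional (f w); apply: rnorm_eq0; rewrite -ew.
have [Fe _] := Hi be.1 Ff.
pose h : weighted_space D v := WeightedSpace (mem_set Fe).
suff : h = 0.
  by move=> /(congr1 (fun h : weighted_space D v => h w)) /= ->; exact: rnorm0.
apply: D0; rewrite weighted_normE; congr EFin.
apply/eqP; rewrite eq_le wsemi_ge0 ?andbT//.
by apply: le_trans (wsemi_weak_le _ be Ff) _; rewrite f0.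
Qed.

Definition weak_system (SS : set (set Lambda)) : set (weighted_space DE v ->
  R) :=
  [set (fun f : weighted_space DE v => weak_wsemi S f) | S in SS].

Lemma sigma_systemE SS : sigma_system D v DE SS =
  [set (fun f : weighted_space DE v => (q f)%:E) | q in weak_system SS].
Proof.
rewrite /sigma_system /weak_system image_comp; apply: eq_imagel => S _ /=.
by apply/funext => f; rewrite wseminorm_sigmaE//; exact: weighted_funP.
Qed.

Lemma rseminorm_weak_wsemi S :
  rseminorm (fun f : weighted_space DE v => weak_wsemi S f).
Proof.
split=> [f g|a f]; have Ff := weighted_funP f.
  have Fg := weighted_funP g; apply/weak_wsemi_leP.
  - exact: (weighted_funP (f + g)).
  - by rewrite addr_ge0// weak_wsemi_ge0.
  move=> e be; rewrite (_ : e \o _ = (e \o f : Omega -> K^o) + (e \o g));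
    last first.
    by apply/funext => x /=; rewrite linearD.
  have [Fef _] := Hi be.1 Ff; have [Feg _] := Hi be.1 Fg.
  apply: (le_trans (wsemiD _ Fef Feg)).
  by apply: lerD; exact: le_weak_wsemi.
apply/weak_wsemi_leP.
- exact: (weighted_funP (a *: f)).
- by rewrite mulr_ge0 ?rnorm_ge0 ?weak_wsemi_ge0.
move=> e be; rewrite (_ : e \o _ = a *: (e \o f : Omega -> K^o)); last first.
  by apply/funext => x /=; rewrite linearZ.
have [Fef _] := Hi be.1 Ff; apply: (le_trans (wsemiZ _ _ Fef)).
by rewrite ler_wpM2l ?rnorm_ge0//; exact: le_weak_wsemi.
Qed.

Lemma weak_wsemi_mono S S' f : Fv DE v f -> S `<=` S' ->
  weak_wsemi S f <= weak_wsemi S' f.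
Proof.
move=> Ff SS'; apply/(weak_wsemi_leP S Ff (weak_wsemi_ge0 _ _)) => e be.
apply: le_trans (le_weak_wsemi S' Ff be).
by apply: wsemi_mono => //; exact: (Hi be.1 Ff).1.
Qed.

Lemma weak_system_saks (SS : set (set Lambda)) : setU_closed SS ->
  \bigcup_(S in SS) S = setT -> SS !=set0 ->
  saks_family (fun f : weighted_space DE v => weak_wsemi setT f) (weak_system
    SS).
Proof.
move=> SSU cov [S0 SS0]; split.
- exact: rseminorm_weak_wsemi.
- by move=> _ [S _ <-]; exact: rseminorm_weak_wsemi.
- split; first by exists (fun f : weighted_space DE v => weak_wsemi S0 f), S0.
  move=> _ _ [S SSS <-] [S' SSS' <-].
  exists (fun f : weighted_space DE v => weak_wsemi (S `|` S') f).
    by exists (S `|` S') => //; exact: SSU.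
  by move=> f; have Ff := weighted_funP f; split; exact: weak_wsemi_mono.
- by move=> _ f [S _ <-]; apply: weak_wsemi_mono => //; exact: weighted_funP.
- move=> f c qc; have Ff := weighted_funP f; have c0 : 0 <= c.
    by apply: le_trans (qc _ (ex_intro2 _ _ S0 SS0 erefl));
      exact: weak_wsemi_ge0.
  apply/weak_wsemi_leP => // e be; have [Fe _] := Hi be.1 Ff.
  apply/wsemi_leP => //; split.
    apply: le_trans (qc _ (ex_intro2 _ _ S0 SS0 erefl)).
    apply: le_trans (le_weak_wsemi _ Ff be).
    exact: wsem_le_wsemi.
  move=> x _; have : setT x by []; rewrite -cov => -[S SSS Sx].
  apply: le_trans (qc _ (ex_intro2 _ _ S SSS erefl)).
  apply: le_trans (le_weak_wsemi _ Ff be).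
  exact: le_wsemi.
Qed.

Lemma submixed_weak_strong (SS : set (set Lambda)) : setU_closed SS ->
  \bigcup_(S in SS) S = setT -> SS !=set0 ->
  submixed_topology (tau_system DE v SS) =
  submixed_topology (sigma_system D v DE SS).
Proof.
move=> SSU cov SS0; have NG := wsystem_saks DE v SSU cov SS0.
have NG' := weak_system_saks SSU cov SS0.
rewrite tau_systemE sigma_systemE (submixed_topologyE NG) (submixed_topologyE
  NG').
apply: topology_eqP; rewrite eqEsubset; split.
  apply: (coarser_submixed (C := 2) _ NG NG') => // _ [S SSS <-].
  exists (fun f : weighted_space DE v => weak_wsemi S f); first by exists S.
  by move=> f; apply: wsemi_le_weak_wsemi; exact: weighted_funP.
apply: (coarser_submixed (C := 1) _ NG' NG) => // _ [S SSS <-].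
exists (fun f : weighted_space DE v => wsemi DE v S f); first by exists S.
by move=> f; rewrite mul1r; apply: weak_wsemi_le; exact: weighted_funP.
Qed.

End weak_strong.

(** * Completeness *)

Section completeness.
Local Open Scope ring_scope.

Lemma tvs_cauchy_image (R : realType) (k : scalar_kind)
    (X Y : lmodType (scalars R k)) (P : set (X -> R)) (Q : set (Y -> R))
    (Phi : X -> Y) (F : set_system X) : Filter F ->
  (forall x y, Phi (x - y) = Phi x - Phi y) ->
  (forall p, P p -> rseminorm p) ->
  (forall q, Q q -> exists2 p, P p &
    exists2 c : R, 0 < c & forall x, q (Phi x) <= c * p x) ->
  tvs_cauchy (rtopology P) F -> tvs_cauchy (rtopology Q) (Phi @ F).
Proof.
move=> FF PhiB sP QP cF U U0.
(* [H] consists of the sets that contain all [Phi (x - y)] with x, y in some member of [F]. The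
   image is Cauchy when [H] converges to 0, which can be tested on seminorms. *)
pose H := [set V : set Y | exists2 A, F A & forall x y, A x -> A y ->
  V (Phi (x - y))].
have FH : Filter H.
  split; first by exists setT => //; exact: filterT.
    move=> V W [A FA AV] [B FB BW]; exists (A `&` B); first exact: filterI.
    by move=> x y [Ax Bx] [Ay By]; split; [exact: AV|exact: BW].
  by move=> V W VW [A FA AV]; exists A => // x y Ax Ay; exact/VW/AV.
have [A FA AU] : H U.
  apply: (@cvg_rtopology _ _ _ Q H 0 FH _ U U0) => q Qq e e0.
  have [p Pp [c c0 qp]] := QP q Qq.
  have [A FA Ap] := tvs_cauchy_rtopology sP cF Pp (divr_gt0 e0 c0).
  exists A => // x y Ax Ay; rewrite /= subr0; apply: (le_lt_trans (qp _)).
  by rewrite mulrC -ltr_pdivlMr//; exact: Ap.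
exists (Phi @` A).
  suff : F (Phi @^-1` (Phi @` A)) by [].
  by apply: filterS FA => x Ax; exists x.
by move=> _ _ [x Ax <-] [y Ay <-]; rewrite -PhiB; exact: AU.
Qed.

Context (R : realType) (k : scalar_kind) (Omega Lambda : pointedType).
Local Notation K := (scalars R k).
Context (v : Lambda -> {posnum R}) (E : normedModType K)
  (D : weighted_data Omega Lambda K^o) (DE : weighted_data Omega Lambda E).
Hypotheses
  (Fv_normed : is_norm (weighted_norm D v))
  (Hi : forall (e : {linear E -> K^o}) (f : Omega -> E),
      norm_dual E e -> Fv DE v f ->
      Fv D v (e \o f) /\ e \o wop DE f = wop D (e \o f))
  (Hii : forall f : Omega -> E, Fv DE v f ->
      (wsem DE f)%:E = nnsup (dual_ball E) (fun e => (wsem D (e \o f))%:E)).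
Context (SS : set (set Lambda)).
Hypotheses (SSU : setU_closed SS) (cov : \bigcup_(S in SS) S = setT)
  (SS0 : SS !=set0).
Implicit Types (e : {linear E -> K^o}).

Local Notation X := (weighted_space D v).
Local Notation Y := (weighted_space DE v).
Local Notation GX := (wsystem D v SS).
Local Notation GY := (wsystem DE v SS).
Let GXs := wsystem_saks D v SSU cov SS0.
Let GYs := wsystem_saks DE v SSU cov SS0.
Let sX q : GX q -> rseminorm q. Proof. by case: GXs => _ + _ _ _; apply. Qed.
Let sY q : GY q -> rseminorm q. Proof. by case: GYs => _ + _ _ _; apply. Qed.
Let dX : rdirected GX. Proof. by case: GXs. Qed.

Definition weak_eval e (ne : norm_dual E e) (f : Y) : X :=
  WeightedSpace (mem_set (Hi ne (weighted_funP f)).1).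

Lemma weak_evalB e (ne : norm_dual E e) (f g : Y) :
  weak_eval ne (f - g) = weak_eval ne f - weak_eval ne g.
Proof. by apply: val_inj; apply/funext => w /=; rewrite linearB. Qed.

Lemma wsemi_weak_eval_le e (ne : norm_dual E e) :
  exists2 c : R, 0 < c & forall S (f : Y),
    wsemi D v S (weak_eval ne f) <= c * wsemi DE v S f.
Proof.
have [c [e' [c0 be' ee']]] := norm_dual_scale ne.
exists c => // S f; have Ff := weighted_funP f.
have -> : weak_eval ne f = of_real k c *: weak_eval be'.1 f.
  by apply: val_inj; apply/funext => w /=; rewrite ee'.
rewrite (rsemi_of_real _ _ (rseminorm_wsemi D v S)) gtr0_norm// ler_pM2l//.
exact: wsemi_weak_le.
Qed.

Hypothesis ptau : coarser (pointwise_topology D v) (tau_topology D v SS).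

(** The set {|g(w)| < 1} is open for the pointwise topology, so it contains a tau-ball around 0;
    homogeneity turns this into an estimate. *)
Lemma eval_scalar_bound w : exists2 S, SS S & exists2 c : R, 0 < c &
  forall g : X, rnorm (g w) <= c * wsemi D v S g.
Proof.
pose A := [set g : X | rnorm (g w) < 1].
have oA : opens (pointwise_topology D v) A.
  pose U := [set y : K^o | rnorm y < 1].
  have oU : open U.
    rewrite openE => y Uy; apply/nbhs_rnormP; exists (1 - rnorm y).
      by rewrite subr_gt0.
    move=> z zy; have := ler_rnormD (z - y) y; rewrite subrK /U /=; lra.
  have pc : continuous (fun f : {ptws Omega -> K^o} => f w).
    exact: (@proj_continuous Omega (fun=> K^o) w).
  have oB := (continuousP (fun f : {ptws Omega -> K^o} => f w)).1 pc U oU.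
  exact: ((continuousP _).1 (@initial_continuous X {ptws Omega -> K^o}
    (fun f : X => (f : {ptws Omega -> K^o}))) _ oB).
move: (ptau oA); rewrite /tau_topology tau_systemE => oA'.
have A0 : A 0 by rewrite /A /= rnorm0.
have : nbhs (0 : tspace (rtopology GX)) A by exact: (@open_nbhs_nbhs (tspace
  (rtopology GX)) 0 A (conj oA' A0)).
move=> /(nbhs_rtopologyP 0 A sX dX)[_ [[S SSS <-] [d d0 dA]]].
have di0 : 0 < d^-1 by rewrite invr_gt0.
exists S => //; exists d^-1 => // g.
have sr : rseminorm (fun g : X => rnorm (g w)).
  by split=> [g1 g2|a g1] /=; [exact: ler_rnormD|rewrite rnormZ].
have sd : rseminorm (fun g : X => d^-1 * wsemi D v S g).
  by apply: rseminormM; [exact: ltW|exact: rseminorm_wsemi].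
apply: (rsemi_le sr sd) => h; rewrite mulrC ltr_pdivrMr// mul1r => hd.
by apply/ltW/dA; rewrite subr0.
Qed.

Lemma eval_bound w : exists2 S, SS S & exists2 c : R, 0 < c &
  forall f : Y, rnorm (f w) <= c * wsemi DE v S f.
Proof.
have [S SSS [c c0 cS]] := eval_scalar_bound w.
exists S => //; exists c => // f; have [e be <-] := norming_functional (f w).
apply: (le_trans (cS (weak_eval be.1 f))); rewrite ler_pM2l//.
exact: (wsemi_weak_le Hi Hii _ be (weighted_funP f)).
Qed.

Hypothesis sigmaE : Fv DE v = Fv_sigma E D v.
Hypothesis E_complete :
  forall F : set_system E, ProperFilter F -> cauchy F -> cvg F.
Hypothesis Xball : semi_montel (mixed_topology (weighted_norm D v)
  (tau_topology D v SS)).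

Let tauX : tau_topology D v SS = rtopology GX.
Proof. by rewrite /tau_topology tau_systemE. Qed.

Lemma submixed_cauchy_pointwise (F : set_system Y) : ProperFilter F ->
  tvs_cauchy (rtopology (submixed_seminorms GY)) F ->
  forall w, cvg ((fun f : Y => f w) @ F).
Proof.
move=> FF cF w; apply: E_complete.
have [S SSS [c c0 cS]] := eval_bound w.
apply/cauchy_exP => d d0; have dE := gt0_of_real (d0 : 0 < (d : K)).
have rd0 : 0 < rnorm (d : K) by rewrite -(ltr_of_real k) -dE of_real0.
have cF' : tvs_cauchy (rtopology GY) F.
  move=> U U0; apply: cF.
  by move/coarserP: (tau_coarser_submixed GYs); apply.
have GS : GY (fun f : Y => wsemi DE v S f) by exists S.
have [A FA AS] := tvs_cauchy_rtopology sY cF' GS (divr_gt0 rd0 c0).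
have [f Af] := filter_ex FA; exists (f w).
suff : F [set h : Y | ball (f w) d (h w)] by [].
apply: filterS FA => h Ah; apply/(ball_rnormP _ _ (d0 : 0 < (d : K))).
have fh : rnorm (f w - h w) <= c * wsemi DE v S (f - h) by exact: cS (f - h).
apply: (le_lt_trans fh); rewrite mulrC -ltr_pdivlMr//.
exact: AS.
Qed.

Lemma submixed_complete : tvs_complete (rtopology (submixed_seminorms GY)).
Proof.
move=> F FF cF.
have /choice[f fP] : forall w, exists y : E, (fun h : Y => h w) @ F --> y.
  move=> w; exists (lim ((fun h : Y => h w) @ F)).
  exact: submixed_cauchy_pointwise.
have sGY : forall p, submixed_seminorms GY p -> rseminorm p.
  by move=> p; exact: (rseminorm_submixed GYs).
have cvgX e (ne : norm_dual E e) : exists g : X,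
    (weak_eval ne @ F) --> (g : tspace (rtopology GX)).
  have cX : forall r : R, exists2 B : set X,
    compact (B : set (tspace (rtopology GX))) &
      [set x : X | wsemi D v setT x <= r] `<=` B.
    move=> r; apply: (semi_montel_ball_compact r GXs).
    by move: Xball; rewrite weighted_normE tauX.
  suff : tvs_cauchy (rtopology (submixed_seminorms GX)) (weak_eval ne @ F).
    exact: (submixed_cauchy_cvg GXs cX).
  have W := @tvs_cauchy_image R k Y X (submixed_seminorms GY)
    (submixed_seminorms GX) (weak_eval ne) F _ (weak_evalB ne) sGY _ cF.
  apply: W => p [q [a [Gq a0 acvg ->]]].
  have [c c0 cS] := wsemi_weak_eval_le ne.
  have /choice[S SP] : forall n, exists S, SS S /\
      (fun g : X => wsemi D v S g) = q n.
    by move=> n; have [S SSS <-] := Gq n; exists S.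
  have Gq' n : GY (fun h : Y => wsemi DE v (S n) h).
    by exists (S n) => //; have [] := SP n.
  exists (fun h : Y => rsup [set: nat] (fun n => wsemi DE v (S n) h * a n)).
    by exists (fun n (h : Y) => wsemi DE v (S n) h), a.
  exists c => // h.
  have [M qM] := submixed_bound GXs (weak_eval ne h) Gq a0 acvg.
  have [M' qM'] := submixed_bound GYs h Gq' a0 acvg.
  apply/(rsup_leP qM); first by rewrite mulr_ge0 ?rsup_ge0 ?ltW.
  move=> n _; have [_ <-] := SP n.
  apply: (@le_trans _ _ (c * (wsemi DE v (S n) h * a n))).
    by rewrite mulrA ler_wpM2r.
  by rewrite ler_pM2l//; apply: (le_rsup qM').
(* Point evaluations are tau-continuous on the scalar space, so the tau-limit of the image filter
   has the values of the pointwise limit. *)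
have limE e (ne : norm_dual E e) (g : X) :
    (weak_eval ne @ F) --> (g : tspace (rtopology GX)) -> e \o f = g.
  move=> Fg; apply/funext => w; apply/eqP; rewrite -subr_eq0; apply/eqP.
  apply: rnorm_eq0; apply/eqP; rewrite eq_le rnorm_ge0 andbT.
  apply/ler_addgt0Pr => d d0; rewrite add0r.
  have [S SSS [c c0 cS]] := eval_scalar_bound w.
  have [c' [e' [c'0 be' ee']]] := norm_dual_scale ne.
  have d2 : 0 < d / 2 by rewrite divr_gt0.
  have GS : GX (fun f : X => wsemi D v S f) by exists S.
  have F1 : F [set h | wsemi D v S (weak_eval ne h - g) < d / 2 / c].
    exact: (Fg _ (nbhs_rseminorm_ball g (sX GS) GS (divr_gt0 d2 c0))).
  have F2 : F [set h : Y | rnorm (h w - f w) < d / 2 / c'].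
    have fw : nbhs (f w) [set y : E | rnorm (y - f w) < d / 2 / c'].
      by apply/nbhs_rnormP; exists (d / 2 / c') => //; exact: divr_gt0.
    exact: (fP w _ fw).
  have [h [/= h1 h2]] := filter_ex (filterI F1 F2).
  have h1' : rnorm (e (h w) - g w : K^o) < d / 2.
    apply: (le_lt_trans (cS (weak_eval ne h - g))).
    by rewrite mulrC -ltr_pdivlMr.
  have h2' : rnorm (e (f w) - e (h w) : K^o) < d / 2.
    rewrite -linearB ee' rnormM rnorm_of_real gtr0_norm// mulrC -ltr_pdivlMr//.
    apply: (le_lt_trans ((dual_ballP e').1 be' _)).
    by rewrite -rnormN opprB.
  have := ler_rnormD (e (f w) - e (h w) : K^o) (e (h w) - g w).
  rewrite subrKA /=; lra.
have Ff : Fv DE v f.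
  rewrite sigmaE => e ne; have [g Fg] := cvgX e ne.
  by rewrite (limE e ne g Fg); exact: weighted_funP.
pose f0 : Y := WeightedSpace (mem_set Ff).
exists f0; apply: cvg_rtopology => p Gp d d0.
(* The passage from weak to strong seminorms doubles d / 4, and d / 2 leaves room for the strict
   inequality. *)
have d4 : 0 < d / 4 by rewrite divr_gt0.
have [A FA Ap] := tvs_cauchy_rtopology sGY cF Gp d4.
have [q [a [Gq a0 acvg pE]]] := Gp.
apply: (filterS _ FA) => h Ah /=; apply: (@le_lt_trans _ _ (d / 2)); last lra.
have [M qM] := submixed_bound GYs (h - f0) Gq a0 acvg.
rewrite pE; apply/(rsup_leP qM); first lra.
move=> n _; have [S SSS qS] := Gq n; rewrite -qS.
have [an0|an0] := eqVneq (a n) 0; first by rewrite an0 mulr0; lra.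
have an : 0 < a n by rewrite lt_def an0 a0.
rewrite -ler_pdivlMr//.
apply: (@le_trans _ _ (2 * (d / 4 / a n))); last first.
  by rewrite mulrA ler_pM2r ?invr_gt0//; lra.
apply: (wsemi_le_weak Hi Hii); first exact: (weighted_funP (h - f0)).
  by rewrite divr_ge0// ltW.
move=> e be; have ne := be.1; have [g Fg] := cvgX e ne.
have -> : e \o (h - f0) = (weak_eval ne h - g : X).
  apply/funext => w /=; rewrite linearB /=.
  by have /(congr1 (fun u : Omega -> K^o => u w)) /= -> := limE e ne g Fg.
apply/ler_addgt0Pr => r r0.
have GS : GX (fun f : X => wsemi D v S f) by exists S.
have F1 : F [set h | wsemi D v S (weak_eval ne h - g) < r].
  exact: (Fg _ (nbhs_rseminorm_ball g (sX GS) GS r0)).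
(* The auxiliary [h'] may depend on [e], [S] and [r]; the Cauchy estimate between [h] and [h'] does
   not, so the bound survives the limit. *)
have [h' [/= h'g Ah']] := filter_ex (filterI F1 FA).
have dist := rsemi_dist (weak_eval ne h) (weak_eval ne h') g
  (rseminorm_wsemi D v S).
apply: (le_trans dist); apply: lerD; last exact: ltW.
rewrite -weak_evalB.
apply: (le_trans (wsemi_weak_le Hi Hii S be (weighted_funP (h - h')))).
rewrite ler_pdivlMr//; apply: le_trans (ltW (Ap h h' Ah Ah')).
rewrite pE; have [M' qM'] := submixed_bound GYs (h - h') Gq a0 acvg.
by have := @le_rsup _ _ _ _ _ n qM' I; rewrite -qS.
Qed.

Lemma weighted_complete_saks_space :
  complete_saks_space (weighted_norm DE v) (tau_topology DE v SS).
Proof.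
have tauY : tau_topology DE v SS = rtopology GY by rewrite /tau_topology
  tau_systemE.
rewrite tauY weighted_normE; split.
  apply: saks_family_space GYs _; exact: weighted_norm_eq0 Fv_normed.
move=> F FF cF.
have [|f Ff] := @submixed_complete F FF.
  move=> U U0; apply: cF.
  by move/coarserP: (submixed_coarser_mixed GYs); apply.
exists f; apply: (mixed_cauchy_cvg GYs) => //.
move=> U Uf; apply: Ff.
by move/coarserP: (tau_coarser_submixed GYs); apply.
Qed.

End completeness.

(** * Weights vanishing at infinity *)

Section compact_supports.
Local Open Scope ring_scope.

(** Otherwise the sets [B] for which [A] minus [B] has [P] form a proper filter; a cluster point in
    [A] contradicts the local hypothesis there. *)
Lemma compact_ind (T : topologicalType) (A : set T) (P : set T -> Prop) :
  compact A -> P set0 -> (forall B C, B `<=` C -> P C -> P B) ->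
  (forall B C, P B -> P C -> P (B `|` C)) ->
  (forall x, A x -> exists2 V, nbhs x V & P V) -> P A.
Proof.
move=> cA P0 PS PU PA; apply: contrapT => nPA.
pose F := [set B | P (A `\` B)].
have FF : ProperFilter F.
  split; first by rewrite /F /= setD0.
  split.
  - by rewrite /F /= setDT.
  - by move=> B C FB FC; rewrite /F /= setDIr; exact: PU.
  - by move=> B C BC; apply: PS; exact: setDS.
have [x [Ax clx]] : A `&` cluster F !=set0.
  by apply: cA; rewrite /F /= setDv.
have [V Vx PV] := PA x Ax.
have FAV : F (A `\` V).
  by apply: PS PV => y [Ay nAV]; apply: contrapT => Vy; apply: nAV.
by have [y [[_ nVy] Vy]] := clx _ _ FAV Vx.
Qed.

Lemma null_seq_finite_union (R : realType) (T : topologicalType) (a : R^nat) (A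
  : nat -> set T) (e : R) :
  (forall n, compact (A n)) -> a @ \oo --> 0 -> 0 < e ->
  exists2 B : set T, compact B &
    B = [set x | exists2 n, A n x & e <= a n].
Proof.
move=> cA acvg e0; have [n0 an0] := null_seq_lt acvg e0.
exists (\big[setU/set0]_(n <- iota 0 n0 | e <= a n) A n).
  by apply: bigsetU_compact => n _; exact: cA.
rewrite -bigcup_seq_cond; apply/seteqP; split=> x /=.
  by move=> [n /= /andP[_ en] Ax]; exists n.
move=> [n Ax en]; exists n => //=; rewrite en andbT mem_iota /= add0n.
by rewrite ltnNge; apply/negP => /an0; rewrite ltNge en.
Qed.

Context (R : realType) (T : topologicalType).
Hypotheses (crT : completely_regular_space T) (lcT : locally_compact [set: T]).

Definition bump_on (C : set T) : Prop := exists phi : T -> R,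
  [/\ continuous phi, forall x, 0 <= phi x <= 1, forall x, C x -> phi x = 1 &
      exists2 B, compact B & forall x, ~ B x -> phi x = 0].

Lemma bump_point (x : T) : exists2 V, nbhs x V & bump_on V.
Proof.
have [U Uw [cU clU]] := lcT (I : setT x).
have Ux : nbhs x U by move: Uw; rewrite /within /=; apply: filterS => y; apply.
have /= [f [cf f01 fx fU]] := (uniform_separatorP (R := R) _ _).1
  (crT (open_closedC (open_interior U)) (fun nUx => nUx Ux)).
have f1 y : ~ U y -> f y = 1.
  by move=> nUy; apply: fU; exists y => // /interior_subset.
have f0 : f x = 0 by apply: fx; exists x.
have f01' y : 0 <= f y <= 1.
  by have := f01 (f y) (ex_intro2 _ _ y I erefl); rewrite /= in_itv.
exists (f @^-1` [set r | r < 1 / 2]).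
  apply: cf; rewrite f0; apply: open_nbhs_nbhs; split; first exact: open_lt.
  by rewrite /=; lra.
(* With f = 0 at [x] and f = 1 off [U], truncating 2 (1 - f) at 1 gives the value 1 on a whole
   neighbourhood of [x], not only at [x]. *)
exists (fun y => Num.min 1 (2 * (1 - f y))); split.
- move=> y; apply: (@continuous_min R T (cst 1) (fun y => 2 * (1 - f y))).
    exact: cvg_cst.
  apply: cvgM; first exact: cvg_cst.
  by apply: cvgB; [exact: cvg_cst|exact: cf].
- move=> y; have /andP[h0 h1] := f01' y.
  by rewrite le_min ler01/= ge_min lexx/= andbT mulr_ge0// subr_ge0.
- by move=> y /= fy; apply/min_idPl; lra.
exists U => // y /f1 ->; rewrite subrr mulr0; apply/min_idPr; lra.
Qed.

Lemma bump_compact (A : set T) : compact A -> bump_on A.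
Proof.
move=> cA; apply: (compact_ind cA).
- exists (cst 0); split=> //.
  + by move=> x; exact: cvg_cst.
  + by move=> x; rewrite lexx ler01.
  + by exists set0 => //; exact: compact0.
- move=> B C BC [phi [cp p01 pC pB]]; exists phi; split=> // x /BC.
  exact: pC.
- move=> B C [phi [cp p01 pB [B' cB' pB']]] [psi [cq q01 qC [C' cC' qC']]].
  (* This is 1 - (1 - phi) (1 - psi). *)
  exists (fun x => phi x + psi x - phi x * psi x); split.
  + move=> x; apply: cvgB; last by apply: cvgM; [exact: cp|exact: cq].
    by apply: cvgD; [exact: cp|exact: cq].
  + by move=> x; have /andP[? ?] := p01 x; have /andP[? ?] := q01 x;
      apply/andP; nra.
  + by move=> x [/pB->|/qC->]; lra.
  exists (B' `|` C'); first exact: compactU.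
  move=> x /not_orP[/pB'-> /qC'->]; lra.
- by move=> x _; exact: bump_point.
Qed.

(** The supremum of the multiples [a n] of bump functions is continuous because, up to any given
    error, only finitely many of them matter. *)
Lemma dominating_continuous (a : R^nat) (A : nat -> set T) :
  (forall n, compact (A n)) -> (forall n, 0 <= a n) -> a @ \oo --> 0 ->
  exists2 w : T -> R, [/\ forall x, 0 <= w x, continuous w &
      forall e : R, 0 < e -> compact [set x | e <= w x]] &
    forall n x, A n x -> a n <= w x.
Proof.
move=> cA a0 acvg; have [M M0 aM] := null_seq_bounded a0 acvg.
have /choice[phi phiP] : forall n, exists phi : T -> R,
    [/\ continuous phi, forall x, 0 <= phi x <= 1, forall x, A n x ->
      phi x = 1 &
      exists2 B, compact B & forall x, ~ B x -> phi x = 0].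
  by move=> n; exact: (bump_compact (cA n)).
have p0 n x : 0 <= phi n x by have [_ /(_ x)/andP[]] := phiP n.
have p1 n x : phi n x <= 1 by have [_ /(_ x)/andP[]] := phiP n.
have pa n x : a n * phi n x <= a n by rewrite ler_piMr.
pose w (x : T) := rsup [set: nat] (fun n => a n * phi n x).
have paM x n : setT n -> a n * phi n x <= M.
  by move=> _; exact: le_trans (pa n x) (aM n).
have le_w n x : a n * phi n x <= w x by exact: (le_rsup (paM x)).
have w0 x : 0 <= w x by exact: rsup_ge0.
have cw : continuous w.
  move=> x; apply/cvgrPdist_le => e e0; have e2 : 0 < e / 2 by rewrite divr_gt0.
  have [n0 an0] := null_seq_lt acvg e2.
  have near_le m : nbhs x [set y | forall n, (n < m)%N ->
      `|a n * phi n x - a n * phi n y| <= e].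
    elim: m => [|m IH]; first by apply: filterS filterT => y _ n.
    have [cp _ _ _] := phiP m.
    have : (fun y => a m * phi m y) @ x --> a m * phi m x.
      by apply: cvgM; [exact: cvg_cst|exact: cp].
    move=> /cvgrPdist_le/(_ e e0) Hm.
    apply: filterS (filterI IH Hm) => y [h1 h2] n; rewrite ltnS leq_eqVlt.
    by move=> /orP[/eqP->//|]; exact: h1.
  apply: filterS (near_le n0) => y xy.
  have half u z : (forall n, (n < n0)%N ->
    a n * phi n u <= a n * phi n z + e) ->
      w u <= w z + e.
    move=> uz; apply/(rsup_leP (paM u)); first by rewrite addr_ge0// ltW.
    move=> n _; have [/an0 an|/uz h] := leqP n0 n.
      by have := pa n u; have := w0 z; lra.
    by have := le_w n z; lra.
  rewrite ler_distlC; apply/andP; split.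
    rewrite lerBlDr; apply: half => n nn0.
    by have := xy n nn0; rewrite ler_norml => /andP[]; lra.
  by apply: half => n nn0; have := xy n nn0; rewrite ler_norml => /andP[]; lra.
exists w.
  split=> // e e0; have e2 : 0 < e / 2 by rewrite divr_gt0.
  have /choice[B BP] : forall n, exists B : set T, compact B /\
      forall x, ~ B x -> phi n x = 0.
    by move=> n; have [_ _ _ [B cB pB]] := phiP n; exists B.
  have cB n : compact (B n) by have [] := BP n.
  (* Off the supports with e / 2 <= a n, all terms are at most e / 2, so the supremum cannot reach
     e. *)
  have [C cC CE] := null_seq_finite_union cB acvg e2.
  apply: (subclosed_compact _ cC).
    rewrite (_ : [set x | _] = w @^-1` [set r | e <= r])//.
    by apply: preimage_closed; [move=> x _; exact: cw|exact: closed_ge].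
  move=> x /= ew; rewrite CE; apply: contrapT => nB.
  suff : w x <= e / 2 by lra.
  apply/(rsup_leP (paM x)); first exact: ltW.
  move=> n _; have [Bx|nBx] := pselect (B n x).
    apply: (le_trans (pa n x)); rewrite leNgt; apply/negP => /ltW en.
    by apply: nB; exists n.
  by have [_ ->//] := BP n; rewrite mulr0 ltW.
move=> n x Ax; have [_ _ p1A _] := phiP n.
by apply: le_trans (le_w n x); rewrite p1A// mulr1.
Qed.

End compact_supports.

(** * Relations between the weight families, and dominating weights *)

Section weight_families.
Local Open Scope ring_scope.
Context (R : realType) (Lambda : choiceType) (t : topology Lambda).
Hypothesis hT : hausdorff_space (tspace t).
Local Notation T := (tspace t).

(** If [w] were unbounded, the sets {w >= n + 1} would generate a filter on the compact set {w >=
    1}; at a cluster point upper semicontinuity bounds [w] nearby. *)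
Lemma weights_usc0_b0 : weights_usc0 t `<=` @weights_b0 R Lambda t.
Proof.
move=> w [w0 wl wv]; split=> //; apply: contrapT => nM.
pose Z n := [set x : T | n.+1%:R <= w x].
have FF : ProperFilter (filter_from setT Z).
  apply: filter_from_proper.
    apply: filter_from_filter; first by exists 0%N.
    move=> i j _ _; exists (maxn i j) => // x; rewrite /Z /= => h.
    by split; apply: le_trans h; rewrite ler_nat ltnS ?leq_maxl ?leq_maxr.
  move=> n _; apply: contrapT => Zn; apply: nM; exists n.+1%:R => x.
  by rewrite leNgt; apply/negP => /ltW h; apply: Zn; exists x.
have [|x [_ clx]] := wv 1 ltr01 _ FF.
  by exists 0%N => // x; rewrite /Z /=.
have [|V Vx Vw] := wl x (- (w x + 1)).
  by rewrite lte_fin ltrN2; lra.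
have FZ : filter_from setT Z (Z (Num.truncn (w x + 1))).
  by exists (Num.truncn (w x + 1)).
have [y [Zy Vy]] := clx _ _ FZ Vx.
have := Vw y Vy; rewrite lte_fin ltrN2 ltNge => /negP; apply.
by apply: le_trans Zy; apply/ltW/truncnS_gt.
Qed.

Lemma weights_c0_usc0 : weights_c0 t `<=` @weights_usc0 R Lambda t.
Proof.
move=> w [w0 cw wv]; split=> //; apply/lower_semicontinuousP => a.
rewrite (_ : [set x | _] = (w : T -> R) @^-1` [set r | r < - a]).
  by apply: open_comp; [move=> x _; exact: cw|exact: open_lt].
by apply/seteqP; split=> x /=; rewrite lte_fin; lra.
Qed.

Lemma dominating_weight_usc0 (a : R^nat) (A : nat -> set T) :
  (forall n, compact (A n)) -> (forall n, 0 <= a n) -> a @ \oo --> 0 ->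
  exists2 w, weights_usc0 t w & forall n x, A n x -> a n <= w x.
Proof.
move=> cA a0 acvg; have [M M0 aM] := null_seq_bounded a0 acvg.
pose w (x : T) := rsup [set n | A n x] a.
have aM' x n : [set n | A n x] n -> a n <= M by move=> _; exact: aM.
have le_w n x : A n x -> a n <= w x by move=> Ax; exact: (le_rsup (aM' x)).
have wE e : 0 < e -> [set x | e <= w x] = [set x | exists2 n, A n x & e <= a n].
  move=> e0; apply/seteqP; split=> x /=; last first.
    by move=> [n Ax en]; exact: le_trans en (le_w n x Ax).
  move=> ew; apply: contrapT => nA.
  have ane n : A n x -> a n < e.
    by move=> Ax; rewrite ltNge; apply/negP => en; apply: nA; exists n.
  have [n0 an0] := null_seq_lt acvg (divr_gt0 e0 (ltr0Sn R 1)).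
  (* A supremum of terms below e is itself below e here: all but finitely many terms are below e /
     2, and [c] is the maximum of e / 2 and the finitely many others. *)
  pose c := \big[Num.max/(e / 2)]_(n <- iota 0 n0 | a n < e) a n.
  have ce : c < e.
    rewrite /c; elim/big_ind: _ => [|y z ye ze|n //]; first lra.
    by rewrite gt_max ye.
  have c0 : e / 2 <= c by rewrite /c; exact: bigmax_ge_id.
  suff : w x <= c by lra.
  apply/(rsup_leP (aM' x)); first by apply: le_trans c0; rewrite divr_ge0 ?ltW.
  move=> n Ax; have [/an0/ltW nn0|nn0] := leqP n0 n; first exact: le_trans c0.
  by apply: le_bigmax_seq => //; [rewrite mem_iota|exact: ane].
have wc e : 0 < e -> compact [set x | e <= w x].
  by move=> e0; rewrite wE//; have [B cB <-] :=
    null_seq_finite_union cA acvg e0.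
exists w => //; split=> //; first by move=> x; exact: rsup_ge0.
apply/lower_semicontinuousP => b.
have [b0|b0] := leP 0 b.
  rewrite (_ : [set x | _] = set0); first exact: open0.
  apply/seteqP; split=> x //=; rewrite lte_fin.
  by have := rsup_ge0 [set n | A n x] a; rewrite -/(w x); lra.
(* Upper semicontinuity follows from compactness of the superlevel sets, which are closed as the
   space is Hausdorff. *)
rewrite (_ : [set x | _] = ~` [set x | - b <= w x]).
  by apply: closed_openC; apply: compact_closed => //; apply: wc;
    rewrite oppr_gt0.
apply/seteqP; split=> x /=; rewrite lte_fin.
  by move=> h; apply/negP; rewrite -ltNge; lra.
by move=> /negP; rewrite -ltNge; lra.
Qed.

Lemma dominating_weight_c0 (a : R^nat) (A : nat -> set T) :
  completely_regular_space T -> locally_compact [set: T] ->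
  (forall n, compact (A n)) -> (forall n, 0 <= a n) -> a @ \oo --> 0 ->
  exists2 w, weights_c0 t w & forall n x, A n x -> a n <= w x.
Proof.
move=> crT lcT cA a0 acvg.
have [w [w0 cw wv] aw] := dominating_continuous crT lcT cA a0 acvg.
by exists w.
Qed.

End weight_families.

(** * The submixed topology as a weighted topology *)

Section weight_topologies.
Local Open Scope ring_scope.
Context (R : realType) (k : scalar_kind) (Omega : Type) (Lambda : pointedType).
Local Notation K := (scalars R k).
Context (v : Lambda -> {posnum R}) (E : normedModType K)
  (DE : weighted_data Omega Lambda E).
Context (t : topology Lambda) (SS : set (set Lambda)).
Hypotheses (hT : hausdorff_space (tspace t)).
Hypothesis (SSE : SS = [set S | compact (S : set (tspace t))]).
Local Notation Y := (weighted_space DE v).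

Let SSU : setU_closed SS.
Proof. by rewrite SSE => A B cA cB; exact: compactU. Qed.

Let SS1 x : SS [set x].
Proof. by rewrite SSE; exact: (@compact_set1 (tspace t)). Qed.

Let cov : \bigcup_(S in SS) S = setT.
Proof. by apply/seteqP; split=> // x _; exists [set x]. Qed.

Let SS0 : SS !=set0.
Proof. by exists [set point]. Qed.

Let GYs := wsystem_saks DE v SSU cov SS0.

Definition weight_semi (w : Lambda -> R) (f : Omega -> E) : R :=
  rsup [set: Lambda] (fun x => (wsem DE f + wterm DE v f x) * w x).

Let weight_bound w (f : Y) : weights_b0 t w -> exists M, forall x, setT x ->
  (wsem DE f + wterm DE v f x) * w x <= M.
Proof.
move=> [w0 [M wM] _]; exists (wsemi DE v setT f * M) => x _.
have Ff := weighted_funP f.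
apply: ler_pM => //; last exact: le_wsemi.
by rewrite addr_ge0 ?wterm_ge0// wsem_ge0//; case: Ff.
Qed.

Lemma weight_topologyE (W : set (Lambda -> R)) : W `<=` weights_b0 t ->
  weight_topology DE v W =
  rtopology [set (fun f : Y => weight_semi w f) | w in W].
Proof.
move=> Wb; rewrite /weight_topology /rtopology image_comp;
  congr seminorm_topology.
apply: eq_imagel => w Ww /=; apply/funext => f.
by have [M fM] := weight_bound f (Wb w Ww); rewrite -(nnsup_rsup fM).
Qed.

Lemma rseminorm_weight w : weights_b0 t w ->
  rseminorm (fun f : Y => weight_semi w f).
Proof.
move=> bw; have [w0 _ _] := bw; split=> [f g|a f].
  have [M fM] := weight_bound f bw; have [M' gM'] := weight_bound g bw.
  have [M'' fgM] := weight_bound (f + g) bw.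
  apply/(rsup_leP fgM); first by rewrite addr_ge0// rsup_ge0.
  move=> x _; have := le_rsup fM (I : setT x); have := le_rsup gM' (I : setT x).
  have [df _] := weighted_funP f; have [dg _] := weighted_funP g.
  have : (wsem DE (f + g) + wterm DE v (f + g) x) * w x <=
      (wsem DE f + wterm DE v f x) * w x + (wsem DE g + wterm DE v g x) * w x.
    rewrite -mulrDl ler_wpM2r// addrACA.
    by apply: lerD; [exact: wsemD|exact: wtermD].
  by rewrite -/(weight_semi w f) -/(weight_semi w g) /=; lra.
have [M fM] := weight_bound f bw; have [M' afM] := weight_bound (a *: f) bw.
have [df _] := weighted_funP f.
apply/(rsup_leP afM); first by rewrite mulr_ge0 ?rnorm_ge0 ?rsup_ge0.
move=> x _; rewrite wsemZ// wtermZ// -mulrDr -mulrA ler_wpM2l ?rnorm_ge0//.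
exact: (le_rsup fM).
Qed.

Lemma weight_le_submixed w : weights_b0 t w ->
  exists2 p, submixed_seminorms (wsystem DE v SS) p &
    forall f : Y, weight_semi w f <= p f.
Proof.
move=> bw; have [w0 [M0 wM0] wv] := bw.
pose M := `|M0| + 1; have Mp : 0 < M by rewrite ltr_wpDl.
have wM x : w x <= M by apply: le_trans (wM0 x) _; have := ler_norm M0;
  rewrite /M; lra.
(* For w x > 0, let n + 1 be the integer part of M / w x, which is at least 1 as [M] bounds [w].
   Then M / (n + 2) < w x <= M / (n + 1), so x lies in [A n] and w x <= a n. *)
pose A n := [set x : Lambda | M / n.+2%:R <= w x].
pose a n : R := M / n.+1%:R.
have a0 n : 0 <= a n by rewrite divr_ge0// ltW.
have acvg : a @ \oo --> 0.
  by rewrite -(mulr0 M); apply: cvgM; [exact: cvg_cst|exact: cvg_invS].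
have GA n : wsystem DE v SS (fun f : Y => wsemi DE v (A n) f).
  by exists (A n) => //; rewrite SSE; apply: wv; rewrite divr_gt0.
exists (fun f : Y => rsup [set: nat] (fun n => wsemi DE v (A n) f * a n)).
  by exists (fun n (f : Y) => wsemi DE v (A n) f), a.
move=> f; have [B fB] := weight_bound f bw; have Ff := weighted_funP f.
have [B' fB'] := submixed_bound GYs f GA a0 acvg.
apply/(rsup_leP fB); first exact: rsup_ge0.
move=> x _; have [wx|wx] := leP (w x) 0.
  rewrite (_ : w x = 0) ?mulr0 ?rsup_ge0//.
  by apply/eqP; rewrite eq_le wx w0.
have Mw1 : 1 <= M / w x by rewrite ler_pdivlMr// mul1r.
have Mw0 : 0 <= M / w x by rewrite divr_ge0// ltW.
have /andP[nl nu] := truncn_itv Mw0.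
have n1 : (0 < Num.truncn (M / w x))%N by rewrite truncn_gt0.
move: nl nu; rewrite -(prednK n1); set n := (_.-1) => nl nu.
apply: le_trans (le_rsup fB' (I : setT n)).
apply: ler_pM => //.
- by rewrite addr_ge0 ?wterm_ge0// wsem_ge0//; case: Ff.
- apply: le_wsemi => //; rewrite /A /= ler_pdivrMr// mulrC.
  by rewrite -ler_pdivrMr// ltW.
- by rewrite /a ler_pdivlMr// mulrC -ler_pdivlMr.
Qed.

Lemma submixed_weight_topology (W : set (Lambda -> R)) : W `<=` weights_b0 t ->
  (forall (a : R^nat) (A : nat -> set (tspace t)), (forall n, compact (A n)) ->
    (forall n, 0 <= a n) -> a @ \oo --> 0 ->
    exists2 w, W w & forall n x, A n x -> a n <= w x) ->
  submixed_topology (tau_system DE v SS) = weight_topology DE v W.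
Proof.
move=> Wb Wdom; rewrite tau_systemE (submixed_topologyE GYs) weight_topologyE//.
apply: topology_eqP; rewrite eqEsubset; split; apply: coarser_rtopology;
  last first.
  move=> _ [w Ww <-]; have [p Gp wp] := weight_le_submixed (Wb w Ww).
  exists p; split=> //; first exact: (rseminorm_submixed GYs).
  by exists 1 => // f; rewrite mul1r.
move=> p [q [a [Gq a0 acvg ->]]].
have /choice[S SP] : forall n, exists S, SS S /\
  (fun f : Y => wsemi DE v S f) = q n.
  by move=> n; have [S SSS <-] := Gq n; exists S.
(* The extra point keeps w away from 0, as q_S = q for empty S. *)
have [w Ww aw] : exists2 w, W w & forall n x, (S n `|` [set point]) x ->
  a n <= w x.
  apply: Wdom => // n; apply: compactU; last exact: (@compact_set1 (tspace t)).
  by have [] := SP n; rewrite SSE.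
have bw := Wb w Ww.
exists (fun f : Y => weight_semi w f); split; first by exists w.
  exact: rseminorm_weight.
exists 1 => // f; rewrite mul1r.
have [M fM] := submixed_bound GYs f Gq a0 acvg.
have [M' fM'] := weight_bound f bw; have Ff := weighted_funP f.
have q0 : 0 <= wsem DE f by rewrite wsem_ge0//; case: Ff.
have le_weight n x : (S n `|` [set point]) x ->
    (wsem DE f + wterm DE v f x) * a n <= weight_semi w f.
  move=> /aw awx; apply: le_trans (le_rsup fM' (I : setT x)).
  by rewrite ler_wpM2l// addr_ge0 ?wterm_ge0.
apply/(rsup_leP fM); first exact: rsup_ge0.
move=> n _; have [_ <-] := SP n.
have [an0|an0] := eqVneq (a n) 0; first by rewrite an0 mulr0 rsup_ge0.
have an : 0 < a n by rewrite lt_def an0 a0.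
rewrite -ler_pdivlMr//; apply/wsemi_leP => //.
  by rewrite divr_ge0// ?rsup_ge0.
split; rewrite ?ler_pdivlMr//.
  apply: le_trans (le_weight n point (or_intror erefl)).
  by rewrite ler_pM2r// lerDl wterm_ge0.
by move=> x Sx; rewrite ler_pdivlMr//; apply: le_weight; left.
Qed.

End weight_topologies.

Theorem proposition4p4 (R : realType) (k : scalar_kind)
    (Omega Lambda : pointedType) (v : Lambda -> {posnum R})
    (E : normedModType (scalars R k))
    (D : weighted_data Omega Lambda (scalars R k)^o)
    (DE : weighted_data Omega Lambda E)
    (Fv_normed : is_norm (weighted_norm D v))
    (* (i) *)
    (Hi : forall (e : {linear E -> (scalars R k)^o}) (f : Omega -> E),
      norm_dual E e -> Fv DE v f ->
      Fv D v (e \o f) /\ e \o wop DE f = wop D (e \o f))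
    (* (ii) *)
    (Hii : forall f : Omega -> E, Fv DE v f ->
      (wsem DE f)%:E = nnsup (dual_ball E) (fun e => (wsem D (e \o f))%:E)) :
  (* (a) *)
  [/\ [/\ submod_closed [in Fv DE v],
          submod_closed [in Fv_sigma E D v] &
          Fv DE v `<=` Fv_sigma E D v],
      forall f, Fv DE v f ->
        wnorm_sigma D v f <= wnorm DE v f <= 2%:E * wnorm_sigma D v f,
      is_norm (weighted_norm DE v) &
      (forall g, wdom D g -> wsem D g = 0%R) ->
        forall f, Fv DE v f -> wnorm_sigma D v f = wnorm DE v f] /\
  forall SS : set (set Lambda),
    setU_closed SS ->
    \bigcup_(S in SS) S = setT ->
    semi_montel_saks_space (weighted_norm D v)
      (tau_topology D v SS) ->
  [/\
    (* (b) *)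
    submixed_topology (tau_system DE v SS) =
      submixed_topology (sigma_system D v DE SS),
    (* (c) *)
    coarser (pointwise_topology D v) (tau_topology D v SS) ->
      Fv DE v = Fv_sigma E D v ->
      (forall F : set_system E, ProperFilter F -> cauchy F -> cvg F) ->
      tvs_complete (submixed_topology (tau_system DE v SS)) /\
      complete_saks_space (weighted_norm DE v)
        (tau_topology DE v SS) &
    (* (d) *)
    forall t : topology Lambda,
      hausdorff_space (tspace t) -> completely_regular_space (tspace t) ->
      SS = [set S | compact (S : set (tspace t))] ->
      [/\ submixed_topology (tau_system DE v SS) =
            weight_topology DE v (weights_b0 t),
          submixed_topology (tau_system DE v SS) =
            weight_topology DE v (weights_usc0 t) &
          locally_compact [set: tspace t] ->
          submixed_topology (tau_system DE v SS) =
            weight_topology DE v (weights_c0 t)]].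
Proof.
split.
  split.
  - split; [exact: Fv_submod|exact: Fv_sigma_submod|].
    exact: (Fv_sub_sigma Hi).
  - exact: (wnorm_weak Hi Hii).
  - rewrite weighted_normE; split=> [|f [f0]].
      exact/seminorm_EFin/rseminorm_wsemi.
    exact: (weighted_norm_eq0 Hi Hii Fv_normed f0).
  - by move=> q0 f; exact: (wnorm_weak_eq Hi Hii).
move=> SS SSU cov [_ Xmontel].
(* [Lambda] has a point, which the family covers. *)
have SS0 : SS !=set0.
  by have : [set: Lambda] point by []; rewrite -cov => -[S SSS _]; exists S.
have GYs := wsystem_saks DE v SSU cov SS0.
split.
- exact: (submixed_weak_strong Hi Hii SSU cov SS0).
- move=> ptau sigmaE E_complete; split.
    rewrite tau_systemE (submixed_topologyE GYs).
    exact: (submixed_complete Hi Hii SSU cov SS0 ptau sigmaE E_complete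
      Xmontel).
  exact: (weighted_complete_saks_space Fv_normed Hi Hii SSU cov SS0 ptau sigmaE
    E_complete Xmontel).
- move=> t hT crT SSE.
  have usc0b0 := weights_usc0_b0 (R := R) (t := t).
  split.
  + apply: (submixed_weight_topology _ _ SSE) => // a A cA a0 acvg.
    have [w uw aw] := dominating_weight_usc0 hT cA a0 acvg.
    by exists w => //; exact: usc0b0.
  + apply: (submixed_weight_topology _ _ SSE) => // a A cA a0 acvg.
    exact: dominating_weight_usc0.
  + move=> lcT; apply: (submixed_weight_topology _ _ SSE) => [|a A cA a0 acvg].
      by apply: subset_trans usc0b0; exact: weights_c0_usc0.
    exact: dominating_weight_c0.
Qed.
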